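(* Let $B$ be an $n$-dimensional ($n\ge1$) compact and orientable Riemannian manifold, $M$ an $m$-dimensional semi-Riemannian manifold of index $r=m-n\ge2$ with constant (sectional) curvature $c$, and $\pi:M\to B$ a semi-Riemannian submersion with totally umbilic fibres. Then: (i) $c\le0$; (ii) if $c=0$, then the fibres are totally geodesic and the horizontal distribution is integrable.
   Context: All manifolds are smooth and connected. A semi-Riemannian submersion $\pi:(M,g)\to(B,g')$ between semi-Riemannian manifolds is a smooth surjective map such that $\pi_*$ is onto at every point, the fibres $\pi^{-1}(b)$ are semi-Riemannian (nondegenerate) submanifolds of $M$, and $\pi_*$ preserves scalar products of vectors normal to fibres. Throughout, fibres are connected and of dimension $r=\dim M-\dim B>0$. Vectors tangent to fibres are vertical, vectors normal to fibres are horizontal; $h$ is the orthogonal projection onto the horizontal part; $\nabla$ is the Levi-Civita connection of $g$. For vertical $U,V$ put $T_UV=h\nabla_UV$; with $e_1,\dots,e_r$ a local orthonormal vertical frame, $g(e_i,e_j)=\varepsilon_i\delta_{ij}$, $\varepsilon_i\in\{-1,1\}$, put $H=\sum_i\varepsilon_iT_{e_i}e_i$. The fibres are totally umbilic if $T_UV=\frac1r g(U,V)H$ for all vertical $U,V$. Curvature: $R(E,F)G=\nabla_E\nabla_FG-\nabla_F\nabla_EG-\nabla_{[E,F]}G$; constant curvature $c$ means $R(E,F)G=c\,(g(F,G)E-g(E,G)F)$. *)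

(* Defs.v *)
From mathcomp Require Import all_boot all_order all_algebra.
From mathcomp Require Import all_classical all_reals all_analysis.

Set Implicit Arguments.
Unset Strict Implicit.
Unset Printing Implicit Defensive.

Import Order.TTheory GRing.Theory Num.Theory.
Import numFieldNormedType.Exports.

Local Open Scope classical_set_scope.
Local Open Scope ring_scope.

(** * Smooth manifolds *)

(* Only meant for open U: all iterated partial derivatives of order at most k
   exist and are continuous on U. *)
Fixpoint Ck_on {R : realType} {n : nat} (k : nat) (U : set 'rV[R]_n)
    (f : 'rV[R]_n -> R) : Prop :=
  (forall x, U x -> {for x, continuous f}) /\
  match k with
  | 0 => True
  | k'.+1 => forall i : 'I_n,
      (forall x, U x -> derivable f x (delta_mx 0 i)) /\
      Ck_on k' U ('D_(delta_mx 0 i) f)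
  end.

Definition smooth_on {R : realType} {n : nat} (U : set 'rV[R]_n)
    (f : 'rV[R]_n -> R) : Prop :=
  forall k : nat, Ck_on k U f.

(* The values of [coord] off [dom], and of [param] off the image of [dom], are
   irrelevant. *)
Record chart (R : realType) (n : nat) (T : topologicalType) := Chart {
  dom : set T;
  coord : T -> 'rV[R]_n;
  param : 'rV[R]_n -> T;
  dom_open : open dom;
  codom_open : open (coord @` dom);
  coordK : forall p, dom p -> param (coord p) = p;
  coord_continuous : forall p, dom p -> {for p, continuous coord};
  param_continuous :
    forall x, (coord @` dom) x -> {for x, continuous param}
}.

Definition transition {R : realType} {n : nat} {T : topologicalType}
    (a b : chart R n T) (x : 'rV[R]_n) : 'rV[R]_n :=
  coord b (param a x).

Definition overlap {R : realType} {n : nat} {T : topologicalType}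
    (a b : chart R n T) : set 'rV[R]_n :=
  coord a @` (dom a `&` dom b).

Definition smooth_transition {R : realType} {n : nat} {T : topologicalType}
    (a b : chart R n T) : Prop :=
  forall j : 'I_n, smooth_on (overlap a b) (fun x => transition a b x 0 j).

(* [atlas] need not be maximal. *)
Record manifold (R : realType) (n : nat) := Manifold {
  carrier :> topologicalType;
  atlas : set (chart R n carrier);
  manifold_nonempty : [set: carrier] !=set0;
  manifold_hausdorff : hausdorff_space carrier;
  manifold_second_countable : @second_countable carrier;
  manifold_connected : connected [set: carrier];
  atlas_cover : forall p : carrier, exists2 a, atlas a & dom a p;
  atlas_compatible :
    forall a b, atlas a -> atlas b -> smooth_transition a b
}.

Definition jacobian {R : realType} {n : nat} {T : topologicalType}
    (a b : chart R n T) (x : 'rV[R]_n) : 'M[R]_n :=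
  \matrix_(i, j) 'D_(delta_mx 0 i) (fun y => transition a b y 0 j) x.

(* The charts of the oriented atlas O belong to the maximal atlas of M. *)
Definition orientable {R : realType} {n : nat} (M : manifold R n) : Prop :=
  exists O : set (chart R n M),
    [/\ forall a b, O a -> atlas b ->
          smooth_transition a b /\ smooth_transition b a,
        forall p : M, exists2 a, O a & dom a p &
        forall a b, O a -> O b ->
          forall x, overlap a b x -> 0 < \det (jacobian a b x)].

Definition smooth_fun {R : realType} {n : nat} (M : manifold R n)
    (f : M -> R) : Prop :=
  forall a, atlas a -> smooth_on (coord a @` dom a) (f \o param a).

Definition smooth_map {R : realType} {m n : nat} (M : manifold R m)
    (N : manifold R n) (phi : M -> N) : Prop :=
  continuous phi /\
  forall (a : chart R m M) (b : chart R n N), atlas a -> atlas b ->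
    forall j : 'I_n,
      smooth_on (coord a @` (dom a `&` phi @^-1` dom b))
                (fun x => coord b (phi (param a x)) 0 j).

(** * Tangent vectors and vector fields *)

(* A tangent vector at p is a derivation at p of the algebra of smooth
   functions on M.  It is encoded as an operator on all functions M -> R; the
   value 0 is imposed on non-smooth functions so that equality of operators is
   equality of derivations. *)
Notation tvec R M := ((M -> R) -> R^o).
Notation field R M := (M -> tvec R M).

Definition tangent {R : realType} {n : nat} (M : manifold R n) (p : M) :
    set (tvec R M) :=
  [set v | [/\ forall f : M -> R, ~ smooth_fun f -> v f = 0,
               forall (a : R) (f h : M -> R), smooth_fun f -> smooth_fun h ->
                 v (fun q => a * f q + h q) = a * v f + v h &
               forall f h : M -> R, smooth_fun f -> smooth_fun h ->
                 v (fun q => f q * h q) = v f * h p + f p * v h]].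

Definition vector_field {R : realType} {n : nat} (M : manifold R n)
    (X : field R M) : Prop :=
  (forall p, tangent p (X p)) /\
  (forall f : M -> R, smooth_fun f -> smooth_fun (fun p => X p f : R)).

Definition bracket {R : realType} {n : nat} (M : manifold R n)
    (X Y : field R M) : field R M :=
  fun p f => X p (fun q => Y q f) - Y p (fun q => X q f).

(* The differential of phi.  Off the smooth functions it is cut off to 0, as
   f \o phi may be smooth even if f is not. *)
Definition pushforward {R : realType} {m n : nat} (M : manifold R m)
    (N : manifold R n) (phi : M -> N) (v : tvec R M) : tvec R N :=
  fun f => if `[< smooth_fun f >] then v (f \o phi) else 0.

(** * Semi-Riemannian metrics *)

(* [g p] is only relevant on tangent vectors at p. *)
Notation metric R M := (M -> tvec R M -> tvec R M -> R).

Definition metric_tensor {R : realType} {n : nat} (M : manifold R n)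
    (g : metric R M) : Prop :=
  [/\ forall p u v, tangent p u -> tangent p v -> g p u v = g p v u,
      forall p (a : R) u v w, tangent p u -> tangent p v -> tangent p w ->
        g p (a *: u + v) w = a * g p u w + g p v w &
      forall X Y : field R M, vector_field X -> vector_field Y ->
        smooth_fun (fun p => g p (X p) (Y p))].

Definition nondegenerate_on {R : realType} {n : nat} (M : manifold R n)
    (g : metric R M) (p : M) (W : set (tvec R M)) : Prop :=
  forall v, W v -> (forall w, W w -> g p v w = 0) -> v = 0.

(* Such a family is automatically linearly independent. *)
Definition spans_negative_definite {R : realType} {n : nat} (M : manifold R n)
    (g : metric R M) (p : M) (k : nat) (e : 'I_k -> tvec R M) : Prop :=
  (forall i, tangent p (e i)) /\
  forall a : 'I_k -> R, (exists i, a i != 0) ->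
    g p (\sum_i a i *: e i) (\sum_i a i *: e i) < 0.

Definition index_at {R : realType} {n : nat} (M : manifold R n)
    (g : metric R M) (p : M) (nu : nat) : Prop :=
  (exists e : 'I_nu -> tvec R M, spans_negative_definite g p e) /\
  (forall k (e : 'I_k -> tvec R M),
     spans_negative_definite g p e -> (k <= nu)%N).

Definition semi_riemannian {R : realType} {n : nat} (M : manifold R n)
    (g : metric R M) (nu : nat) : Prop :=
  [/\ metric_tensor g,
      forall p, nondegenerate_on g p (tangent p) &
      forall p, index_at g p nu].

Definition riemannian {R : realType} {n : nat} (M : manifold R n)
    (g : metric R M) : Prop :=
  metric_tensor g /\
  forall p v, tangent p v -> v != 0 -> 0 < g p v v.

(** * Levi-Civita connection and curvature *)

Notation connection R M := (field R M -> field R M -> field R M).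

Definition affine_connection {R : realType} {n : nat} (M : manifold R n)
    (D : connection R M) : Prop :=
  [/\ forall X Y, vector_field X -> vector_field Y -> vector_field (D X Y),
      forall (f : M -> R) X X' Y, smooth_fun f ->
        vector_field X -> vector_field X' -> vector_field Y ->
        forall p, D (fun q => f q *: X q + X' q) Y p
                  = f p *: D X Y p + D X' Y p,
      forall X Y Y', vector_field X -> vector_field Y -> vector_field Y' ->
        forall p, D X (fun q => Y q + Y' q) p = D X Y p + D X Y' p &
      forall (f : M -> R) X Y, smooth_fun f ->
        vector_field X -> vector_field Y ->
        forall p, D X (fun q => f q *: Y q) p
                  = (X p f : R) *: Y p + f p *: D X Y p].

Definition levi_civita {R : realType} {n : nat} (M : manifold R n)
    (g : metric R M) (D : connection R M) : Prop :=
  [/\ affine_connection D,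
      forall X Y, vector_field X -> vector_field Y ->
        forall p, D X Y p - D Y X p = bracket X Y p &
      forall X Y Z, vector_field X -> vector_field Y -> vector_field Z ->
        forall p, X p (fun q => g q (Y q) (Z q))
                  = g p (D X Y p) (Z p) + g p (Y p) (D X Z p)].

Definition curvature {R : realType} {n : nat} (M : manifold R n)
    (D : connection R M) (E F G : field R M) : field R M :=
  fun p => D E (D F G) p - D F (D E G) p - D (bracket E F) G p.

Definition constant_curvature {R : realType} {n : nat} (M : manifold R n)
    (g : metric R M) (D : connection R M) (c : R) : Prop :=
  forall E F G : field R M,
    vector_field E -> vector_field F -> vector_field G ->
    forall p, curvature D E F G p
              = c *: (g p (F p) (G p) *: E p - g p (E p) (G p) *: F p).

(** * Semi-Riemannian submersions *)

(* The tangent space of the fibre through p, namely the kernel of the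
   differential of pi at p. *)
Definition vertical {R : realType} {m n : nat} (M : manifold R m)
    (B : manifold R n) (pi : M -> B) (p : M) : set (tvec R M) :=
  [set v | tangent p v /\ pushforward pi v = 0].

Definition horizontal {R : realType} {m n : nat} (M : manifold R m)
    (B : manifold R n) (g : metric R M) (pi : M -> B) (p : M) :
    set (tvec R M) :=
  [set v | tangent p v /\ forall w, vertical pi p w -> g p v w = 0].

Definition semi_riemannian_submersion {R : realType} {m n : nat}
    (M : manifold R m) (B : manifold R n) (g : metric R M) (gB : metric R B)
    (pi : M -> B) : Prop :=
  [/\ smooth_map pi,
      forall b, exists p, pi p = b,
      forall p w, tangent (pi p) w ->
        exists2 v, tangent p v & pushforward pi v = w,
      forall p, nondegenerate_on g p (vertical pi p) &
      forall p v w, horizontal g pi p v -> horizontal g pi p w ->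
        gB (pi p) (pushforward pi v) (pushforward pi w) = g p v w].

Definition vertical_field {R : realType} {m n : nat} (M : manifold R m)
    (B : manifold R n) (pi : M -> B) (U : field R M) : Prop :=
  vector_field U /\ forall p, vertical pi p (U p).

(* The orthogonal projection h onto the horizontal part: the horizontal w such
   that v - w is vertical (unique since the fibres are nondegenerate). *)
Definition hproj {R : realType} {m n : nat} (M : manifold R m)
    (B : manifold R n) (g : metric R M) (pi : M -> B) (p : M)
    (v : tvec R M) : tvec R M :=
  xget 0 [set w | horizontal g pi p w /\ vertical pi p (v - w)].

Definition Ttensor {R : realType} {m n : nat} (M : manifold R m)
    (B : manifold R n) (g : metric R M) (D : connection R M) (pi : M -> B)
    (U V : field R M) : field R M :=
  fun p => hproj g pi p (D U V p).

(* A local orthonormal vertical frame around p.  Its members are taken to be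
   globally defined fields, orthonormal near p: every local frame has such an
   extension after shrinking its domain. *)
Definition vertical_frame_near {R : realType} {m n : nat} (M : manifold R m)
    (B : manifold R n) (g : metric R M) (pi : M -> B) (r : nat) (p : M)
    (e : 'I_r -> field R M) (eps : 'I_r -> R) : Prop :=
  [/\ forall i, vertical_field pi (e i),
      forall i, eps i = 1 \/ eps i = -1 &
      \forall q \near p, forall i j : 'I_r,
        g q (e i q) (e j q) = if i == j then eps i else 0].

(* The right-hand side does not depend on the frame. *)
Definition is_trace_T {R : realType} {m n : nat} (M : manifold R m)
    (B : manifold R n) (g : metric R M) (D : connection R M) (pi : M -> B)
    (r : nat) (H : field R M) : Prop :=
  forall p, exists (e : 'I_r -> field R M) (eps : 'I_r -> R),
    vertical_frame_near g pi p e eps /\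
    H p = \sum_i eps i *: Ttensor g D pi (e i) (e i) p.

Definition totally_umbilic_fibres {R : realType} {m n : nat}
    (M : manifold R m) (B : manifold R n) (g : metric R M)
    (D : connection R M) (pi : M -> B) (r : nat) : Prop :=
  exists H : field R M, is_trace_T g D pi r H /\
    forall U V, vertical_field pi U -> vertical_field pi V ->
      forall p, Ttensor g D pi U V p
                = (r%:R^-1 * g p (U p) (V p)) *: H p.

Definition totally_geodesic_fibres {R : realType} {m n : nat}
    (M : manifold R m) (B : manifold R n) (g : metric R M)
    (D : connection R M) (pi : M -> B) : Prop :=
  forall U V, vertical_field pi U -> vertical_field pi V ->
    forall p, Ttensor g D pi U V p = 0.

(** * Integrable distributions *)

(* N, injectively immersed in M by iota, is an integral manifold of Delta. *)
Definition integral_manifold {R : realType} {m k : nat} (M : manifold R m)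
    (Delta : M -> set (tvec R M)) (N : manifold R k) (iota : N -> M) : Prop :=
  [/\ smooth_map iota,
      injective iota,
      forall q v, tangent q v -> pushforward iota v = 0 -> v = 0 &
      forall q, pushforward iota @` tangent q = Delta (iota q)].

(* k is the rank of Delta. *)
Definition integrable_distribution {R : realType} {m : nat} (M : manifold R m)
    (k : nat) (Delta : M -> set (tvec R M)) : Prop :=
  forall p : M, exists (N : manifold R k) (iota : N -> M),
    integral_manifold Delta iota /\ exists q, iota q = p.

(* Main.v *)
(* Let N = H / r.  The Codazzi equation, together with r >= 2, makes F = g(N, N)
   constant along the fibres, so that F descends to the compact base and attains
   its maximum at some p.  The mixed O'Neill equation
     c g(U, U) g(X, X) = g(U, U) (g(D_X N, X) - g(N, X)^2) + g(h D_X U, h D_X U)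
   for U vertical and X horizontal, taken at p with X = N and g(U, U) < 0, gives
   (c + F) F <= 0.  The horizontal spaces are positive definite because B is
   Riemannian, whence F >= 0; so c >= 0 forces N = 0 everywhere.  The same
   equation with N = 0 then excludes c > 0, and for c = 0 it says that h D_X U = 0,
   i.e. that brackets of horizontal fields are horizontal.  Integral manifolds
   arise from the commuting horizontal lifts of coordinate fields of B. *)

(* Tangent vectors are derivations of the algebra of global smooth functions, so local data enter
   only after multiplication by a bump function, and Hadamard's lemma is what shows that coordinate
   fields span each tangent space. Gradients of functions pulled back from [B] are global and
   horizontal; they replace basic fields. Flows do the work of the inverse function theorem: along
   the flow of fields dual to given functions these functions grow linearly, so all nearby values
   are reached. With vertical fields this turns a vanishing vertical derivative into local constancy
   on fibres, which connectedness makes global; with horizontal lifts it shows that [pi] is open,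
   which makes the descended [F] continuous. Lifts of coordinate fields commute once brackets of
   horizontal fields are horizontal: such a bracket also kills the pulled-back coordinates, hence is
   vertical as well. Smooth dependence of a flow on its parameters is needed only for commuting
   fields, where the derivative of the time-one point is known in advance to be [A h]. *)
Require Import Defs.
From mathcomp Require Import all_boot all_order all_algebra.
From mathcomp Require Import perm ring lra.
From mathcomp Require Import all_classical all_reals all_analysis.

Set Implicit Arguments.
Unset Strict Implicit.
Unset Printing Implicit Defensive.

Import Order.TTheory GRing.Theory Num.Theory.
Import numFieldNormedType.Exports.
Import Defs.

Local Open Scope classical_set_scope.
Local Open Scope ring_scope.

(** * Calculus in several variables *)

Section calculus.
Context {R : realType}.
Implicit Types (n : nat).

Lemma Ck_onS n k (U : set 'rV[R]_n) f : Ck_on k.+1 U f -> Ck_on k U f.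
Proof.
elim: k f => [|k IH] f; first by case.
move=> [cf df]; split=> // i; have [dfi Cf] := df i.
by split=> //; exact: IH.
Qed.

Lemma Ck_on_le n j k (U : set 'rV[R]_n) f : (j <= k)%N -> Ck_on k U f -> Ck_on j U f.
Proof.
elim: k => [|k IH]; first by rewrite leqn0 => /eqP ->.
by rewrite leq_eqVlt => /predU1P[-> //|jk] /Ck_onS; exact: IH.
Qed.

Lemma Ck_on_sub n k (U V : set 'rV[R]_n) f : U `<=` V -> Ck_on k V f -> Ck_on k U f.
Proof.
move=> UV; elim: k f => [|k IH] f [cf df]; first by split=> // x /UV /cf.
split=> [x /UV /cf //|i]; have [dfi Cf] := df i.
by split; [move=> x /UV /dfi | exact: IH].
Qed.

Lemma near_eq_continuous n (f g : 'rV[R]_n -> R) x :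
  (\near x, f x = g x) -> {for x, continuous f} -> {for x, continuous g}.
Proof.
move=> fg cf; rewrite /prop_for /continuous_at -(nbhs_singleton fg).
exact: cvg_trans (near_eq_cvg fg) cf.
Qed.

(** Openness of [U] turns agreement on [U] into agreement near each of its points, so all
    derivatives agree too. *)
Lemma Ck_on_eq n k (U : set 'rV[R]_n) f g : open U -> (forall x, U x -> f x = g x) ->
  Ck_on k U f -> Ck_on k U g.
Proof.
move=> oU; elim: k f g => [|k IH] f g fg [cf df].
- have fgx x : U x -> \near x, f x = g x.
    by move=> Ux; near=> y; apply: fg; near: y; exact: open_nbhs_nbhs.
  by split=> // x Ux; apply: near_eq_continuous (fgx x Ux) (cf x Ux).
- have fgx x : U x -> \near x, f x = g x.
    by move=> Ux; near=> y; apply: fg; near: y; exact: open_nbhs_nbhs.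
  split=> [x Ux|i]; first exact: near_eq_continuous (fgx x Ux) (cf x Ux).
  have [dfi Cf] := df i; split=> [x Ux|].
    exact: near_eq_derivable (fgx x Ux) (dfi x Ux).
  by apply: IH Cf => x Ux; exact: near_eq_derive (fgx x Ux).
Unshelve. all: by end_near. Qed.

Lemma Ck_on_local n k (U : set 'rV[R]_n) f :
  (forall x, U x -> exists2 V, V x & Ck_on k V f) -> Ck_on k U f.
Proof.
elim: k f => [|k IH] f loc.
  by split=> // x /loc [V Vx [+ _]]; exact.
split=> [x /loc [V Vx [+ _]]|i]; first exact.
split=> [x /loc [V Vx [_ /(_ i)[+ _]]]|]; first exact.
by apply: IH => x /loc [V Vx [_ /(_ i)[_ ?]]]; exists V.
Qed.

Lemma line_derive n (f : 'rV[R]_n -> R) x v t :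
  derivable f (x + t *: v) v ->
  is_derive t 1 (fun s : R => f (x + s *: v)) ('D_v f (x + t *: v)).
Proof.
have E : (fun h : R => h^-1 *: (((fun s : R => f (x + s *: v)) \o shift t) (h *: 1) - f (x + t *: v)))
  = (fun h : R => h^-1 *: ((f \o shift (x + t *: v)) (h *: v) - f (x + t *: v))).
  apply/funext => h /=; congr (_ *: (f _ - _)).
  by rewrite [_%:A]mulr1 scalerDl addrCA.
by move=> d; split; rewrite /derivable /derive E.
Qed.

Lemma mvt_dir n (f : 'rV[R]_n -> R) x v :
  (forall t : R, 0 <= t <= 1 -> derivable f (x + t *: v) v) ->
  exists2 t : R, 0 <= t <= 1 & f (x + v) - f x = 'D_v f (x + t *: v).
Proof.
move=> df.
have := @MVT_segment R (fun s : R => f (x + s *: v)) (fun t => 'D_v f (x + t *: v)) 0 1 ler01.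
case.
- by move=> t; rewrite in_itv /= => /andP[t0 t1]; apply/line_derive/df; rewrite !ltW.
- apply: derivable_within_continuous => t; rewrite in_itv /= => t01.
  by have [] := line_derive (df t t01).
- move=> t; rewrite in_itv /= => t01; rewrite scale1r scale0r addr0 subr0 mulr1 => E.
  by exists t.
Qed.

Lemma derive_scale n (f : 'rV[R]_n -> R) x v c :
  derivable f x v -> is_derive x (c *: v) f (c * 'D_v f x).
Proof.
move=> d.
have d0 : derivable f (x + 0 *: v) v by rewrite scale0r addr0.
have [d1 D1] := line_derive d0; rewrite scale0r addr0 in D1.
have [d2 D2] : is_derive (0:R) 1 (fun s : R => f (x + (s * c) *: v)) (c * 'D_v f x).
  have L : is_derive (0:R) 1 (fun s : R => s * c) c.
    apply: is_derive_eq; by rewrite /GRing.scale /= mulr0 add0r mulr1.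
  have H : is_derive ((fun s : R => s * c) 0) (1:R) (fun s : R => f (x + s *: v)) ('D_v f x).
    by rewrite mul0r; split.
  rewrite mulrC; exact: (@is_derive1_comp R (fun s : R => f (x + s *: v)) (fun s : R => s * c)).
have E : (fun h : R => h^-1 *: ((f \o shift x) (h *: (c *: v)) - f x))
   = (fun h : R => h^-1 *: (((fun s : R => f (x + (s * c) *: v)) \o shift (0:R)) (h *: 1) - f (x + ((0:R) * c) *: v))).
  apply/funext => h /=; rewrite [_%:A]mulr1 mul0r scale0r !addr0 scalerA.
  by rewrite [_ + x]addrC.
by split; rewrite /derivable /derive E.
Qed.


Lemma is_derive_line n (f : 'rV[R]_n -> R) x v d :
  is_derive (0:R) 1 (fun s : R => f (x + s *: v)) d -> is_derive x v f d.
Proof.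
have E : (fun h : R => h^-1 *: (((fun s : R => f (x + s *: v)) \o shift (0:R)) (h *: 1) - f (x + (0:R) *: v)))
  = (fun h : R => h^-1 *: ((f \o shift x) (h *: v) - f x)).
  apply/funext => h /=; rewrite [_%:A]mulr1 addr0 scale0r addr0.
  by rewrite [x + _]addrC.
by move=> [d1 D1]; split; [move: d1|move: D1]; rewrite /derivable /derive E.
Qed.

(** The closed box with opposite corners [x] and [y]. A parameter for each coordinate spares any
    case distinction on the order of [x 0 i] and [y 0 i]. *)
Definition box n (x y z : 'rV[R]_n) :=
  forall i, exists2 t : R, 0 <= t <= 1 & z 0 i = x 0 i + t * (y 0 i - x 0 i).

Lemma box_ball n (c x y z : 'rV[R]_n) r :
  ball c r x -> ball c r y -> box x y z -> ball c r z.
Proof.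
move=> [r0 bx] [_ by_] bz; split=> // i j; rewrite (ord1 i) {i}.
have [t /andP[t0 t1] ->] := bz j; move: (bx 0 j) (by_ 0 j).
rewrite /ball /= => bx0 by0.
have -> : c 0 j - (x 0 j + t * (y 0 j - x 0 j)) = (1 - t) * (c 0 j - x 0 j) + t * (c 0 j - y 0 j).
  by ring.
apply: le_lt_trans (ler_normD _ _) _.
rewrite !normrM (ger0_norm t0) ger0_norm ?subr_ge0 //.
have [t00|t00] := eqVneq t 0.
  by rewrite t00 subr0 mul1r mul0r addr0.
have tp : 0 < t by rewrite lt_neqAle eq_sym t00.
have -> : r = (1 - t) * r + t * r by ring.
apply: ler_ltD; last by rewrite ltr_pM2l.
by apply: ler_wpM2l; [rewrite subr_ge0|exact: ltW].
Qed.

(** Walk from [x] to [y] along edges of the box, one coordinate at a time, with the one-variable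
    mean value theorem on each edge. Only partial derivatives are involved; the price is a different
    intermediate point for each coordinate. *)
Lemma mvt_box n (f : 'rV[R]_n -> R) x y :
  (forall z, box x y z -> forall i, derivable f z (delta_mx 0 i)) ->
  exists xi : 'I_n -> 'rV[R]_n, (forall i, box x y (xi i)) /\
    f y - f x = \sum_i 'D_(delta_mx 0 i) f (xi i) * (y 0 i - x 0 i).
Proof.
move=> df.
(* [z k] is the corner reached after the first [k] coordinates have been changed. *)
pose z k : 'rV[R]_n := \row_j (if (j < k)%N then y 0 j else x 0 j).
have zS (i : 'I_n) : z i.+1 = z i + (y 0 i - x 0 i) *: delta_mx 0 i.
  apply/rowP => j; rewrite !mxE eqxx /= ltnS leq_eqVlt.
  have [->|ji] := eqVneq j i; first by rewrite eqxx ltnn /= mulr1 addrC subrK.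
  by rewrite val_eqE (negbTE ji) /= mulr0 addr0.
have bz (i : 'I_n) (t : R) : 0 <= t <= 1 -> box x y (z i + t *: ((y 0 i - x 0 i) *: delta_mx 0 i)).
  move=> t01 j; rewrite !mxE eqxx /=.
  have [->|ji] := eqVneq j i; first by exists t => //; rewrite ltnn mulr1.
  rewrite !mulr0 addr0; case: ltnP => _; first by exists 1; rewrite ?lexx ?ler01 // mul1r addrC subrK.
  by exists 0; rewrite ?lexx ?ler01 // mul0r addr0.
have H (i : 'I_n) : exists xi, box x y xi /\ f (z i.+1) - f (z i) = 'D_(delta_mx 0 i) f xi * (y 0 i - x 0 i).
  rewrite zS.
  have [|t t01 ->] := @mvt_dir n f (z i) ((y 0 i - x 0 i) *: delta_mx 0 i).
    by move=> t t01; apply: ex_derive; apply: derive_scale; apply: df; exact: bz.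
  exists (z i + t *: ((y 0 i - x 0 i) *: delta_mx 0 i)); split; first exact: bz.
  have [_ ->] := @derive_scale n f (z i + t *: ((y 0 i - x 0 i) *: delta_mx 0 i)) (delta_mx 0 i) (y 0 i - x 0 i) (df _ (bz i t t01) i).
  by rewrite mulrC.
have [xi Hxi] := choice H.
exists xi; split=> [i|]; first by have [] := Hxi i.
have <- : z n = y by apply/rowP => j; rewrite mxE ltn_ord.
have -> : f x = f (z 0%N) by congr f; apply/rowP => j; rewrite mxE ltn0.
have := @telescope_sumr _ 0%N n (fun k => f (z k)) (leq0n n); rewrite big_mkord => <-.
by apply: eq_bigr => i _; have [_ ->] := Hxi i; rewrite mxE ltn_ord.
Qed.

Lemma ball_rVP n (x y : 'rV[R]_n) e : 0 < e ->
  ball x e y <-> forall j, `|x 0 j - y 0 j| < e.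
Proof.
move=> e0; split=> [[_ h] j|h]; first exact: (h 0 j).
by split=> // i j; rewrite (ord1 i); exact: h.
Qed.

Lemma cvg_rVP (T : Type) (F : set_system T) (FF : Filter F) n (g : T -> 'rV[R]_n) (y : 'rV[R]_n) :
  (g @ F --> y) <-> forall j, (fun t => g t 0 j) @ F --> y 0 j.
Proof.
split=> [h j|h].
  apply: (@cvg_comp _ _ _ g (fun z : 'rV[R]_n => z 0 j) F (nbhs y)) => //.
  exact: matrix_normedtype.coord_continuous.
apply/cvg_ballP => e e0.
have : \forall t \near F, forall j, `|y 0 j - g t 0 j| < e.
  apply: filter_forall => j.
  by have /cvgrPdist_lt/(_ e e0) := h j.
by apply: filterS => t ht; apply/ball_rVP.
Qed.

Lemma continuous_rV (T : topologicalType) n (g : T -> 'rV[R]_n) (x : T) :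
  (forall j, {for x, continuous (fun t => g t 0 j)}) -> {for x, continuous g}.
Proof. by move=> h; apply: (cvg_rVP (nbhs_filter x) g (g x)).2. Qed.

Lemma cvg_sumR (T : Type) (F : set_system T) (FF : Filter F) (I : Type) (r : seq I)
    (f : I -> T -> R) (l : I -> R) :
  (forall i, f i @ F --> l i) ->
  (fun t => \sum_(i <- r) f i t) @ F --> \sum_(i <- r) l i.
Proof.
move=> h; elim: r => [|i r IH].
  rewrite big_nil; under eq_fun do rewrite big_nil.
  exact: cvg_cst.
rewrite big_cons; under eq_fun do rewrite big_cons.
exact: cvgD.
Qed.

(** By [mvt_box] the difference quotient is a sum of partial derivatives at intermediate points
    times difference quotients of the coordinates. The intermediate points tend to [c t0], where the
    partial derivatives are continuous. *)
Lemma chain_curve n (f : 'rV[R]_n -> R) (U : set 'rV[R]_n) (c : R -> 'rV[R]_n) (dc : 'I_n -> R) t0 :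
  open U -> U (c t0) -> Ck_on 1 U f ->
  (forall j, is_derive t0 1 (fun t => c t 0 j) (dc j)) ->
  is_derive t0 1 (fun t => f (c t)) (\sum_j 'D_(delta_mx 0 j) f (c t0) * dc j).
Proof.
move=> oU Uc [cf df] dcj.
have cc : {for t0, continuous c}.
  apply/cvg_rVP => j; have [d _] := dcj j.
  by apply: (@differentiable_continuous _ _ _ _ (fun t => c t 0 j)); apply/derivable1_diffP.
have /nbhs_ballP[e e0 be] : nbhs (c t0) U by exact: open_nbhs_nbhs.
(* When the point of the curve is outside the ball a dummy value is used, so that [choice] gives
   intermediate points for every [h]. *)
have H h : exists xi : 'I_n -> 'rV[R]_n, (forall i, box (c t0) (c (h + t0)) (xi i)) /\
   (ball (c t0) e (c (h + t0)) ->
    f (c (h + t0)) - f (c t0) = \sum_i 'D_(delta_mx 0 i) f (xi i) * (c (h + t0) 0 i - c t0 0 i)).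
  have [b|nb] := pselect (ball (c t0) e (c (h + t0))).
    have [|xi [h1 h2]] := @mvt_box n f (c t0) (c (h + t0)); last by exists xi.
    move=> z bz i; have [+ _] := df i; apply; apply: be.
    by apply: box_ball bz => //; exact: ballxx.
  by exists (fun _ => c t0); split => // i j; exists 0; rewrite ?lexx ?ler01 // mul0r addr0.
have [xi Hxi] := choice H.
have cs : c (h + t0) @[h --> (0:R)] --> c t0.
  apply: (@cvg_comp _ _ _ (fun h => h + t0) c _ (nbhs t0)) => //.
  have E : (fun h : R => h + t0) @ (0:R) --> 0 + t0 by apply: cvgD; [exact: cvg_id|exact: cvg_cst].
  by rewrite add0r in E.
have xic i : xi h i @[h --> 0] --> c t0.
  apply/cvg_ballP => r r0; have /cvg_ballP/(_ r r0) := cs; apply: filterS => h bh.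
  have [/(_ i) bx _] := Hxi h; apply: box_ball bx => //; exact: ballxx.
have L : (fun h => \sum_i 'D_(delta_mx 0 i) f (xi h i) * (h^-1 *: (((fun t => c t 0 i) \o shift t0) (h *: 1) - c t0 0 i)))
    @ (0^') --> \sum_j 'D_(delta_mx 0 j) f (c t0) * dc j.
  apply: cvg_sumR => i; apply: cvgM.
    apply: cvg_within_filter.
    apply: (@cvg_comp _ _ _ (fun h => xi h i) ('D_(delta_mx 0 i) f) _ (nbhs (c t0))); first exact: xic.
    by have [_ [+ _]] := df i; apply.
  by have [d <-] := dcj i; exact: d.
have L2 : (fun h => h^-1 *: (((fun t => f (c t)) \o shift t0) (h *: 1) - f (c t0))) @ 0^' -->
   \sum_j 'D_(delta_mx 0 j) f (c t0) * dc j.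
  apply: cvg_trans L; apply: near_eq_cvg; apply: cvg_within.
  have /cvg_ballP/(_ e e0) := cs; apply: filterS => h bh.
  have [_ /(_ bh) /= E] := Hxi h.
  rewrite [_%:A]mulr1 E scaler_sumr; apply: eq_bigr => i _.
  by rewrite /GRing.scale /= mulrCA.
split; first by apply/cvg_ex; eexists; exact: L2.
by apply: cvg_lim => //; exact: L2.
Qed.


Lemma is_derive_comp m n (f : 'rV[R]_n -> R) (V : set 'rV[R]_n)
    (phi : 'rV[R]_m -> 'rV[R]_n) x v (dphi : 'I_n -> R) :
  open V -> V (phi x) -> Ck_on 1 V f ->
  (forall j, is_derive x v (fun y => phi y 0 j) (dphi j)) ->
  is_derive x v (fun y => f (phi y)) (\sum_j 'D_(delta_mx 0 j) f (phi x) * dphi j).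
Proof.
move=> oV Vx C1 dp; apply: is_derive_line.
have := @chain_curve n f V (fun s : R => phi (x + s *: v)) dphi 0.
rewrite scale0r addr0; apply=> // j.
have [d <-] := dp j.
have d0 : derivable (fun y => phi y 0 j) (x + 0 *: v) v by rewrite scale0r addr0.
by have := line_derive d0; rewrite scale0r addr0.
Qed.

Lemma is_derive_coord n (x v : 'rV[R]_n) j : is_derive x v (fun y : 'rV[R]_n => y 0 j) (v 0 j).
Proof.
apply: is_derive_line.
have -> : (fun s : R => (x + s *: v) 0 j) = (fun s : R => x 0 j + s * v 0 j).
  by apply/funext => s; rewrite !mxE.
by apply: is_derive_eq; rewrite /GRing.scale /= mulr0 !add0r mul1r mulr1.
Qed.

Lemma Ck_on_cst n k (U : set 'rV[R]_n) c : Ck_on k U (fun _ => c).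
Proof.
elim: k c => [|k IH] c; (split; [by move=> x _; exact: cst_continuous|]) => // i.
split=> [x _|]; first exact: derivable_cst.
have -> : 'D_(delta_mx 0 i) (fun _ : 'rV[R]_n => c) = (fun _ => 0); last exact: IH.
by apply/funext => x; exact: derive_cst.
Qed.

Lemma Ck_on_coord n k (U : set 'rV[R]_n) j : Ck_on k U (fun x => x 0 j).
Proof.
case: k => [|k]; (split; [by move=> x _; exact: matrix_normedtype.coord_continuous|]) => // i.
split=> [x _|].
  by have [] := is_derive_coord x (delta_mx 0 i) j.
have -> : 'D_(delta_mx 0 i) (fun x : 'rV[R]_n => x 0 j) = (fun _ => (delta_mx 0 i : 'rV[R]_n) 0 j).
  by apply/funext => x; have [] := is_derive_coord x (delta_mx 0 i) j.
exact: Ck_on_cst.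
Qed.

Section opensets.
Context {n : nat} {U : set 'rV[R]_n} (oU : open U).

Lemma Ck_onD k f g : Ck_on k U f -> Ck_on k U g -> Ck_on k U (fun x => f x + g x).
Proof.
elim: k f g => [|k IH] f g [cf df] [cg dg]; (split; [move=> x Ux; exact: (cvgD (cf x Ux) (cg x Ux))|]) => // i.
have [dfi Cf] := df i; have [dgi Cg] := dg i.
split=> [x Ux|]; first exact: derivableD (dfi x Ux) (dgi x Ux).
apply: Ck_on_eq (IH _ _ Cf Cg) => // x Ux.
by rewrite -(deriveD (dfi x Ux) (dgi x Ux)).
Qed.

Lemma Ck_onM k f g : Ck_on k U f -> Ck_on k U g -> Ck_on k U (fun x => f x * g x).
Proof.
elim: k f g => [|k IH] f g Cf Cg; have [cf df] := Cf; have [cg dg] := Cg;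
  (split; [move=> x Ux; exact: (cvgM (cf x Ux) (cg x Ux))|]) => // i.
have [dfi Cdf] := df i; have [dgi Cdg] := dg i.
split=> [x Ux|]; first exact: derivableM (dfi x Ux) (dgi x Ux).
apply: Ck_on_eq (Ck_onD (IH _ _ (Ck_onS Cf) Cdg) (IH _ _ (Ck_onS Cg) Cdf)) => // x Ux.
by rewrite -(deriveM (dfi x Ux) (dgi x Ux)).
Qed.

Lemma Ck_on_sum k (I : Type) (r : seq I) (f : I -> 'rV[R]_n -> R) :
  (forall i, Ck_on k U (f i)) -> Ck_on k U (fun x => \sum_(i <- r) f i x).
Proof.
move=> h; elim: r => [|i r IH].
  by under eq_fun do rewrite big_nil; exact: Ck_on_cst.
by under eq_fun do rewrite big_cons; exact: Ck_onD.
Qed.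

Lemma Ck_on_prod k (I : Type) (r : seq I) (f : I -> 'rV[R]_n -> R) :
  (forall i, Ck_on k U (f i)) -> Ck_on k U (fun x => \prod_(i <- r) f i x).
Proof.
move=> h; elim: r => [|i r IH].
  by under eq_fun do rewrite big_nil; exact: Ck_on_cst.
by under eq_fun do rewrite big_cons; exact: Ck_onM.
Qed.

Lemma Ck_onV k f : (forall x, U x -> f x != 0) -> Ck_on k U f -> Ck_on k U (fun x => (f x)^-1).
Proof.
move=> f0; elim: k => [|k IH] Cf; have [cf df] := Cf;
  (split; [by move=> x Ux; exact: (cvgV (f0 x Ux) (cf x Ux))|]) => // i.
have [dfi Cdf] := df i.
split=> [x Ux|]; first by apply: derivableV; [exact: f0|exact: dfi].
have Cf' := IH (Ck_onS Cf).
apply: Ck_on_eq (Ck_onM (Ck_on_cst k _ (-1)) (Ck_onM Cdf (Ck_onM Cf' Cf'))) => // x Ux.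
rewrite deriveV; [|exact: f0|exact: dfi].
by rewrite expr2 invfM /GRing.scale /= mulN1r mulNr mulrC.
Qed.

(** Induction on [k]: the chain rule writes a partial derivative of the composite as a sum of
    products to which the induction hypothesis applies. *)
Lemma Ck_on_comp m k (V : set 'rV[R]_m) (f : 'rV[R]_m -> R) (phi : 'rV[R]_n -> 'rV[R]_m) :
  open V -> (forall x, U x -> V (phi x)) -> (forall j, Ck_on k U (fun x => phi x 0 j)) ->
  Ck_on k V f -> Ck_on k U (fun x => f (phi x)).
Proof.
move=> oV UV; elim: k f => [|k IH] f Cp Cf; have [cf df] := Cf.
- split=> // x Ux; apply: (@continuous_comp _ _ _ phi f x); last exact/cf/UV.
  by apply: continuous_rV => j; have [+ _] := Cp j; apply.
- have dc x i : U x -> is_derive x (delta_mx 0 i) (fun y => f (phi y))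
     (\sum_j 'D_(delta_mx 0 j) f (phi x) * 'D_(delta_mx 0 i) (fun y => phi y 0 j) x).
    move=> Ux; apply: (@is_derive_comp _ _ _ V) => //; first exact: UV.
      exact: Ck_on_le Cf.
    by move=> j; apply: derivableP; have [_ /(_ i) [+ _]] := Cp j; apply.
  split=> [x Ux|i].
    apply: (@continuous_comp _ _ _ phi f x); last exact/cf/UV.
    by apply: continuous_rV => j; have [+ _] := Cp j; apply.
  split=> [x Ux|]; first by have [] := dc x i Ux.
  have C2 : Ck_on k U (fun x => \sum_j 'D_(delta_mx 0 j) f (phi x) * 'D_(delta_mx 0 i) (fun y => phi y 0 j) x).
    apply: Ck_on_sum => j; apply: Ck_onM; last by have [_ /(_ i) []] := Cp j.
    have [_ dfj] := df j.
    by apply: (IH ('D_(delta_mx 0 j) f)) => // l; exact: Ck_onS.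
  by apply: Ck_on_eq C2 => // x Ux; have [] := dc x i Ux.
Qed.

End opensets.

End calculus.

(** * Smooth functions on open sets *)

Section smooth_on.
Context {R : realType} {n : nat}.
Implicit Types (U : set 'rV[R]_n) (f g : 'rV[R]_n -> R).

Lemma smooth_on_continuous U f : smooth_on U f -> forall x, U x -> {for x, continuous f}.
Proof. by move=> /(_ 0%N) []. Qed.

Lemma smooth_on_derivable U f : smooth_on U f ->
  forall x i, U x -> derivable f x (delta_mx 0 i).
Proof. by move=> /(_ 1%N) [_ df] x i Ux; have [+ _] := df i; apply. Qed.

Lemma smooth_on_derive U f i : smooth_on U f -> smooth_on U ('D_(delta_mx 0 i) f).
Proof. by move=> sf k; have [_ /(_ i) []] := sf k.+1. Qed.

Lemma smooth_on_sub U V f : U `<=` V -> smooth_on V f -> smooth_on U f.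
Proof. by move=> UV sf k; exact: Ck_on_sub UV (sf k). Qed.

Lemma smooth_on_eq U f g : open U -> (forall x, U x -> f x = g x) ->
  smooth_on U f -> smooth_on U g.
Proof. by move=> oU fg sf k; exact: Ck_on_eq (sf k). Qed.

Lemma smooth_on_local U f :
  (forall x, U x -> exists2 V, V x & smooth_on V f) -> smooth_on U f.
Proof. by move=> loc k; apply: Ck_on_local => x /loc [V Vx /(_ k)]; exists V. Qed.

Lemma smooth_on_cst U c : smooth_on U (fun _ => c).
Proof. by move=> k; exact: Ck_on_cst. Qed.

Lemma smooth_on_coord U j : smooth_on U (fun x => x 0 j).
Proof. by move=> k; exact: Ck_on_coord. Qed.

Lemma smooth_onD U f g : open U -> smooth_on U f -> smooth_on U g ->
  smooth_on U (fun x => f x + g x).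
Proof. by move=> oU sf sg k; exact: Ck_onD (sf k) (sg k). Qed.

Lemma smooth_onM U f g : open U -> smooth_on U f -> smooth_on U g ->
  smooth_on U (fun x => f x * g x).
Proof. by move=> oU sf sg k; exact: Ck_onM (sf k) (sg k). Qed.

Lemma smooth_on_sum U (I : Type) (r : seq I) (f : I -> 'rV[R]_n -> R) : open U ->
  (forall i, smooth_on U (f i)) -> smooth_on U (fun x => \sum_(i <- r) f i x).
Proof. by move=> oU sf k; apply: Ck_on_sum => // i; exact: sf. Qed.

Lemma smooth_on_prod U (I : Type) (r : seq I) (f : I -> 'rV[R]_n -> R) : open U ->
  (forall i, smooth_on U (f i)) -> smooth_on U (fun x => \prod_(i <- r) f i x).
Proof. by move=> oU sf k; apply: Ck_on_prod => // i; exact: sf. Qed.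

Lemma smooth_onV U f : open U -> (forall x, U x -> f x != 0) -> smooth_on U f ->
  smooth_on U (fun x => (f x)^-1).
Proof. by move=> oU f0 sf k; exact: Ck_onV (sf k). Qed.

Lemma smooth_on_comp m U (V : set 'rV[R]_m) (f : 'rV[R]_m -> R) (phi : 'rV[R]_n -> 'rV[R]_m) :
  open U -> open V -> (forall x, U x -> V (phi x)) ->
  (forall j, smooth_on U (fun x => phi x 0 j)) ->
  smooth_on V f -> smooth_on U (fun x => f (phi x)).
Proof.
by move=> oU oV UV sp sf k; apply: Ck_on_comp (sf k) => // j; exact: sp.
Qed.

Lemma is_derive_comp1 (th : R -> R) f x v d :
  is_derive (f x) 1 th d -> derivable f x v ->
  is_derive x v (fun y => th (f y)) (d * 'D_v f x).
Proof.
move=> dth df; apply: is_derive_line.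
have d0 : derivable f (x + 0 *: v) v by rewrite scale0r addr0.
have D := line_derive d0; rewrite scale0r addr0 in D.
have dth' : is_derive ((fun s : R => f (x + s *: v)) 0) 1 th d by rewrite scale0r addr0.
exact: (@is_derive1_comp R th (fun s : R => f (x + s *: v))).
Qed.

End smooth_on.

(** * Bump functions and Hadamard's lemma *)

Section bump.
Context {R : realType}.

(* The family t^-k exp(-1/t), extended by 0, is closed under differentiation. *)
Definition flat (k : nat) (t : R) : R := if 0 < t then t^-1 ^+ k * expR (- t^-1) else 0.

Lemma flat_gt0 k t : 0 < t -> 0 < flat k t.
Proof. by move=> t0; rewrite /flat t0 mulr_gt0 ?expR_gt0 ?exprn_gt0 ?invr_gt0. Qed.

Lemma flat_le0 k t : t <= 0 -> flat k t = 0.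
Proof. by move=> t0; rewrite /flat ltNge t0. Qed.

Lemma flat_ge0 k t : 0 <= flat k t.
Proof. by have [/flat_le0 ->//|/flat_gt0 /ltW] := leP t 0. Qed.

(** For positive [t] the exponential series gives [expR t^-1 >= t^-1 ^+ k.+1 / k.+1!], so one power
    of [t] is left over. This linear bound is what makes [flat] differentiable at 0. *)
Lemma flat_bound k t : `|flat k t| <= k.+1`!%:R * `|t|.
Proof.
rewrite ger0_norm ?flat_ge0 //.
have [t0|t0] := leP t 0; first by rewrite flat_le0 // mulr_ge0.
rewrite /flat t0 gtr0_norm // expRN.
have ti : 0 <= t^-1 by rewrite invr_ge0 ltW.
have := expR_ge1Dxn k ti => h.
have h2 : t^-1 ^+ k.+1 / k.+1`!%:R <= expR t^-1 by apply: le_trans h; rewrite lerDr.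
have f0 : 0 < k.+1`!%:R :> R by rewrite ltr0n fact_gt0.
rewrite ler_pdivrMr ?expR_gt0 //.
have -> : t^-1 ^+ k = k.+1`!%:R * t * (t^-1 ^+ k.+1 / k.+1`!%:R).
  rewrite exprS; field; by rewrite gt_eqF //= gt_eqF.
by apply: ler_wpM2l => //; rewrite mulr_ge0 // ltW.
Qed.

(** At 0 the difference quotient of [flat k] is exactly [flat k.+1], which [flat_bound] sends to
    0. *)
Lemma is_derive_flat k (t : R) : is_derive t 1 (flat k) (- k%:R * flat k.+1 t + flat k.+2 t).
Proof.
have [t0|t0|->] := ltgtP t 0.
- rewrite !flat_le0 ?ltW // mulr0 addr0.
  apply: (@near_eq_is_derive _ _ _ (fun _ => 0)).
    near=> s; rewrite flat_le0 //; apply: ltW; near: s.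
    by apply: (@open_lt R 0) => //; exact: nbhs_left_lt.
- have tn : t != 0 by rewrite gt_eqF.
  apply: (@near_eq_is_derive R R^o R^o (fun s : R => s^-1 ^+ k * expR (- s^-1) : R^o)).
    near=> s; rewrite /flat ifT //; near: s.
    by apply: open_nbhs_nbhs; split => //; exact: open_gt.
  have d1 : is_derive t (1:R) (fun s : R => s^-1) (- t^-1 ^+ 2).
    have := @is_deriveV _ id t 1 1 tn (is_derive_id _ _).
    by rewrite [_ *: 1]mulr1 exprVn.
  have d2 : is_derive t (1:R) (fun s : R => s^-1 ^+ k) (k%:R * t^-1 ^+ k.-1 * - t^-1 ^+ 2).
    have d5 : is_derive t^-1 (1:R) (fun y : R => y ^+ k) (k%:R * t^-1 ^+ k.-1).
      by split; [exact: exprn_derivable|rewrite exp_derive [_ *: 1]mulr1].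
    exact: (@is_derive1_comp R (fun y => y ^+ k) (fun s => s^-1) t _ _ d5 d1).
  have d3 : is_derive t (1:R) (fun s : R => expR (- s^-1)) (expR (- t^-1) * t^-1 ^+ 2).
    have d4 := @is_deriveN _ _ _ _ t 1 _ d1; rewrite opprK in d4.
    exact: (@is_derive1_comp R expR (fun s => - s^-1) t _ _ (is_derive_expR _) d4).
  have := @is_deriveM _ _ _ _ t 1 _ _ d2 d3.
  set a := (X in is_derive _ _ _ X -> _); set b := (X in _ -> is_derive _ _ _ X).
  suff -> : a = b by [].
  rewrite /a /b /flat t0 /GRing.scale /=.
  by case: k {a b d2 d3} => [|k] /=; rewrite !exprS ?expr0; field.
- have F0 j : flat j 0 = 0 by rewrite flat_le0.
  have L : h^-1 *: ((flat k \o shift 0) (h *: 1) - flat k 0) @[h --> (0:R)^'] --> (0:R).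
    apply/cvgr0Pnorm_lt => e e0.
    have C0 : 0 < k.+2`!%:R :> R by rewrite ltr0n fact_gt0.
    near=> h.
    have -> : h^-1 *: ((flat k \o shift 0) (h *: 1) - flat k 0) = flat k.+1 h.
      rewrite /= F0 subr0 addr0 [h%:A]mulr1 /flat; case: ifP => _; last by rewrite scaler0.
      by rewrite exprS -mulrA.
    apply: le_lt_trans (flat_bound _ _) _.
    rewrite mulrC -ltr_pdivlMr //; near: h; apply: dnbhs0_lt; exact: divr_gt0.
  rewrite !F0 mulr0 addr0; split; first by apply/cvg_ex; exists 0; exact: L.
  by apply: cvg_lim => //; exact: L.
Unshelve. all: by end_near. Qed.

Lemma Ck_on_flat n k j (U : set 'rV[R]_n) f : open U -> Ck_on k U f ->
  Ck_on k U (fun x => flat j (f x)).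
Proof.
move=> oU; elim: k j => [|k IH] j Cf; have [cf df] := Cf.
all: split; first by move=> x Ux; apply: (@continuous_comp _ _ _ f (flat j) x);
  [exact: cf | apply: differentiable_continuous; apply/derivable1_diffP;
   have [] := is_derive_flat j (f x)].
- by [].
- move=> i; have [dfi Cdf] := df i; split=> [x Ux|].
    by have [] := is_derive_comp1 (is_derive_flat j (f x)) (dfi x Ux).
  have C1 := Ck_onM oU (Ck_onD oU (Ck_onM oU (Ck_on_cst k U (- j%:R)) (IH j.+1 (Ck_onS Cf))) (IH j.+2 (Ck_onS Cf))) Cdf.
  apply: Ck_on_eq C1 => // x Ux.
  by have [_ ->] := is_derive_comp1 (is_derive_flat j (f x)) (dfi x Ux).
Qed.

(** The smooth step from 0 on the negative axis to 1 beyond 1. The denominator is positive because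
    [t] and [1 - t] are never both nonpositive. *)
Definition plateau (t : R) : R := flat 0 t / (flat 0 t + flat 0 (1 - t)).

Lemma plateau_den t : 0 < flat 0 t + flat 0 (1 - t).
Proof.
have [t0|t0] := leP t 0; last by rewrite ltr_wpDr ?flat_ge0 ?flat_gt0.
by rewrite ltr_wpDl ?flat_ge0 ?flat_gt0 // subr_gt0 (le_lt_trans t0) ?ltr01.
Qed.

Lemma plateau0 t : t <= 0 -> plateau t = 0.
Proof. by move=> t0; rewrite /plateau flat_le0 // mul0r. Qed.

Lemma plateau1 t : 1 <= t -> plateau t = 1.
Proof.
move=> t1; rewrite /plateau (@flat_le0 _ (1 - t)) ?subr_le0 // addr0 divff //.
by rewrite gt_eqF // flat_gt0 // (lt_le_trans ltr01).
Qed.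

Lemma smooth_on_plateau n (U : set 'rV[R]_n) f : open U -> smooth_on U f ->
  smooth_on U (fun x => plateau (f x)).
Proof.
move=> oU sf; apply: smooth_onM => //; first by move=> k; exact: Ck_on_flat.
apply: smooth_onV => //; first by move=> x _; rewrite gt_eqF // plateau_den.
apply: smooth_onD => // k; apply: Ck_on_flat => //.
have : smooth_on U (fun x => 1 + (-1) * f x).
  apply: smooth_onD => //; first exact: smooth_on_cst.
  by apply: smooth_onM => //; exact: smooth_on_cst.
by move/(_ k); under eq_fun do rewrite mulN1r.
Qed.

Lemma bump_rV n (x0 : 'rV[R]_n) r : 0 < r ->
  exists b : 'rV[R]_n -> R, [/\ smooth_on setT b,
    exists2 r', 0 < r' & forall x, ball x0 r' x -> b x = 1 &
    forall x, b x != 0 -> ball x0 r x].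
Proof.
move=> r0; pose d := r / 2; have d0 : 0 < d by rewrite divr_gt0.
(* At distance at most [d] in coordinate [j], [q] is at least 1 and the plateau is 1; at distance at
   least [2 * d = r], [q] is negative and the plateau is 0. The square keeps [q] smooth where an
   absolute value would not. *)
pose q (x : 'rV[R]_n) j := 2 - ((x 0 j - x0 0 j) / d) ^+ 2.
exists (fun x => \prod_j plateau (q x j)); split.
- apply: smooth_on_prod => [|j]; first exact: openT.
  apply: smooth_on_plateau; first exact: openT.
  have L : smooth_on setT (fun x : 'rV[R]_n => (x 0 j + - x0 0 j) * d^-1).
    apply: smooth_onM; [exact: openT| |exact: smooth_on_cst].
    by apply: smooth_onD; [exact: openT|exact: smooth_on_coord|exact: smooth_on_cst].
  have : smooth_on setT (fun x : 'rV[R]_n => 2 + (-1) * (((x 0 j + - x0 0 j) * d^-1) * ((x 0 j + - x0 0 j) * d^-1))).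
    apply: smooth_onD; [exact: openT|exact: smooth_on_cst|].
    apply: smooth_onM; [exact: openT|exact: smooth_on_cst|].
    by apply: smooth_onM => //; exact: openT.
  apply: smooth_on_eq; first exact: openT.
  by move=> x _; rewrite /q expr2 mulN1r.
- exists d => // x /ball_rVP; move=> /(_ d0) bx.
  apply: big1 => j _; apply: plateau1; rewrite /q.
  have h : `|(x 0 j - x0 0 j) / d| <= 1.
    by rewrite normrM normfV (gtr0_norm d0) ler_pdivrMr // mul1r distrC ltW.
  have := ler_norml ((x 0 j - x0 0 j) / d) 1; rewrite h => /esym/andP[h1 h2].
  nra.
- move=> x; apply: contraNP => nb.
  have [j hj] : exists j, r <= `|x0 0 j - x 0 j|.
    apply: contrapT => H; apply: nb; apply/ball_rVP => // j.
    by rewrite ltNge; apply/negP => h; apply: H; exists j.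
  rewrite (bigD1 j) //= plateau0 ?mul0r // /q.
  have h : 2 <= `|(x 0 j - x0 0 j) / d|.
    by rewrite normrM normfV (gtr0_norm d0) ler_pdivlMr // distrC /d mulrC divfK.
  rewrite -real_normK ?num_real //; nra.
Qed.

End bump.

(** * Hadamard's lemma by integration along segments *)

Section hadamard.
Context {R : realType} {n : nat}.
Implicit Types (x y : 'rV[R]_n) (f psi : 'rV[R]_n -> R).

(** Balls of the sup norm are cubes, and the closed cube of radius [rho] is compact inside the ball
    of radius [r]. *)
Lemma bounded_ball psi (x0 : 'rV[R]_n) (rho r : R) : 0 < rho -> rho < r ->
  (forall x, ball x0 r x -> {for x, continuous psi}) ->
  exists2 C : R, 0 <= C & forall x, ball x0 rho x -> `|psi x| <= C.
Proof.
move=> rho0 rr cpsi.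
pose A : set 'rV[R]_n := [set v | forall i, `[x0 0 i - rho, x0 0 i + rho]%classic (v 0 i)].
have r0 : 0 < r by exact: lt_trans rr.
have cA : compact A.
  by apply: (@rV_compact R n (fun i => `[x0 0 i - rho, x0 0 i + rho]%classic)) => i; exact: segment_compact.
have A0 : A !=set0 by exists x0 => i /=; rewrite in_itv /= lerBlDr lerDl ltW //= lerDl ltW.
have Ab x : A x -> ball x0 r x.
  move=> Ax; apply/ball_rVP => // j; apply: le_lt_trans rr.
  have := Ax j; rewrite /= in_itv /= => /andP[h1 h2].
  by rewrite ler_distlC; lra.
have cf : {within A, continuous (fun x => `|psi x|)}.
  apply: continuous_in_subspaceT => x /set_mem /Ab /cpsi cx.
  exact: (@continuous_comp _ _ _ psi (fun t : R => `|t|) x cx (@norm_continuous _ _ _)).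
have [c _ hc] := compact_EVT_max A0 cA cf.
exists `|psi c| => // x /ball_rVP; move=> /(_ rho0) bx.
apply: hc; apply/mem_set => i /=; rewrite in_itv /=.
by have := ltW (bx i); rewrite ler_distlC => /andP[]; lra.
Qed.

Lemma continuous_eps (f : 'rV[R]_n -> R) x :
  (forall e : R, 0 < e -> exists2 d : R, 0 < d & forall y, ball x d y -> `|f x - f y| < e) ->
  {for x, continuous f}.
Proof.
move=> h; apply/(@cvgrPdist_lt _ _ _ (nbhs x) (nbhs_filter x) f (f x)) => e e0.
have [d d0 hd] := h e e0.
by apply: filterS hd _; exact: nbhsx_ballx.
Qed.

(** Used for integrals with a parameter: their partial derivatives are easy to bound, and continuity
    then follows from [mvt_box]. *)
Lemma bounded_derive_continuous f x (eta C : R) : 0 < eta ->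
  (forall y i, ball x eta y -> derivable f y (delta_mx 0 i) /\ `|'D_(delta_mx 0 i) f y| <= C) ->
  {for x, continuous f}.
Proof.
move=> eta0 h.
apply: continuous_eps => e e0.
(* The sign of [C] is read off a partial derivative, so the space of dimension 0 is treated
   apart. *)
have [n0|n0] := posnP n.
  exists 1 => // y _; suff -> : y = x by rewrite subrr normr0.
  by apply/rowP => i; have := ltn_ord i; rewrite {2}n0.
have C0 : 0 <= C.
  by have [_] := h x (Ordinal n0) (ballxx _ eta0); exact: le_trans.
(* The increment is at most [n * C * d]; the added 1 keeps the denominator positive and the final
   inequality strict. *)
pose d := Num.min eta (e / (n%:R * C + 1)).
have p1 : 0 < n%:R * C + 1 by rewrite ltr_wpDl // mulr_ge0.
have d0 : 0 < d by rewrite lt_min eta0 divr_gt0.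
have bd : ball x d `<=` ball x eta by apply: le_ball; rewrite ge_min lexx.
exists d => // y by_.
have bxz z : box x y z -> ball x d z by apply: box_ball => //; exact: ballxx.
have [z bz i|xi [bxi E]] := @mvt_box R n f x y.
  by have [] := h z i (bd _ (bxz _ bz)).
rewrite distrC E; apply: le_lt_trans (ler_norm_sum _ _ _) _.
apply: (@le_lt_trans _ _ (\sum_(i < n) C * d)).
  apply: ler_sum => i _; rewrite normrM; apply: ler_pM => //.
    by have [] := h _ i (bd _ (bxz _ (bxi i))).
  by have /ball_rVP/(_ i)/ltW := by_; rewrite distrC; exact.
rewrite sumr_const card_ord -mulr_natl mulrA.
apply: (@le_lt_trans _ _ (n%:R * C * (e / (n%:R * C + 1)))).
  by apply: ler_wpM2l; [rewrite mulr_ge0|rewrite ge_min lexx orbT].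
rewrite mulrCA gtr_pMr // ltr_pdivrMr // mul1r ltrDl //.
Qed.

Lemma ball_shrink (x0 x : 'rV[R]_n) (r : R) : ball x0 r x ->
  exists rho : R, [/\ 0 < rho, rho < r & ball x0 rho x].
Proof.
rewrite -ball_normE /= => h; exists ((`|x0 - x| + r) / 2); split.
- by rewrite divr_gt0 // ltr_wpDl // (le_lt_trans _ h).
- by rewrite ltr_pdivrMr // mulr_natr mulr2n ltrD2r.
- by rewrite ltr_pdivlMr // mulr_natr mulr2n ltrD2l.
Qed.

Context (x0 : 'rV[R]_n) (r : R) (r0 : 0 < r).

Let mu := @lebesgue_measure R.
Let seg x (t : R) := x0 + t *: (x - x0).

Lemma cont01_integrable (u : R -> R) : (forall t, 0 <= t <= 1 -> {for t, continuous u}) ->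
  mu.-integrable `[0, 1]%classic (EFin \o u).
Proof.
move=> cu; apply: continuous_compact_integrable; first exact: segment_compact.
by apply: continuous_in_subspaceT => t /set_mem /=; rewrite in_itv /=; exact: cu.
Qed.

Lemma Rintegral01_sum (I : Type) (s : seq I) (u : I -> R -> R) :
  (forall i t, 0 <= t <= 1 -> {for t, continuous (u i)}) ->
  \int[mu]_(t in `[0, 1]) (\sum_(i <- s) u i t) = \sum_(i <- s) \int[mu]_(t in `[0, 1]) u i t.
Proof.
move=> cu; elim: s => [|i s IH].
  rewrite big_nil; under eq_Rintegral do rewrite big_nil.
  by rewrite Rintegral_cst ?mul0r //; exact: measurable_itv.
rewrite big_cons -IH; under eq_Rintegral do rewrite big_cons.
apply: RintegralD; [exact: measurable_itv|exact/cont01_integrable/cu|].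
apply: cont01_integrable => t t01.
by apply: (@cvg_sumR _ _ (nbhs t)) => j; exact: cu.
Qed.

Lemma seg_ball rho x t : ball x0 rho x -> 0 <= t <= 1 -> ball x0 rho (seg x t).
Proof.
move=> bx t01; apply: (@box_ball R n x0 x0 x) => //.
  by apply: ballxx; case: bx.
by move=> i; exists t => //; rewrite !mxE.
Qed.

(** The weights [t ^+ k] close the family under partial differentiation: each derivative of
    [psi (seg x t)] in [x] brings out a factor [t]. *)
Definition segint k psi x : R := \int[mu]_(t in `[0, 1]) (t ^+ k * psi (seg x t)).

Lemma seg_integrand_continuous k psi x t :
  (forall y, ball x0 r y -> {for y, continuous psi}) -> ball x0 r x -> 0 <= t <= 1 ->
  {for t, continuous (fun t : R => t ^+ k * psi (seg x t))}.
Proof.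
move=> cpsi bx t01; apply: (@continuousM _ _ (fun t : R => t ^+ k) (fun t => psi (seg x t))).
  exact: exprn_continuous.
apply: (@continuous_comp _ _ _ (seg x) psi t); last exact/cpsi/seg_ball.
apply: continuous_rV => j.
have -> : (fun t : R => seg x t 0 j) = (fun t : R => x0 0 j + t * (x 0 j - x0 0 j)).
  by apply/funext => s; rewrite !mxE.
apply: (@continuousD _ _ _ (fun=> x0 0 j) (fun t : R => t * (x 0 j - x0 0 j))); first exact: cst_continuous.
apply: (@continuousM _ _ id (fun=> (x 0 j - x0 0 j))); [exact: cvg_id|exact: cst_continuous].
Qed.

Lemma seg_integrable k psi x :
  (forall y, ball x0 r y -> {for y, continuous psi}) -> ball x0 r x ->
  mu.-integrable `[0, 1]%classic (EFin \o (fun t : R => t ^+ k * psi (seg x t))).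
Proof.
by move=> cpsi bx; apply: cont01_integrable => t t01; exact: seg_integrand_continuous.
Qed.

Lemma norm_segint_le k psi x (C : R) : (forall y, ball x0 r y -> {for y, continuous psi}) -> ball x0 r x ->
  (forall t, 0 <= t <= 1 -> `|psi (seg x t)| <= C) -> `|segint k psi x| <= C.
Proof.
move=> cpsi bx hC; have I := seg_integrable k cpsi bx.
apply: le_trans (le_normr_Rintegral _ I) _; first exact: measurable_itv.
have -> : C = \int[mu]_(t in `[0, 1]) (fun=> C) t.
  by rewrite Rintegral_cst ?measurable_itv //= lebesgue_measure_itv /= lte_fin ltr01 -EFinB subr0 mulr1.
apply: le_Rintegral => //.
- by have := integrable_norm I.
- by apply: continuous_compact_integrable; [exact: segment_compact|move=> ?; exact: cst_continuous].
- move=> t /=; rewrite in_itv /= => t01; rewrite normrM -[leRHS]mul1r.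
  apply: ler_pM => //; last exact: hC.
  by case/andP: t01 => t0 t1; rewrite normrX ger0_norm // exprn_ile1.
Qed.

(** Differentiation under the integral sign, dominated by a constant that bounds the partial
    derivative of [psi] on a smaller ball. *)
Lemma is_derive_segint k psi x i : smooth_on (ball x0 r) psi -> ball x0 r x ->
  is_derive x (delta_mx 0 i) (segint k psi) (segint k.+1 ('D_(delta_mx 0 i) psi) x).
Proof.
move=> spsi bx; set e := delta_mx 0 i.
(* Two nested radii: [x] lies in the ball of radius [rho1], its displacements by less than
   [eta = rho - rho1] stay in the ball of radius [rho], and the bound [C] holds there because
   [rho < r]. *)
have [rho [rho0 rhor bxrho]] := ball_shrink bx.
have [rho1 [rho10 rho1r bxrho1]] := ball_shrink bxrho.
pose eta := rho - rho1; have eta0 : 0 < eta by rewrite subr_gt0.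
have sub s : `|s| < eta -> ball x0 rho (x + s *: e).
  move=> se; have -> : rho = rho1 + eta by rewrite addrC subrK.
  apply: ball_triangle bxrho1 _; apply/ball_rVP => // j.
  rewrite !mxE opprD addrA subrr add0r normrN normrM.
  case: (_ && _); rewrite ?normr1 ?mulr1 // normr0 mulr0 //.
have cpsi y : ball x0 r y -> {for y, continuous psi} by exact: smooth_on_continuous.
have sdpsi : smooth_on (ball x0 r) ('D_e psi) by exact: smooth_on_derive.
have cdpsi y : ball x0 r y -> {for y, continuous ('D_e psi)} by exact: smooth_on_continuous.
have [C C0 hC] := bounded_ball rho0 rhor cdpsi.
have rr : ball x0 rho `<=` ball x0 r by apply: le_ball; exact: ltW.
pose f (s t : R) : R := t ^+ k * psi (seg (x + s *: e) t).
have D (s t : R) : `|s| < eta -> 0 <= t <= 1 ->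
    is_derive s 1 (f^~ t) (t ^+ k.+1 * 'D_e psi (seg (x + s *: e) t)).
  move=> se t01; have b := rr _ (seg_ball (sub s se) t01).
  have E s' : seg (x + s' *: e) t = seg x t + s' *: (t *: e).
    by apply/rowP => j; rewrite !mxE; ring.
  have d1 := derive_scale t (@smooth_on_derivable _ _ _ _ spsi _ i b).
  have d2 : is_derive s 1 (fun s => psi (seg x t + s *: (t *: e))) (t * 'D_e psi (seg (x + s *: e) t)).
    rewrite E in d1 *; have [d3 d4] := d1.
    by have := line_derive d3; rewrite d4.
  have -> : f^~ t = t ^+ k \*: (fun s => psi (seg x t + s *: (t *: e))).
    by apply/funext => s'; rewrite /f E.
  rewrite exprSr -mulrA; exact: (@is_deriveZ _ _ _ _ (t ^+ k) s 1 _ d2).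
have Ie s : `]- eta, eta[%classic s -> `|s| < eta.
  by rewrite /= in_itv /= ltr_norml.
have Ii t : `[0, 1]%classic t -> 0 <= t <= 1 :> bool by rewrite /= in_itv.
have mB : measurable (`[0, 1]%classic : set (measurableTypeR R)) by exact: measurable_itv.
have I0 : `]- eta, eta[%classic (0 : R) by rewrite /= in_itv /= oppr_lt0 eta0.
have intf s : `]- eta, eta[%classic s -> mu.-integrable `[0, 1]%classic (EFin \o f s).
  by move=> /Ie se; apply: (seg_integrable k cpsi); exact/rr/sub.
have derf s t : `]- eta, eta[%classic s -> `[0, 1]%classic t -> derivable (f^~ t) s 1.
  by move=> /Ie se /Ii t01; have [] := D s t se t01.
have intG : mu.-integrable `[0, 1]%classic (EFin \o (fun=> C)).
  by apply: continuous_compact_integrable; [exact: segment_compact|move=> ?; exact: cst_continuous].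
have Gub s t : `]- eta, eta[%classic s -> `[0, 1]%classic t -> `|partial1of2 f s t| <= C.
  move=> /Ie se /Ii t01; rewrite partial1of2E; have [_ ->] := D s t se t01.
  rewrite normrM -[leRHS]mul1r; apply: ler_pM => //.
    by case/andP: t01 => t0 t1; rewrite normrX ger0_norm // exprn_ile1.
  by apply: hC; apply: seg_ball => //; exact: sub.
have dU := @derivable_under_integral R _ _ mu f _ mB 0 (- eta) eta I0 intf derf (fun=> C) (fun=> C0) intG Gub.
have dE := @differentiation_under_integral R _ _ mu f _ mB 0 (- eta) eta I0 intf derf (fun=> C) (fun=> C0) intG Gub.
apply: is_derive_line; split; first exact: dU.
rewrite -derive1E dE; apply: eq_Rintegral => t /set_mem /Ii t01.
rewrite partial1of2E; have [|_ ->] := D 0 t _ t01; first by rewrite normr0.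
by rewrite scale0r addr0.
Qed.

Lemma segint_continuous k psi x : smooth_on (ball x0 r) psi -> ball x0 r x ->
  {for x, continuous (segint k psi)}.
Proof.
move=> spsi bx; have [rho [rho0 rhor bxrho]] := ball_shrink bx.
have rr : ball x0 rho `<=` ball x0 r by apply: le_ball; exact: ltW.
have [rho1 [rho10 rho1r bxrho1]] := ball_shrink bxrho.
have cd i : forall y, ball x0 r y -> {for y, continuous ('D_(delta_mx 0 i) psi)}.
  by apply: smooth_on_continuous; exact: smooth_on_derive.
have H i : exists C : R, 0 <= C /\ forall y, ball x0 rho y -> `|'D_(delta_mx 0 i) psi y| <= C.
  by have [C C0 hC] := bounded_ball rho0 rhor (cd i); exists C.
have [C HC] := choice H.
apply: (@bounded_derive_continuous _ x (rho - rho1) (\sum_i C i)); first by rewrite subr_gt0.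
move=> y i bxy; have by_ : ball x0 rho y.
  have -> : rho = rho1 + (rho - rho1) by rewrite addrC subrK.
  exact: ball_triangle bxrho1 bxy.
have [d ->] := is_derive_segint k i spsi (rr _ by_); split=> //.
apply: (@le_trans _ _ (C i)); last by rewrite (bigD1 i) //= lerDl sumr_ge0 // => j _; have [] := HC j.
apply: norm_segint_le; [exact: cd|exact: rr|].
by move=> t t01; have [_] := HC i; apply; exact: seg_ball.
Qed.

Lemma smooth_on_segint k psi : smooth_on (ball x0 r) psi -> smooth_on (ball x0 r) (segint k psi).
Proof.
move=> spsi K; elim: K k psi spsi => [|K IH] k psi spsi.
  by split=> // x bx; exact: segint_continuous.
split=> [x bx|i]; first exact: segint_continuous.
split=> [x bx|]; first by have [] := is_derive_segint k i spsi bx.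
have C1 := IH k.+1 _ (smooth_on_derive i spsi).
apply: Ck_on_eq C1; first exact: ball_open.
by move=> x bx; have [_ ->] := is_derive_segint k i spsi bx.
Qed.

(** The fundamental theorem of calculus along the segment from [x0] to [x]: [h j] is the integral
    over [t] in [0, 1] of the [j]-th partial derivative at [seg x t]. *)
Lemma hadamard f : smooth_on (ball x0 r) f ->
  exists h : 'I_n -> 'rV[R]_n -> R, (forall j, smooth_on (ball x0 r) (h j)) /\
    forall x, ball x0 r x -> f x = f x0 + \sum_j (x 0 j - x0 0 j) * h j x.
Proof.
move=> sf; exists (fun j => segint 0 ('D_(delta_mx 0 j) f)); split=> [j|x bx].
  exact/smooth_on_segint/smooth_on_derive.
have cdf j y : ball x0 r y -> {for y, continuous ('D_(delta_mx 0 j) f)}.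
  by move=> by_; apply: smooth_on_continuous by_; exact: smooth_on_derive.
pose phi (t : R) := f (seg x t).
pose u j (t : R) := (x 0 j - x0 0 j) * (t ^+ 0 * 'D_(delta_mx 0 j) f (seg x t)).
have dphi (t : R) : 0 <= t <= 1 -> is_derive t 1 phi (\sum_j u j t).
  move=> t01.
  have dj j : is_derive t (1:R) (fun t : R => seg x t 0 j) (x 0 j - x0 0 j).
    have -> : (fun t : R => seg x t 0 j) = (fun t : R => x0 0 j + t * (x 0 j - x0 0 j)).
      by apply/funext => s; rewrite !mxE.
    by apply: is_derive_eq; rewrite /GRing.scale /= mulr0 !add0r mul1r mulr1.
  have := @chain_curve R n f (ball x0 r) (seg x) (fun j => x 0 j - x0 0 j) t (ball_open _ _) (seg_ball bx t01) (sf 1%N) dj.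
  set a := (X in is_derive _ _ _ X -> _); set b := (X in _ -> is_derive _ _ _ X).
  suff -> : a = b by [].
  by apply: eq_bigr => j _; rewrite /u expr0 mul1r mulrC.
have cphi (t : R) : 0 <= t <= 1 -> {for t, continuous phi}.
  by move=> /dphi [d _]; apply: differentiable_continuous; apply/derivable1_diffP.
have cu j (t : R) : 0 <= t <= 1 -> {for t, continuous (u j)}.
  move=> t01; apply: (@continuousM _ _ (fun=> _)); first exact: cst_continuous.
  exact: seg_integrand_continuous (cdf j) bx t01.
have csum (t : R) : 0 <= t <= 1 -> {for t, continuous (fun t => \sum_j u j t)}.
  by move=> t01; apply: (@cvg_sumR _ _ (nbhs t)) => j; exact: cu.
have c1 : {within `[0, 1], continuous (fun t => \sum_j u j t)}.
  by apply: continuous_in_subspaceT => t /set_mem /=; rewrite in_itv /=; exact: csum.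
have c2 : derivable_oo_LRcontinuous phi 0 1.
  split.
  - by move=> t; rewrite in_itv /= => /andP[t0 t1]; have [|] := dphi t; rewrite ?ltW.
  - by apply: cvg_at_right_filter; apply: cphi; rewrite lexx ler01.
  - by apply: cvg_at_left_filter; apply: cphi; rewrite lexx ler01.
have c3 : {in `]0, 1[, derive1 phi =1 (fun t => \sum_j u j t)}.
  move=> t; rewrite in_itv /= => /andP[t0 t1]; rewrite derive1E.
  by have [|_ ->] := dphi t; rewrite ?ltW.
have FTC := continuous_FTC2 ltr01 c1 c2 c3.
have E1 : \int[mu]_(t in `[0, 1]) (\sum_j u j t) = f x - f x0.
  rewrite /Rintegral FTC -EFinB /= /phi /seg scale1r scale0r addr0.
  by rewrite [x0 + _]addrC subrK.
rewrite Rintegral01_sum in E1; last exact: cu.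
rewrite -[LHS](subrK (f x0)) -E1 addrC; congr (_ + _); apply: eq_bigr => j _.
by rewrite /u RintegralZl //; exact: seg_integrable (cdf j) bx.
Qed.

End hadamard.

(** * Ordinary differential equations *)

Section ode.
Context {R : realType}.

Lemma rV_coord_le n (x : 'rV[R]_n) j : `|x 0 j| <= `|x|.
Proof.
rewrite [leRHS]/Num.Def.normr /= mx_normrE.
exact: (le_bigmax _ (fun i : 'I_1 * 'I_n => `|x i.1 i.2|) (0, j)).
Qed.

Lemma rV_norm_le n (x : 'rV[R]_n) (C : R) : 0 <= C -> (forall j, `|x 0 j| <= C) -> `|x| <= C.
Proof.
move=> C0 h; rewrite [leLHS]/Num.Def.normr /= mx_normrE; apply: bigmax_le => // -[i j] _ /=.
by rewrite (ord1 i).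
Qed.

(** The integral starts at -1 although the value at 0 is normalized to 0: then 0 is interior to the
    interval of integration and the derivative there is two-sided. *)
Definition primitive (u : R -> R) (t : R) : R :=
  \int[lebesgue_measure]_(s in `[-1, t]) u s - \int[lebesgue_measure]_(s in `[-1, 0]) u s.

Lemma primitive0 u : primitive u 0 = 0.
Proof. by rewrite /primitive subrr. Qed.

Lemma is_derive_primitive u (t : R) : continuous u -> 0 <= t <= 1 ->
  is_derive t 1 (primitive u) (u t).
Proof.
move=> cu /andP[t0 t1].
have It : lebesgue_measure.-integrable `[(-1:R), 2]%classic (EFin \o u).
  apply: continuous_compact_integrable; first exact: segment_compact.
  exact: continuous_subspaceT.
have t2 : t < 2 by apply: le_lt_trans t1 _; rewrite ltr1n.
have tm : -1 < t by apply: lt_le_trans t0; rewrite oppr_lt0.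
have [d D] := continuous_FTC1_closed t2 It tm (cu t).
have d1 : is_derive t (1:R) (fun x => \int[lebesgue_measure]_(s in `[-1, x]) u s) (u t).
  by split; [exact: d|rewrite -D derive1E].
have d2 := @is_deriveB _ _ _ _ (cst (\int[lebesgue_measure]_(s in `[-1, 0]) u s)) t 1 _ _ d1 (is_derive_cst _ _ _).
by rewrite subr0 in d2.
Qed.

Lemma mvt01_le (f df : R -> R) (K : R) (s t : R) : 0 <= s <= 1 -> 0 <= t <= 1 ->
  (forall x : R, 0 <= x <= 1 -> is_derive x 1 f (df x)) ->
  (forall x : R, 0 <= x <= 1 -> `|df x| <= K) -> `|f t - f s| <= K * `|t - s|.
Proof.
move=> + + hd hK; wlog st : s t / s <= t.
  move=> H hs ht; have [st|ts] := leP s t; first exact: H.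
  by rewrite distrC [`|t - s|]distrC; apply: H => //; exact: ltW.
move=> /andP[s0 s1] /andP[t0 t1].
have [||x] := @MVT_segment R f df s t st.
- move=> x; rewrite in_itv /= => /andP[sx xt]; apply: hd.
  by rewrite (le_trans s0 (ltW sx)) (le_trans (ltW xt) t1).
- apply: derivable_within_continuous => x; rewrite in_itv /= => /andP[sx xt].
  by have [|] := hd x; first by rewrite (le_trans s0 sx) (le_trans xt t1).
rewrite in_itv /= => /andP[sx xt] ->; rewrite normrM ler_wpM2r // hK //.
by rewrite (le_trans s0 sx) (le_trans xt t1).
Qed.

(** With [e k = 2 * C / 2 ^+ k] the sum of the remaining increments, the intervals of centre [a k]
    and radius [e k] are nested; the supremum of their left ends lies in all of them. *)
Lemma geometric_limit (a : nat -> R) (C : R) : 0 <= C ->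
  (forall k, `|a k.+1 - a k| <= C / 2 ^+ k) ->
  exists l, forall k, `|a k - l| <= 2 * C / 2 ^+ k.
Proof.
move=> C0 ha.
have p2 k : 0 < 2 ^+ k :> R by rewrite exprn_gt0.
pose e k : R := 2 * C / 2 ^+ k.
have eS k : e k = C / 2 ^+ k + e k.+1.
  by rewrite /e exprS; field; rewrite gt_eqF.
have e0 k : 0 <= e k by rewrite /e divr_ge0 ?mulr_ge0 // ltW.
have up k : a k - e k <= a k.+1 - e k.+1.
  by have := ha k; rewrite ler_norml (eS k) => /andP[]; lra.
have dn k : a k.+1 + e k.+1 <= a k + e k.
  by have := ha k; rewrite ler_norml (eS k) => /andP[]; lra.
have ups k j : a k - e k <= a (k + j)%N - e (k + j)%N.
  by elim: j => [|j IH]; rewrite ?addn0 // addnS; exact: le_trans IH (up _).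
have dns k j : a (k + j)%N + e (k + j)%N <= a k + e k.
  by elim: j => [|j IH]; rewrite ?addn0 // addnS; exact: le_trans (dn _) IH.
have cross k j : a k - e k <= a j + e j.
  apply: le_trans (ups k j) _; apply: le_trans _ (dns j k).
  by rewrite [(j + k)%N]addnC; have := e0 (k + j)%N; lra.
pose S := [set a k - e k | k in [set: nat]].
have S0 : S !=set0 by exists (a 0%N - e 0%N), 0%N.
have Sub j : ubound S (a j + e j) by move=> _ [k _ <-]; exact: cross.
exists (sup S) => k; rewrite ler_distlC.
apply/andP; split.
- by apply: ub_le_sup; [exists (a 0%N + e 0%N)|exists k].
- by apply: ge_sup.
Qed.

Lemma le_geometric0 (x C : R) : (forall k : nat, x <= C / 2 ^+ k) -> x <= 0.
Proof.
move=> h; rewrite leNgt; apply/negP => x0.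
have [C0|C0] := leP C 0.
  by have := h 0%N; rewrite expr0 divr1 => /le_trans/(_ C0); rewrite leNgt x0.
have [k hk] : exists k : nat, C / x < k%:R.
  by exists (Num.bound (C / x)); apply: archi_boundP; rewrite divr_ge0 ?ltW.
have := h k; rewrite leNgt => /negP; apply.
rewrite ltr_pdivrMr ?exprn_gt0 //.
rewrite ltr_pdivrMr // mulrC in hk; apply: lt_le_trans hk _.
apply: ler_wpM2l; first exact: ltW.
by rewrite -natrX ler_nat ltnW // ltn_expl.
Qed.

(** A retraction of the line onto an interval that is 1-Lipschitz. Composing with it makes local
    data global without spoiling Lipschitz constants. *)
Definition clip (a b t : R) : R := Num.max a (Num.min b t).

Lemma clip_itv a b t : a <= b -> a <= clip a b t <= b.
Proof. by move=> ab; rewrite /clip le_max lexx /= ge_max ab ge_min lexx. Qed.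

Lemma clip_id a b t : a <= t <= b -> clip a b t = t.
Proof. by move=> /andP[t0 t1]; rewrite /clip min_r // max_r. Qed.

Lemma clip_lip a b s t : `|clip a b s - clip a b t| <= `|s - t|.
Proof.
have h1 := ler_norm (s - t); have h2 := ler_norm (t - s); rewrite (distrC t) in h2.
rewrite /clip !maxEle !minEle; case: (leP b s) => ?; case: (leP b t) => ?;
 case: (leP a b) => ?; case: (leP a s) => ?; case: (leP a t) => ?; rewrite ler_norml; lra.
Qed.

Definition clip01 := clip 0 1.

Lemma clip01_itv t : 0 <= clip01 t <= 1.
Proof. exact/clip_itv/ler01. Qed.

Lemma continuous_lip (n : nat) (z : R -> 'rV[R]_n) (K : R) :
  (forall s t, `|z s - z t| <= K * `|s - t|) -> continuous z.
Proof.
move=> h t; apply/cvgrPdist_lt => e e0.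
have K0 : 0 < `|K| + 1 by rewrite ltr_wpDl.
near=> s; apply: le_lt_trans (h t s) _.
apply: (@le_lt_trans _ _ ((`|K| + 1) * `|t - s|)).
  by rewrite ler_wpM2r // (le_trans (ler_norm _)) // lerDl.
rewrite mulrC -ltr_pdivlMr //; near: s.
by apply: cvgr_dist_lt; [exact: cvg_id|exact: divr_gt0].
Unshelve. all: by end_near. Qed.


Lemma primitive_dist (u w : R -> R) (K s t : R) : continuous u -> continuous w ->
  0 <= t <= 1 ->
  (forall x : R, 0 <= x <= 1 -> `|u x - w x| <= K) -> `|primitive u t - primitive w t| <= K.
Proof.
move=> cu cw t01 h.
have K0 : 0 <= K by apply: le_trans (h 0 _); rewrite ?lexx ?ler01.
have D (x : R) : 0 <= x <= 1 -> is_derive x 1 (fun t => primitive u t - primitive w t) (u x - w x).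
  by move=> x01; exact: (@is_deriveB _ _ _ _ _ x 1 _ _ (is_derive_primitive cu x01) (is_derive_primitive cw x01)).
have := @mvt01_le (fun t => primitive u t - primitive w t) (fun t => u t - w t) K 0 t _ t01 D h.
rewrite lexx ler01 !primitive0 subrr !subr0 => /(_ isT) /le_trans; apply.
by case/andP: t01 => t0 t1; rewrite ger0_norm // ler_piMr.
Qed.

(* Rescaling the field brings the Lipschitz constant below 1/2, so that the
   Picard iterates converge on all of [0, 1]. *)
Section picard.
Context {m : nat} (A : 'rV[R]_m -> 'rV[R]_m) (K : R).
Hypothesis AL : forall x y, `|A x - A y| <= 2^-1 * `|x - y|.
Hypothesis AK : forall x, `|A x| <= K.
Context (x0 : 'rV[R]_m).

Let K0 : 0 <= K.
Proof. exact: le_trans (AK 0). Qed.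

(** The Picard operator. Time is frozen outside [0, 1], so that all iterates are [K]-Lipschitz on
    the whole line. *)
Let T (z : R -> 'rV[R]_m) (t : R) : 'rV[R]_m :=
  x0 + \row_j primitive (fun s => A (z s) 0 j) (clip01 t).

Let Az_cont (z : R -> 'rV[R]_m) j : (forall s t, `|z s - z t| <= K * `|s - t|) ->
  continuous (fun s => A (z s) 0 j).
Proof.
move=> cz t; have cAz : continuous (fun s => A (z s)).
  apply: (@continuous_lip _ _ (2^-1 * K)) => a b.
  by apply: le_trans (AL _ _) _; rewrite -mulrA ler_wpM2l // invr_ge0.
by apply: (@continuous_comp _ _ _ (fun s => A (z s)) (fun x : 'rV[R]_m => x 0 j)); [exact: cAz|exact: matrix_normedtype.coord_continuous].
Qed.

Let T_lip (z : R -> 'rV[R]_m) : (forall s t, `|z s - z t| <= K * `|s - t|) ->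
  forall s t, `|T z s - T z t| <= K * `|s - t|.
Proof.
move=> cz s t; apply: rV_norm_le => [|j]; first by rewrite mulr_ge0.
rewrite !mxE opprD addrACA subrr add0r.
apply: le_trans (_ : K * `|clip01 s - clip01 t| <= _); last by rewrite ler_wpM2l // clip_lip.
apply: (@mvt01_le _ (fun s => A (z s) 0 j)); rewrite ?clip01_itv // => x x01.
  by apply: is_derive_primitive => //; exact: Az_cont.
exact: le_trans (rV_coord_le _ _) (AK _).
Qed.

Let T_dist (z w : R -> 'rV[R]_m) (C : R) :
  (forall s t, `|z s - z t| <= K * `|s - t|) -> (forall s t, `|w s - w t| <= K * `|s - t|) ->
  (forall t, `|z t - w t| <= C) -> forall t, `|T z t - T w t| <= 2^-1 * C.
Proof.
move=> cz cw h t; have C0 : 0 <= C by exact: le_trans (h 0).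
apply: rV_norm_le => [|j]; first by rewrite mulr_ge0 // invr_ge0.
rewrite !mxE opprD addrACA subrr add0r.
apply: primitive_dist; rewrite ?clip01_itv //; [exact: Az_cont|exact: Az_cont|].
move=> x _; have := rV_coord_le (A (z x) - A (w x)) j; rewrite !mxE => /le_trans; apply.
by apply: le_trans (AL _ _) _; rewrite ler_wpM2l // invr_ge0.
Qed.

Lemma picard : exists g : R -> 'rV[R]_m, g 0 = x0 /\
  forall t : R, 0 <= t <= 1 -> forall j, is_derive t 1 (fun s => g s 0 j) (A (g t) 0 j).
Proof.
pose z k := iter k T (fun=> x0).
have zL k s t : `|z k s - z k t| <= K * `|s - t|.
  elim: k s t => [|k IH] s t; first by rewrite subrr normr0 mulr_ge0.
  exact: T_lip.
have zS k t : `|z k.+1 t - z k t| <= K / 2 ^+ k.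
  elim: k t => [|k IH] t.
    rewrite expr0 divr1 /= /T.
    apply: rV_norm_le => // j; rewrite !mxE addrAC subrr add0r.
    have h0 : 0 <= (0 : R) <= 1 by rewrite lexx ler01.
    have := @mvt01_le (primitive (fun=> A x0 0 j)) (fun=> A x0 0 j) K _ _ h0 (clip01_itv t).
    rewrite primitive0 !subr0 => H; apply: le_trans (H _ _) _.
    - by move=> x x01; apply: is_derive_primitive => // ?; exact: cst_continuous.
    - by move=> x _; exact: le_trans (rV_coord_le _ _) (AK _).
    - by rewrite ler_piMr //; have /andP[a b] := clip01_itv t; rewrite ger0_norm.
  have := @T_dist (z k.+1) (z k) (K / 2 ^+ k) (zL _) (zL _) IH t.
  by rewrite exprS invfM mulrCA.
have H t : exists l : 'rV[R]_m, forall k, `|z k t - l| <= 2 * K / 2 ^+ k.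
  have Hj j : exists l, forall k, `|z k t 0 j - l| <= 2 * K / 2 ^+ k.
    apply: geometric_limit => // k.
    by have := rV_coord_le (z k.+1 t - z k t) j; rewrite !mxE => /le_trans; apply.
  have [l hl] := choice Hj.
  exists (\row_j l j) => k; apply: rV_norm_le => [|j]; last by rewrite !mxE.
  by rewrite divr_ge0 ?mulr_ge0 ?exprn_ge0.
have [g hg] := choice H.
have gL s t : `|g s - g t| <= K * `|s - t|.
  rewrite -subr_le0; apply: (@le_geometric0 _ (4 * K)) => k.
  have -> : 4 * K / 2 ^+ k = 2 * K / 2 ^+ k + 2 * K / 2 ^+ k by rewrite -mulrDl -mulrDl -natrD.
  have -> : g s - g t = - (z k s - g s) + (z k s - z k t) + (z k t - g t).
    by rewrite opprB !addrA subrK subrK.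
  have h1 := ler_normD (- (z k s - g s) + (z k s - z k t)) (z k t - g t).
  have h2 := ler_normD (- (z k s - g s)) (z k s - z k t).
  rewrite normrN in h2.
  have := hg s k; have := hg t k; have := zL k s t; lra.
(* [T g] is within [K / 2 ^+ k] of the iterate [z k.+1] for every [k], as is [g]. *)
have gT t : g t = T g t.
  apply/eqP; rewrite -subr_eq0 -normr_le0; apply: (@le_geometric0 _ (4 * K)) => k.
  have h3 : `|T (z k) t - T g t| <= 2^-1 * (2 * K / 2 ^+ k).
    by apply: T_dist => // s; exact: hg.
  have -> : g t - T g t = - (z k.+1 t - g t) + (z k.+1 t - T g t).
    by rewrite opprB addrA subrK.
  have h1 := ler_normD (- (z k.+1 t - g t)) (z k.+1 t - T g t).
  rewrite normrN in h1; have h4 := hg t k.+1.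
  have e1 : 2 * K / 2 ^+ k.+1 = K / 2 ^+ k by rewrite exprS; field; rewrite expf_eq0 /= pnatr_eq0 andbF.
  have e2 : 2^-1 * (2 * K / 2 ^+ k) = K / 2 ^+ k by field; rewrite expf_eq0 /= pnatr_eq0 andbF.
  have e3 : 4 * K / 2 ^+ k = 4 * (K / 2 ^+ k) by rewrite mulrA.
  have e4 : 0 <= K / 2 ^+ k by rewrite divr_ge0 // exprn_ge0.
  rewrite e1 in h4; rewrite e2 in h3; rewrite e3.
  have h5 : `|z k.+1 t - T g t| <= K / 2 ^+ k by exact: h3.
  lra.
(* The fixed point [g] is frozen outside [0, 1] and need not be differentiable at the ends. Dropping
   the clip gives a curve equal to [g] on [0, 1] with two-sided derivatives there. *)
exists (fun t => x0 + \row_j primitive (fun s => A (g s) 0 j) t); split.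
  by apply/rowP => j; rewrite !mxE primitive0 addr0.
move=> t t01 j.
have -> : x0 + \row_j primitive (fun s => A (g s) 0 j) t = g t.
  by rewrite [RHS]gT /T [clip01 t]clip_id.
have -> : (fun s => (x0 + \row_j primitive (fun s => A (g s) 0 j) s) 0 j)
   = (fun s => cst (x0 0 j) s + primitive (fun s => A (g s) 0 j) s).
  by apply/funext => s; rewrite !mxE.
have := @is_deriveD _ _ _ _ _ t 1 _ _ (is_derive_cst (x0 0 j) t 1) (is_derive_primitive (@Az_cont _ j gL) t01).
by rewrite add0r.
Qed.

(** A curve [w] that solves the equation up to a defect [e] stays within [2 * e] of the solution.
    The Lipschitz constant 1/2 over unit time makes a plain maximum argument enough, in place of
    Gronwall's inequality. *)
Lemma ode_compare (g w : R -> 'rV[R]_m) (dw : R -> 'rV[R]_m) (e : R) :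
  (forall t : R, 0 <= t <= 1 -> forall j, is_derive t 1 (fun s => g s 0 j) (A (g t) 0 j)) ->
  (forall t : R, 0 <= t <= 1 -> forall j, is_derive t 1 (fun s => w s 0 j) (dw t 0 j)) ->
  g 0 = w 0 ->
  (forall t : R, 0 <= t <= 1 -> `|dw t - A (w t)| <= e) ->
  forall t : R, 0 <= t <= 1 -> `|w t - g t| <= 2 * e.
Proof.
move=> dg dwj g0 he.
pose d t := w t - g t.
have cd (t : R) : 0 <= t <= 1 -> {for t, continuous (fun t => `|d t|)}.
  move=> t01; apply: (@continuous_comp _ _ _ d (fun x : 'rV[R]_m => `|x|)); last exact: norm_continuous.
  apply: continuous_rV => j.
  have D := @is_deriveB _ _ _ _ _ t 1 _ _ (dwj t t01 j) (dg t t01 j).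
  have -> : (fun t => d t 0 j) = (fun s => w s 0 j - g s 0 j) by apply/funext => s; rewrite !mxE.
  by apply: differentiable_continuous; apply/derivable1_diffP; case: D.
have [c c01 hc] : exists2 c, c \in `[0, 1]%R & forall t, t \in `[0, 1]%R -> `|d t| <= `|d c|.
  apply: EVT_max => //; apply: continuous_in_subspaceT => t /set_mem /=.
  by rewrite in_itv /=; exact: cd.
rewrite in_itv /= in c01.
have e0 : 0 <= e by apply: le_trans (he 0 _); rewrite ?lexx ?ler01.
(* Here [c] is a time of greatest distance; half of that distance is absorbed on the left, whence
   the factor 2. *)
suff M : `|d c| <= e + 2^-1 * `|d c|.
  move=> t t01; apply: le_trans (hc t _) _; first by rewrite in_itv.
  have : 2^-1 * `|d c| = `|d c| / 2 by rewrite mulrC.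
  lra.
apply: rV_norm_le => [|j]; first by rewrite addr_ge0 // mulr_ge0 // invr_ge0.
have D (t : R) : 0 <= t <= 1 -> is_derive t 1 (fun s => d s 0 j) (dw t 0 j - A (g t) 0 j).
  move=> t01; have := @is_deriveB _ _ _ _ _ t 1 _ _ (dwj t t01 j) (dg t t01 j).
  suff -> : (fun t => d t 0 j) = (fun s => w s 0 j - g s 0 j) by [].
  by apply/funext => s; rewrite !mxE.
have h0 : 0 <= (0 : R) <= 1 by rewrite lexx ler01.
have B (t : R) : 0 <= t <= 1 -> `|dw t 0 j - A (g t) 0 j| <= e + 2^-1 * `|d c|.
  move=> t01; have := rV_coord_le (dw t - A (g t)) j; rewrite !mxE => /le_trans; apply.
  have -> : dw t - A (g t) = (dw t - A (w t)) + (A (w t) - A (g t)) by rewrite addrA subrK.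
  apply: le_trans (ler_normD _ _) _; apply: lerD; first exact: he.
  apply: le_trans (AL _ _) _; apply: ler_wpM2l; first by rewrite invr_ge0.
  by apply: hc; rewrite in_itv.
have := mvt01_le h0 c01 D B.
have -> : d 0 0 j = 0 by rewrite /d g0 subrr mxE.
rewrite !subr0 => /le_trans; apply; rewrite ler_piMr //.
  by rewrite addr_ge0 // mulr_ge0 // invr_ge0.
by case/andP: c01 => c0 c1; rewrite ger0_norm.
Qed.

End picard.

End ode.

(** * Flows of families of fields on a ball *)

Section flow.
Context {R : realType}.

Lemma ball_normP n (x y : 'rV[R]_n) (e : R) : ball x e y <-> `|x - y| < e.
Proof. by rewrite -ball_normE. Qed.

Lemma lip_ball n (f : 'rV[R]_n -> R) (x0 : 'rV[R]_n) (rho rho0 : R) : 0 < rho -> rho < rho0 ->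
  smooth_on (ball x0 rho0) f ->
  exists L : R, 0 <= L /\ forall x y, ball x0 rho x -> ball x0 rho y -> `|f x - f y| <= L * `|x - y|.
Proof.
move=> r0 rr sf.
have sub : ball x0 rho `<=` ball x0 rho0 by apply: le_ball; exact: ltW.
have H i : exists C : R, 0 <= C /\ forall x, ball x0 rho x -> `|'D_(delta_mx 0 i) f x| <= C.
  have [|C C0 hC] := @bounded_ball R n ('D_(delta_mx 0 i) f) x0 rho rho0 r0 rr; last by exists C.
  by move=> x bx; exact: (smooth_on_continuous (smooth_on_derive i sf)).
have [C hC] := choice H.
exists (\sum_i C i); split; first by apply: sumr_ge0 => i _; have [] := hC i.
move=> x y bx by_.
have bz z : box y x z -> ball x0 rho z by exact: box_ball.
have [z /bz /sub bz' i|xi [bxi ->]] := @mvt_box R n f y x; first exact: (smooth_on_derivable sf).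
apply: le_trans (ler_norm_sum _ _ _) _; rewrite mulr_suml; apply: ler_sum => i _.
rewrite normrM; apply: ler_pM => //; first by have [_] := hC i; apply; exact: bz.
by have := rV_coord_le (x - y) i; rewrite !mxE.
Qed.

(** The sum of the finitely many nonnegative bounds serves all indices at once. *)
Lemma exists_unif (I : finType) (P : I -> R -> Prop) :
  (forall a C C', C <= C' -> P a C -> P a C') -> (forall a, exists C, 0 <= C /\ P a C) ->
  exists C, 0 <= C /\ forall a, P a C.
Proof.
move=> mono h; have [C hC] := choice h.
have C0 i : 0 <= C i by have [] := hC i.
exists (\sum_i C i); split; first exact: sumr_ge0.
move=> a; have [_] := hC a; apply: mono.
by rewrite (bigD1 a) //= lerDl sumr_ge0.
Qed.

Lemma is_derive_quadratic n (f : 'rV[R]_n -> R) x v (d eta C : R) : 0 < eta ->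
  (forall s : R, `|s| < eta -> `|f (x + s *: v) - f x - s * d| <= C * s ^+ 2) ->
  is_derive x v f d.
Proof.
move=> eta0 h.
have C0 : 0 <= C.
  have := h (eta / 2); rewrite gtr0_norm ?divr_gt0 // ltr_pdivrMr // mulr_natr mulr2n ltrDr => /(_ eta0).
  move=> /(le_trans (normr_ge0 _)); rewrite pmulr_lge0 // exprn_gt0 // divr_gt0 //.
have L : (fun h : R => h^-1 *: ((f \o shift x) (h *: v) - f x)) @ 0^' --> d.
  apply/cvgrPdist_lt => e e0.
  have C1 : 0 < C + 1 by rewrite ltr_wpDl.
  have C2 : 0 < e / (C + 1) by exact: divr_gt0.
  near=> s.
  have s0 : s != 0 by near: s; exact: nbhs_dnbhs_neq.
  have se : `|s| < eta by near: s; exact: dnbhs0_lt.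
  have sC : `|s| < e / (C + 1) by near: s; exact: dnbhs0_lt.
  have -> : d - s^-1 *: ((f \o shift x) (s *: v) - f x) = - (s^-1 * (f (x + s *: v) - f x - s * d)).
    by rewrite /= [s *: v + x]addrC /GRing.scale /=; field.
  rewrite normrN normrM normfV.
  apply: (@le_lt_trans _ _ (`|s|^-1 * (C * s ^+ 2))); first by rewrite ler_wpM2l ?invr_ge0 // h.
  have -> : `|s|^-1 * (C * s ^+ 2) = C * `|s| by rewrite -real_normK ?num_real // expr2; field; rewrite normr_eq0.
  apply: (@le_lt_trans _ _ ((C + 1) * `|s|)); first by rewrite ler_wpM2r // lerDl.
  by rewrite mulrC -ltr_pdivlMr.
split; first by apply/cvg_ex; exists d; exact: L.
by apply: cvg_lim => //; exact: L.
Unshelve. all: by end_near. Qed.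

Context {k m : nat} (A : 'I_k -> 'rV[R]_m -> 'rV[R]_m) (x0 : 'rV[R]_m) (rho0 : R).
Hypothesis sA : forall i j, smooth_on (ball x0 rho0) (fun x => A i x 0 j).

(** The retraction onto the closed cube of radius [r] about [x0]. Fields precomposed with it are
    bounded and Lipschitz everywhere, as [picard] demands. *)
Let clipb (r : R) (x : 'rV[R]_m) : 'rV[R]_m := \row_j clip (x0 0 j - r) (x0 0 j + r) (x 0 j).

Let clipb_lip r x y : `|clipb r x - clipb r y| <= `|x - y|.
Proof.
apply: rV_norm_le => // j; rewrite !mxE; apply: le_trans (clip_lip _ _ _ _) _.
by have := rV_coord_le (x - y) j; rewrite !mxE.
Qed.

Let clipb_ball r r' x : 0 < r -> r < r' -> ball x0 r' (clipb r x).
Proof.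
move=> r0 rr; apply/ball_rVP; first exact: lt_trans rr.
move=> j; rewrite !mxE; apply: le_lt_trans rr.
have : x0 0 j - r <= x0 0 j + r by lra.
by move/clip_itv => /(_ (x 0 j)) /andP[h1 h2]; rewrite ler_norml; lra.
Qed.

Let clipb_id r x : 0 < r -> ball x0 r x -> clipb r x = x.
Proof.
move=> r0 /ball_rVP; move=> /(_ r0) h; apply/rowP => j; rewrite mxE clip_id //.
by have := h j; rewrite ltr_norml; lra.
Qed.

Let Av (v : 'rV[R]_k) (x : 'rV[R]_m) : 'rV[R]_m := \sum_i v 0 i *: A i x.

Let AvE v x j : Av v x 0 j = \sum_i v 0 i * A i x 0 j.
Proof. by rewrite /Av summxE; apply: eq_bigr => i _; rewrite mxE. Qed.

(* When the [A_i] commute, the derivative of the endpoint in direction [h] is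
   found without linearizing the flow: [g v s + s t A_h (g v s)] solves the
   equation for [v + t e_h] up to an error of order [t ^ 2]. *)
Lemma commuting_flow (rho : R) : 0 < rho -> rho < rho0 ->
  exists (delta : R) (g : 'rV[R]_k -> R -> 'rV[R]_m), [/\ 0 < delta,
    forall v : 'rV[R]_k, `|v| < delta -> [/\ g v 0 = x0,
      forall t : R, 0 <= t <= 1 -> ball x0 rho (g v t) &
      forall t : R, 0 <= t <= 1 -> forall j,
        is_derive t 1 (fun s => g v s 0 j) (\sum_i v 0 i * A i (g v t) 0 j)] &
    (forall i h j x, ball x0 rho0 x ->
       \sum_l A i x 0 l * 'D_(delta_mx 0 l) (fun y => A h y 0 j) x =
       \sum_l A h x 0 l * 'D_(delta_mx 0 l) (fun y => A i y 0 j) x) ->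
    forall v : 'rV[R]_k, `|v| < delta -> forall j, {for v, continuous (fun u => g u 1 0 j)} /\
      forall h, is_derive v (delta_mx 0 h) (fun u => g u 1 0 j) (A h (g v 1) 0 j)].
Proof.
move=> r0 rr.
have subr : ball x0 rho `<=` ball x0 rho0 by apply: le_ball; exact: ltW.
have [K [K0 hK]] : exists K : R, 0 <= K /\ forall ij : 'I_k * 'I_m, forall x : 'rV[R]_m, ball x0 rho x -> `|A ij.1 x 0 ij.2| <= K.
  apply: exists_unif => [a C C' CC h x bx|[i j]]; first exact: le_trans (h x bx) CC.
  have [|C C0 hC] := @bounded_ball R m (fun x => A i x 0 j) x0 rho rho0 r0 rr; last by exists C.
  by move=> x bx; exact: (smooth_on_continuous (sA i j)).
have [L [L0 hL]] : exists L : R, 0 <= L /\ forall ij : 'I_k * 'I_m, forall x y : 'rV[R]_m, ball x0 rho x -> ball x0 rho y ->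
    `|A ij.1 x 0 ij.2 - A ij.1 y 0 ij.2| <= L * `|x - y|.
  apply: exists_unif => [a C C' CC h x y bx by_|[i j]]; last exact: lip_ball (sA i j).
  by apply: le_trans (h x y bx by_) _; rewrite ler_wpM2r.
have [L1 [L10 hL1]] : exists L : R, 0 <= L /\ forall ijl : 'I_k * 'I_m * 'I_m, forall x y : 'rV[R]_m, ball x0 rho x -> ball x0 rho y ->
    `|'D_(delta_mx 0 ijl.2) (fun x => A ijl.1.1 x 0 ijl.1.2) x - 'D_(delta_mx 0 ijl.2) (fun x => A ijl.1.1 x 0 ijl.1.2) y| <= L * `|x - y|.
  apply: exists_unif => [a C C' CC h x y bx by_|[[i j] l]].
    by apply: le_trans (h x y bx by_) _; rewrite ler_wpM2r.
  exact: lip_ball (smooth_on_derive l (sA i j)).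
(* Clipping at half the radius keeps the clipped points inside the ball of radius [rho], where the
   bounds [K], [L] and [L1] hold. *)
pose r := rho / 2; have rp : 0 < r by rewrite divr_gt0.
have rlt : r < rho by rewrite ltr_pdivrMr // mulr_natr mulr2n ltrDr.
have subr2 : ball x0 r `<=` ball x0 rho by apply: le_ball; exact: ltW.
pose At v x := Av v (clipb r x).
have sumv (v : 'rV[R]_k) (F : 'I_k -> R) (C : R) : 0 <= C -> (forall i, `|F i| <= C) ->
    `|\sum_i v 0 i * F i| <= k%:R * `|v| * C.
  move=> C0 hF; apply: le_trans (ler_norm_sum _ _ _) _.
  apply: (@le_trans _ _ (\sum_(i < k) `|v| * C)).
    by apply: ler_sum => i _; rewrite normrM; apply: ler_pM => //; exact: rV_coord_le.
  by rewrite sumr_const card_ord -[leLHS]mulr_natl mulrA.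
have AtK v x : `|At v x| <= k%:R * `|v| * K.
  apply: rV_norm_le => [|j]; first by rewrite !mulr_ge0.
  by rewrite AvE; apply: sumv => // i; apply: (hK (i, j)); exact: clipb_ball.
have AtL v x y : `|At v x - At v y| <= k%:R * `|v| * L * `|x - y|.
  apply: rV_norm_le => [|j]; first by rewrite !mulr_ge0.
  rewrite !mxE !AvE -sumrB.
  under eq_bigr do rewrite -mulrBr.
  rewrite -mulrA; apply: sumv => [|i]; first by rewrite mulr_ge0.
  apply: le_trans (hL (i, j) _ _ (clipb_ball _ rp rlt) (clipb_ball _ rp rlt)) _.
  by rewrite ler_wpM2l // clipb_lip.
(* For [v] shorter than [delta] the field has Lipschitz constant at most 1/2 and norm at most
   [r / 2]. So [picard] applies, the solution never meets the clip, and a margin [r / 2] is left for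
   the perturbed curve [w] below. *)
pose q := k%:R * (L + K) + 1.
have q0 : 0 < q by rewrite ltr_wpDl // mulr_ge0 // addr_ge0.
pose delta := Num.min (2^-1) (r / 2) / q.
have dl0 : 0 < delta by rewrite divr_gt0 // lt_min invr_gt0 ltr0n /= divr_gt0.
have dL (v : 'rV[R]_k) : `|v| < delta -> k%:R * `|v| * L <= 2^-1 /\ k%:R * `|v| * K <= r / 2.
  move=> vd; have h : `|v| * q <= Num.min (2^-1) (r / 2) by rewrite -ler_pdivlMr // ltW.
  have n0 := normr_ge0 v; have k0 : 0 <= k%:R :> R by [].
  have e1 : 0 <= k%:R * `|v| * K by rewrite !mulr_ge0.
  have e2 : 0 <= k%:R * `|v| * L by rewrite !mulr_ge0.
  have e3 : `|v| * q = k%:R * `|v| * L + k%:R * `|v| * K + `|v| by rewrite /q; ring.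
  by rewrite e3 le_min in h; case/andP: h; split; lra.
have H (v : 'rV[R]_k) : exists g : R -> 'rV[R]_m, `|v| < delta -> g 0 = x0 /\
   forall t : R, 0 <= t <= 1 -> forall j, is_derive t 1 (fun s => g s 0 j) (At v (g t) 0 j).
  have [vd|vd] := boolP (`|v| < delta); last by exists (fun=> x0).
  have [|g hg] := @picard R m (At v) (k%:R * `|v| * K) _ (AtK v) x0; last by exists g.
  by move=> x y; apply: le_trans (AtL v x y) _; rewrite ler_wpM2r //; have [] := dL v vd.
have [g hg] := choice H.
have gin (v : 'rV[R]_k) (t : R) : `|v| < delta -> 0 <= t <= 1 -> `|x0 - g v t| <= r / 2.
  move=> vd t01; have [g0 dg] := hg v vd.
  apply: rV_norm_le => [|j]; first by rewrite divr_ge0 // ltW.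
  rewrite !mxE distrC -g0.
  have h0 : 0 <= (0 : R) <= 1 by rewrite lexx ler01.
  apply: le_trans (mvt01_le h0 t01 (fun x x01 => dg x x01 j) (K := r / 2) _) _.
    move=> x _; apply: le_trans (rV_coord_le _ _) _; apply: le_trans (AtK _ _) _.
    by have [] := dL v vd.
  rewrite subr0 ler_piMr //; first by rewrite divr_ge0 // ltW.
  by case/andP: t01 => a b; rewrite ger0_norm.
have rr2 : r / 2 < r by rewrite ltr_pdivrMr // mulr_natr mulr2n ltrDr.
have gb (v : 'rV[R]_k) (t : R) : `|v| < delta -> 0 <= t <= 1 -> ball x0 r (g v t).
  by move=> vd t01; apply/ball_normP; apply: le_lt_trans (gin v t vd t01) rr2.
have AtE v x : ball x0 r x -> At v x = Av v x by move=> bx; rewrite /At clipb_id.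
have AtC (v : 'rV[R]_k) : `|v| < delta -> forall x y, `|At v x - At v y| <= 2^-1 * `|x - y|.
  by move=> vd x y; apply: le_trans (AtL v x y) _; rewrite ler_wpM2r //; have [] := dL v vd.
exists delta, g; split=> //.
  move=> v vd; have [g0 dg] := hg v vd; split=> // [t t01|t t01 j].
    exact/subr2/gb.
  by rewrite -AvE -AtE; [exact: dg|exact: gb].
move=> comm v vd j.
have i01 : 0 <= (1 : R) <= 1 by rewrite ler01 lexx.
have AtB u u' x : At u x - At u' x = At (u - u') x.
  apply/rowP => l; rewrite !mxE !AvE -sumrB; apply: eq_bigr => i _.
  by rewrite !mxE mulrBl.
split.
  (* The solution for [v] solves the equation for [u] with a defect linear in [v - u]. *)
  have cmp u : `|u| < delta -> `|g v 1 - g u 1| <= 2 * (k%:R * `|v - u| * K).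
    move=> ud; have [g0 dg] := hg v vd; have [g0' dg'] := hg u ud.
    apply: (@ode_compare R m (At u) (AtC u ud) (g u) (g v) (fun t => At v (g v t))) => //.
      by rewrite g0 g0'.
    by move=> t _; rewrite AtB; exact: AtK.
  apply: continuous_eps => e e0.
  pose c := 2 * k%:R * K + 1.
  have c0 : 0 < c by rewrite ltr_wpDl // !mulr_ge0.
  exists (Num.min (delta - `|v|) (e / c)); first by rewrite lt_min subr_gt0 vd divr_gt0.
  move=> u /ball_normP; rewrite lt_min => /andP[u1 u2].
  have ud : `|u| < delta.
    have -> : u = v - (v - u) by rewrite subKr.
    by apply: le_lt_trans (ler_normB _ _) _; rewrite addrC -ltrBrDr.
  have := rV_coord_le (g v 1 - g u 1) j; rewrite !mxE => /le_lt_trans; apply.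
  apply: le_lt_trans (cmp u ud) _; rewrite ltr_pdivlMr // in u2.
  have n0 := normr_ge0 (v - u).
  have e3 : `|v - u| * c = 2 * (k%:R * `|v - u| * K) + `|v - u| by rewrite /c; ring.
  by lra.
move=> h.
(* The first bound keeps [v + s *: delta_mx 0 h] admissible, the second keeps [w] in the unclipped
   region. *)
pose eta := Num.min (delta - `|v|) (r / 2 / (K + 1)).
have K1 : 0 < K + 1 by rewrite ltr_wpDl.
have eta0 : 0 < eta by rewrite lt_min subr_gt0 vd /= !divr_gt0.
(* [L * K] bounds the error of evaluating [A h] at [g v t] instead of [w t]; the other term bounds
   that of evaluating the first derivatives of the [A i] at [g v t] instead of at mean-value
   points. *)
pose C := L * K + k%:R * `|v| * (m%:R * (K * (L1 * K))).
apply: (@is_derive_quadratic _ _ _ _ _ eta (2 * C) eta0) => s.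
rewrite lt_min => /andP[s1 s2].
have [g0 dg] := hg v vd.
set u := v + s *: delta_mx 0 h.
have e1 : `|s *: delta_mx 0 h : 'rV[R]_k| <= `|s|.
  apply: rV_norm_le => // l; rewrite !mxE eqxx /= normrM.
  by case: eqP; rewrite ?normr1 ?mulr1 // normr0 mulr0.
have ud : `|u| < delta.
  apply: le_lt_trans (ler_normD _ _) _; apply: le_lt_trans (lerD (lexx _) e1) _.
  by rewrite addrC -ltrBrDr.
have [g0' dg'] := hg u ud.
have sK : `|s| * K < r / 2.
  rewrite ltr_pdivlMr // in s2; apply: le_lt_trans s2.
  by rewrite ler_wpM2l // lerDl.
pose w (t : R) := g v t + (s * t) *: A h (g v t).
pose dw (t : R) : 'rV[R]_m := Av v (g v t) + s *: A h (g v t) +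
   (s * t) *: \row_j (\sum_l 'D_(delta_mx 0 l) (fun y => A h y 0 j) (g v t) * Av v (g v t) 0 l).
have AhK (t : R) : 0 <= t <= 1 -> `|A h (g v t)| <= K.
  by move=> t01; apply: rV_norm_le => // l; apply: (hK (h, l)); exact/subr2/gb.
have stK (t : R) : 0 <= t <= 1 -> `|(s * t) *: A h (g v t)| <= `|s| * K.
  move=> t01; rewrite normrZ normrM.
  have -> : `|s| * K = `|s| * 1 * K by rewrite mulr1.
  apply: ler_pM; rewrite ?mulr_ge0 //; last exact: AhK.
  by apply: ler_wpM2l => //; case/andP: t01 => a b; rewrite ger0_norm.
have wb (t : R) : 0 <= t <= 1 -> ball x0 r (w t).
  move=> t01; apply/ball_normP; rewrite /w opprD addrA.
  apply: le_lt_trans (ler_normB _ _) _.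
  have := gin v t vd t01; have := stK t t01; lra.
have wg (t : R) : 0 <= t <= 1 -> `|g v t - w t| <= `|s| * K.
  by move=> t01; rewrite /w opprD addrA subrr add0r normrN; exact: stK.
have dwP (t : R) : 0 <= t <= 1 -> forall l, is_derive t 1 (fun t => w t 0 l) (dw t 0 l).
  move=> t01 l.
  have d1 := dg t t01 l.
  have bg := subr _ (subr2 _ (gb v t vd t01)).
  have d2 := @chain_curve R m (fun y => A h y 0 l) (ball x0 rho0) (g v) (fun i => At v (g v t) 0 i) t
     (ball_open _ _) bg (sA h l 1%N) (dg t t01).
  have d3 : is_derive t (1:R) (fun t : R => s * t) s.
    by have := @is_deriveZ _ _ _ _ s t 1 _ (is_derive_id t 1); rewrite [s *: 1]mulr1.
  have d4 := @is_deriveD _ _ _ _ _ t 1 _ _ d1 (@is_deriveM _ _ _ _ t 1 _ _ d3 d2).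
  have -> : (fun t => w t 0 l) = (fun t => g v t 0 l + s * t * A h (g v t) 0 l).
    by apply/funext => t'; rewrite !mxE.
  move: d4; set a := (X in is_derive _ _ _ X -> _); set b := (X in _ -> is_derive _ _ _ X).
  suff -> : a = b by [].
  rewrite /a /b /dw !mxE /GRing.scale /= AtE; last exact: gb.
  by ring.
suff cmp : `|w 1 - g u 1| <= 2 * (C * s ^+ 2).
  have := rV_coord_le (g u 1 - w 1) j.
  rewrite distrC in cmp; move=> /le_trans/(_ cmp); rewrite !mxE mulrA mulr1 opprD addrA.
  exact.
apply: (@ode_compare R m (At u) (AtC u ud) (g u) w dw) => //.
  by rewrite /w g0 g0' mulr0 scale0r addr0.
move=> t t01.
set x := g v t.
have bx : ball x0 rho x by exact/subr2/gb.
have bw : ball x0 rho (w t) by exact/subr2/wb.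
have s20 : 0 <= s ^+ 2 by exact: sqr_ge0.
have C0 : 0 <= C by rewrite addr_ge0 // !mulr_ge0.
apply: rV_norm_le => [|l]; first by rewrite mulr_ge0.
(* Expansion of [A i] between [x] and [w t], whose displacement is [s * t] times [A h x]. *)
have Hxi i : exists xi : 'I_m -> 'rV[R]_m, (forall p, ball x0 rho (xi p) /\ `|x - xi p| <= `|s| * K) /\
    A i (w t) 0 l - A i x 0 l = \sum_p 'D_(delta_mx 0 p) (fun y => A i y 0 l) (xi p) * (s * t * A h x 0 p).
  have bz z : box x (w t) z -> ball x0 rho z by exact: box_ball.
  have [z /bz /subr bz' q'|xi [bxi E]] := @mvt_box R m (fun y => A i y 0 l) x (w t); first exact: (smooth_on_derivable (sA i l)).
  exists xi; split=> [p|].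
    split; first exact: bz.
    apply: rV_norm_le => [|p']; first by rewrite mulr_ge0.
    rewrite !mxE; have [a a01 ->] := bxi p p'.
    rewrite opprD addrA subrr add0r normrN normrM.
    have := wg t t01; rewrite -/x distrC => /(le_trans (rV_coord_le _ p')); rewrite !mxE; apply: le_trans.
    by case/andP: a01 => a0 a1; rewrite ler_piMl // ger0_norm.
  by rewrite E; apply: eq_bigr => p _; rewrite !mxE [x 0 p + _]addrC addrK.
have [xi hxi] := choice Hxi.
pose G i := \sum_p A h x 0 p * ('D_(delta_mx 0 p) (fun y => A i y 0 l) x - 'D_(delta_mx 0 p) (fun y => A i y 0 l) (xi i p)).
(* The defect of [w]. Commutation exchanges the derivative of [A h] along the field with the
   derivative of the field along [A h]; this cancels the terms linear in [s], and only differences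
   between nearby points remain. *)
have -> : (dw t - At u (w t)) 0 l = s * (A h x 0 l - A h (w t) 0 l) + s * t * \sum_i v 0 i * G i.
  rewrite AtE; last exact: wb.
  rewrite !mxE !AvE -/x.
  have -> : \sum_i u 0 i * A i (w t) 0 l = \sum_i v 0 i * A i (w t) 0 l + s * A h (w t) 0 l.
    rewrite /u; under eq_bigr do rewrite !mxE eqxx /= mulrDl.
    rewrite big_split /=; congr (_ + _); rewrite (bigD1 h) //= eqxx mulr1 big1 ?addr0 // => i ih.
    by rewrite (negbTE ih) mulr0 mul0r.
  have -> : \sum_i v 0 i * A i (w t) 0 l = \sum_i v 0 i * A i x 0 l +
      s * t * \sum_i v 0 i * \sum_p A h x 0 p * 'D_(delta_mx 0 p) (fun y => A i y 0 l) (xi i p).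
    rewrite mulr_sumr -big_split /=; apply: eq_bigr => i _.
    have [_ E] := hxi i; rewrite -[A i (w t) 0 l](subrK (A i x 0 l)) E mulrDr addrC; congr (_ + _).
    rewrite mulrCA; congr (_ * _); rewrite mulr_sumr; apply: eq_bigr => p _; ring.
  have -> : \sum_p 'D_(delta_mx 0 p) (fun y => A h y 0 l) x * Av v x 0 p =
      \sum_i v 0 i * \sum_p A h x 0 p * 'D_(delta_mx 0 p) (fun y => A i y 0 l) x.
    transitivity (\sum_i v 0 i * \sum_p A i x 0 p * 'D_(delta_mx 0 p) (fun y => A h y 0 l) x).
      under eq_bigr do rewrite AvE mulr_sumr.
      rewrite exchange_big /=; apply: eq_bigr => i _; rewrite mulr_sumr; apply: eq_bigr => p _; ring.
    by apply: eq_bigr => i _; rewrite comm //; exact: subr.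
  have -> : \sum_i v 0 i * G i = \sum_i v 0 i * (\sum_p A h x 0 p * 'D_(delta_mx 0 p) (fun y => A i y 0 l) x)
     - \sum_i v 0 i * (\sum_p A h x 0 p * 'D_(delta_mx 0 p) (fun y => A i y 0 l) (xi i p)).
    rewrite -sumrB; apply: eq_bigr => i _; rewrite -mulrBr -sumrB; congr (_ * _).
    by apply: eq_bigr => p _; rewrite mulrBr.
  ring.
have GB i : `|G i| <= m%:R * (K * (L1 * (`|s| * K))).
  apply: le_trans (ler_norm_sum _ _ _) _.
  apply: (@le_trans _ _ (\sum_(p < m) K * (L1 * (`|s| * K)))).
    apply: ler_sum => p _; rewrite normrM; apply: ler_pM => //; first exact: (hK (h, p)).
    have [/(_ p) [b1 b2] _] := hxi i.
    apply: le_trans (hL1 (i, l, p) _ _ bx b1) _; exact: ler_wpM2l.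
  by rewrite sumr_const card_ord -[leLHS]mulr_natl.
have GS := sumv v G _ (mulr_ge0 (ler0n _ m) (mulr_ge0 K0 (mulr_ge0 L10 (mulr_ge0 (normr_ge0 s) K0)))) GB.
have -> : C * s ^+ 2 = `|s| * (L * (`|s| * K)) + `|s| * 1 * (k%:R * `|v| * (m%:R * (K * (L1 * (`|s| * K))))).
  by rewrite -real_normK ?num_real // /C; ring.
apply: le_trans (ler_normD _ _) _; apply: lerD; rewrite !normrM.
  apply: ler_wpM2l => //; apply: le_trans (hL (h, l) _ _ bx bw) _.
  by apply: ler_wpM2l => //; exact: wg.
apply: ler_pM; rewrite ?mulr_ge0 // ler_wpM2l //.
by case/andP: t01 => a b; rewrite ger0_norm.
Qed.

End flow.

(** * Smooth functions, tangent vectors and vector fields *)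

Section charts.
Context {R : realType} {n : nat} {T : topologicalType}.
Implicit Types (a b : chart R n T).

Definition chart_image a := coord a @` dom a.

Lemma codom_coord a p : dom a p -> chart_image a (coord a p).
Proof. by exists p. Qed.

Lemma coord_param a x : chart_image a x -> dom a (param a x) /\ coord a (param a x) = x.
Proof. by move=> [p dp <-]; rewrite coordK. Qed.

Lemma image_coordE a (W : set T) :
  coord a @` (dom a `&` W) = chart_image a `&` param a @^-1` W.
Proof.
apply/seteqP; split=> x /=.
  by move=> [p [dp Wp] <-]; split; [exists p|rewrite /= coordK].
move=> [cx Wx]; have [d e] := coord_param cx.
by exists (param a x).
Qed.

Lemma open_image_coord a (W : set T) : open W -> open (coord a @` (dom a `&` W)).
Proof.
move=> oW; rewrite image_coordE openE => x [cx Wx].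
apply: filterI; first by apply: open_nbhs_nbhs; split => //; exact: codom_open.
by apply: (param_continuous cx); apply: open_nbhs_nbhs.
Qed.

Lemma open_preimage_coord a (V : set 'rV[R]_n) : open V -> open (dom a `&` coord a @^-1` V).
Proof.
move=> oV; rewrite openE => p [dp Vp].
apply: filterI; first by apply: open_nbhs_nbhs; split => //; exact: dom_open.
by apply: (coord_continuous dp); apply: open_nbhs_nbhs.
Qed.

End charts.

Lemma near_open (T : topologicalType) (p : T) (P : set T) : nbhs p P ->
  exists Q, [/\ open Q, Q p & Q `<=` P].
Proof. by rewrite nbhsE => -[Q [oQ Qp] hQ]; exists Q. Qed.

Section smooth_functions.
Context {R : realType} {n : nat} {M : manifold R n}.
Implicit Types (f g : M -> R) (p q : M) (a b : chart R n M).

(** Smoothness tested in a single chart around [p], against all charts of the atlas in [smooth_fun];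
    the two are reconciled by compatibility of charts. *)
Definition smooth_at f p := exists a, [/\ atlas a, dom a p &
  exists W, [/\ open W, W (coord a p), W `<=` chart_image a & smooth_on W (f \o param a)]].

Lemma smooth_fun_at f : (forall p, smooth_at f p) -> smooth_fun f.
Proof.
move=> sf b Mb; apply: smooth_on_local => y cy.
have [dq ey] := coord_param cy.
have [a [Ma da [W [oW Wq Wa sW]]]] := sf (param b y).
have st := atlas_compatible Mb Ma.
pose V := overlap b a `&` transition b a @^-1` W.
have ov : open (overlap b a) by apply: open_image_coord; exact: dom_open.
have oV : open V.
  rewrite openE => x [ox Wx]; apply: filterI; first exact: open_nbhs_nbhs.
  have ct : {for x, continuous (transition b a)}.
    by apply: continuous_rV => j; exact: (smooth_on_continuous (st j)).
  by apply: ct; exact: open_nbhs_nbhs.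
exists V; first by split; [exists (param b y)|].
apply: (@smooth_on_eq _ _ V (fun x => (f \o param a) (transition b a x))) => //.
  move=> x [[z [dz dz'] <-] _]; rewrite /transition /= coordK // coordK //.
apply: (smooth_on_comp oV oW _ _ sW) => [x []//|j].
by apply: smooth_on_sub (st j) => x [].
Qed.

Lemma smooth_at_near f F p : smooth_fun F -> (\near p, f p = F p) -> smooth_at f p.
Proof.
move=> sF /near_open [Q [oQ Qp hQ]].
have [a Ma dp] := atlas_cover p.
exists a; split=> //; exists (coord a @` (dom a `&` Q)).
have oW := @open_image_coord _ _ _ a _ oQ.
split=> //; first by exists p.
  by move=> _ [q [dq _] <-]; exact: codom_coord.
apply: (@smooth_on_eq _ _ _ (F \o param a)) => //.
  by rewrite image_coordE => x [_ /hQ /= ->].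
by apply: smooth_on_sub (sF a Ma) => _ [q [dq _] <-]; exact: codom_coord.
Qed.

Lemma smooth_fun_near f :
  (forall p, exists2 F, smooth_fun F & \near p, f p = F p) -> smooth_fun f.
Proof. by move=> h; apply: smooth_fun_at => p; have [F] := h p; exact: smooth_at_near. Qed.

Lemma smooth_fun_cst c : @smooth_fun R n M (fun=> c).
Proof. by move=> a Ma; exact: smooth_on_cst. Qed.

Lemma smooth_funD f g : smooth_fun f -> smooth_fun g -> smooth_fun (fun p => f p + g p).
Proof. by move=> sf sg a Ma; apply: (smooth_onD (@codom_open _ _ _ a) (sf a Ma) (sg a Ma)). Qed.

Lemma smooth_funM f g : smooth_fun f -> smooth_fun g -> smooth_fun (fun p => f p * g p).
Proof. by move=> sf sg a Ma; apply: (smooth_onM (@codom_open _ _ _ a) (sf a Ma) (sg a Ma)). Qed.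

Lemma smooth_fun_sum (I : Type) (r : seq I) (f : I -> M -> R) :
  (forall i, smooth_fun (f i)) -> smooth_fun (fun p => \sum_(i <- r) f i p).
Proof. by move=> sf a Ma; apply: (smooth_on_sum _ (@codom_open _ _ _ a)) => i; exact: sf. Qed.

Lemma smooth_fun_prod (I : Type) (r : seq I) (f : I -> M -> R) :
  (forall i, smooth_fun (f i)) -> smooth_fun (fun p => \prod_(i <- r) f i p).
Proof. by move=> sf a Ma; apply: (smooth_on_prod _ (@codom_open _ _ _ a)) => i; exact: sf. Qed.

Lemma smooth_funZ c f : smooth_fun f -> smooth_fun (fun p => c * f p).
Proof. by apply: smooth_funM; exact: smooth_fun_cst. Qed.

Lemma smooth_funN f : smooth_fun f -> smooth_fun (fun p => - f p).
Proof. by move/(smooth_funZ (-1)); under eq_fun do rewrite mulN1r. Qed.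

Lemma smooth_funB f g : smooth_fun f -> smooth_fun g -> smooth_fun (fun p => f p - g p).
Proof. by move=> sf sg; apply: smooth_funD => //; exact: smooth_funN. Qed.

Lemma smooth_funV f : (forall p, f p != 0) -> smooth_fun f -> smooth_fun (fun p => (f p)^-1).
Proof. by move=> f0 sf a Ma; apply: (smooth_onV (@codom_open _ _ _ a) _ (sf a Ma)) => x _; exact: f0. Qed.

Lemma smooth_fun_continuous f : smooth_fun f -> continuous f.
Proof.
move=> sf p; have [a Ma dp] := atlas_cover p.
have c1 : {for p, continuous (fun q => (f \o param a) (coord a q))}.
  apply: (@continuous_comp _ _ _ (coord a) (f \o param a) p); first exact: coord_continuous.
  by apply: smooth_on_continuous (sf a Ma) _ _; exact: codom_coord.
rewrite /continuous_at; have : (f \o param a) (coord a p) = f p by rewrite /= coordK.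
move=> e; rewrite /prop_for /continuous_at e in c1; apply: cvg_trans c1.
apply: near_eq_cvg.
have : nbhs p (dom a) by apply: open_nbhs_nbhs; split => //; exact: dom_open.
by apply: filterS => q dq /=; rewrite coordK.
Qed.

(** The last clause is the main tool for globalization: a smooth function of the coordinates,
    multiplied by [chi] and extended by 0, is smooth on all of [M]. *)
Lemma bump_ext a p (W : set M) : atlas a -> dom a p -> open W -> W p ->
  exists chi : M -> R, [/\ smooth_fun chi,
    exists2 O, open O & O p /\ forall q, O q -> chi q = 1,
    forall q, chi q != 0 -> dom a q /\ W q &
    forall u, smooth_on (coord a @` (dom a `&` W)) u -> smooth_fun (fun q => chi q * u (coord a q))].
Proof.
move=> Ma dp oW Wp.
pose Om := coord a @` (dom a `&` W).
have oOm : open Om by exact: open_image_coord.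
have Omp : Om (coord a p) by exists p.
have /nbhs_ballP[r /= r0 hr] : nbhs (coord a p) Om by exact: open_nbhs_nbhs.
have r2 : 0 < r / 2 by rewrite divr_gt0.
have [b [sb [r' r'0 b1] b0]] := bump_rV (coord a p) r2.
pose chi q := if `[< dom a q >] then b (coord a q) else 0.
pose A : set 'rV[R]_n := [set v | forall i, `[coord a p 0 i - r / 2, coord a p 0 i + r / 2]%classic (v 0 i)].
have cA : compact A.
  by apply: (@rV_compact R n (fun i => `[coord a p 0 i - r / 2, coord a p 0 i + r / 2]%classic)) => i; exact: segment_compact.
have AOm : A `<=` Om.
  move=> x Ax; apply: hr; apply/ball_rVP => // j.
  have := Ax j; rewrite /= in_itv /= => /andP[h1 h2].
  apply: (@le_lt_trans _ _ (r / 2)); last by rewrite ltr_pdivrMr // mulr_natr mulr2n ltrDr.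
  by rewrite ler_distlC; lra.
have Omc : Om `<=` chart_image a by move=> _ [q [dq _] <-]; exact: codom_coord.
(* The image of a compact cube is closed because [M] is Hausdorff. Hence [chi] vanishes on an open
   set around every point outside [K], which gives smoothness there. *)
pose K := param a @` A.
have cK : closed K.
  apply: compact_closed; first exact: manifold_hausdorff.
  apply: continuous_compact cA; apply: continuous_in_subspaceT => x /set_mem /AOm /Omc.
  exact: param_continuous.
have chiK q : chi q != 0 -> dom a q /\ K q.
  rewrite /chi; case: asboolP => [dq bq|]; last by rewrite eqxx.
  split=> //; exists (coord a q); last by rewrite coordK.
  move=> i; have /ball_rVP := b0 _ bq; move=> /(_ r2 i) /ltW.
  by rewrite /= in_itv /= ler_distlC; lra.
have ext u : smooth_on Om u -> smooth_fun (fun q => chi q * u (coord a q)).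
  move=> su; apply: smooth_fun_at => q.
  have [Kq|nKq] := pselect (K q); last first.
    apply: (@smooth_at_near _ (fun=> 0)); first exact: smooth_fun_cst.
    have : nbhs q (~` K) by apply: open_nbhs_nbhs; split => //; exact: closed_openC.
    apply: filterS => q' nK; have [->|/chiK [_ /nK]//] := eqVneq (chi q') 0.
    by rewrite mul0r.
  have [x Ax xq] := Kq; have Ox := AOm _ Ax; have [dx ex] := coord_param (Omc _ Ox).
  rewrite xq in dx ex.
  exists a; split=> //; exists Om; split=> //; first by rewrite ex.
  apply: (@smooth_on_eq _ _ _ (fun x => b x * u x)) => //.
    move=> y /Omc /coord_param [dy ey] /=.
    by rewrite /chi asboolT // ey.
  by apply: smooth_onM => //; exact: smooth_on_sub sb.
exists chi; split=> //.
- by have := ext (fun=> 1) (smooth_on_cst _ _); under eq_fun do rewrite mulr1.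
- exists (dom a `&` coord a @^-1` ball (coord a p) r'); first by apply: open_preimage_coord; exact: ball_open.
  split; first by split => //; exact: ballxx.
  by move=> q [dq bq]; rewrite /chi asboolT // b1.
- move=> q cq; have [dq [x Ax xq]] := chiK q cq; split=> //.
  by have := AOm _ Ax; rewrite /Om image_coordE => -[_]; rewrite /= xq.
Qed.

End smooth_functions.

(** * Tangent vectors as derivations, vector fields and brackets *)

Section tangent_vectors.
Context {R : realType} {n : nat} {M : manifold R n}.
Implicit Types (f g : M -> R) (p q : M) (v w : tvec R M) (X Y : field R M).

Lemma tangent_nonsmooth p v f : tangent p v -> ~ smooth_fun f -> v f = 0.
Proof. by move=> [h _ _]; exact: h. Qed.

Lemma tangent_lin p v a f g : tangent p v -> smooth_fun f -> smooth_fun g ->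
  v (fun q => a * f q + g q) = a * v f + v g.
Proof. by move=> [_ h _]; exact: h. Qed.

Lemma tangentM p v f g : tangent p v -> smooth_fun f -> smooth_fun g ->
  v (fun q => f q * g q) = v f * g p + f p * v g.
Proof. by move=> [_ _ h]; exact: h. Qed.

Lemma tangentD p v f g : tangent p v -> smooth_fun f -> smooth_fun g ->
  v (fun q => f q + g q) = v f + v g.
Proof.
by move=> tv sf sg; have := tangent_lin 1 tv sf sg; rewrite mul1r; under eq_fun do rewrite mul1r.
Qed.

Lemma tangent_cst p v c : tangent p v -> v (fun=> c) = 0.
Proof.
move=> tv.
have v1 : v (fun=> 1) = 0.
  have := tangentM tv (smooth_fun_cst 1) (smooth_fun_cst 1).
  by under eq_fun do rewrite mulr1; rewrite mulr1 mul1r => /eqP; rewrite -subr_eq0 opprD addNKr oppr_eq0 => /eqP.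
have v0 : v (fun=> 0) = 0.
  have := tangentM tv (smooth_fun_cst 0) (smooth_fun_cst 0).
  by under eq_fun do rewrite mulr0; rewrite mulr0 mul0r addr0.
have := tangent_lin c tv (smooth_fun_cst 1) (smooth_fun_cst 0).
by rewrite v1 v0 mulr0 !addr0 mulr1.
Qed.

Lemma tangentZ p v c f : tangent p v -> smooth_fun f -> v (fun q => c * f q) = c * v f.
Proof.
move=> tv sf; have := tangent_lin c tv sf (smooth_fun_cst 0).
by rewrite (tangent_cst _ tv) addr0; under eq_fun do rewrite addr0.
Qed.

Lemma tangentB p v f g : tangent p v -> smooth_fun f -> smooth_fun g ->
  v (fun q => f q - g q) = v f - v g.
Proof.
move=> tv sf sg; have := tangent_lin (-1) tv sg sf; rewrite mulN1r addrC => <-.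
by congr v; apply/funext => q; rewrite mulN1r addrC.
Qed.

Lemma tangent_sum p v (I : Type) (r : seq I) (f : I -> M -> R) : tangent p v ->
  (forall i, smooth_fun (f i)) -> v (fun q => \sum_(i <- r) f i q) = \sum_(i <- r) v (f i).
Proof.
move=> tv sf; elim: r => [|i r IH].
  by rewrite big_nil; under eq_fun do rewrite big_nil; exact: tangent_cst tv.
rewrite big_cons -IH; under eq_fun do rewrite big_cons.
by apply: tangentD tv _ _ => //; exact: smooth_fun_sum.
Qed.

(** Derivations are local: for a bump function [chi] supported where [f = g], the product of [chi]
    and [f - g] is zero, and the Leibniz rule at [p], where [chi] is 1, isolates [v] on [f - g]. *)
Lemma tangent_near p v f g : tangent p v -> smooth_fun f -> smooth_fun g ->
  (\near p, f p = g p) -> v f = v g.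
Proof.
move=> tv sf sg /near_open [Q [oQ Qp hQ]].
have [a Ma dp] := atlas_cover p.
have [chi [sc [Z oZ [Zp c1]] c0 _]] := bump_ext Ma dp oQ Qp.
apply/eqP; rewrite -subr_eq0; apply/eqP.
have sB := smooth_funB sf sg.
rewrite -(tangentB tv sf sg).
have E : v (fun q => chi q * (f q - g q)) = 0.
  rewrite (_ : (fun q => _) = (fun=> 0)); first exact: tangent_cst tv.
  apply/funext => q; have [->|/c0 [_ /hQ ->]] := eqVneq (chi q) 0; first by rewrite mul0r.
  by rewrite subrr mulr0.
have := tangentM tv sc sB; rewrite E (hQ p Qp) subrr mulr0 add0r (c1 p Zp) mul1r.
by move=> <-.
Qed.

Lemma tangent0 p : tangent p (0 : tvec R M).
Proof.
by split=> // *; rewrite /GRing.zero /= ?mulr0 ?mul0r ?addr0.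
Qed.

Lemma tangent_comb p c v w : tangent p v -> tangent p w -> tangent p (c *: v + w).
Proof.
move=> tv tw; have E f : (c *: v + w) f = c * v f + w f by [].
split=> [f nf|a f h sf sh|f h sf sh]; rewrite !E.
- by rewrite (tangent_nonsmooth tv nf) (tangent_nonsmooth tw nf) mulr0 addr0.
- by rewrite (tangent_lin a tv sf sh) (tangent_lin a tw sf sh); ring.
- by rewrite (tangentM tv sf sh) (tangentM tw sf sh); ring.
Qed.

Lemma tangent_add p v w : tangent p v -> tangent p w -> tangent p (v + w).
Proof. by move=> tv tw; have := tangent_comb 1 tv tw; rewrite scale1r. Qed.

Lemma tangent_scale p c v : tangent p v -> tangent p (c *: v).
Proof. by move=> tv; have := tangent_comb c tv (tangent0 p); rewrite addr0. Qed.

Lemma tangent_sub p v w : tangent p v -> tangent p w -> tangent p (v - w).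
Proof. by move=> tv tw; rewrite -scaleN1r addrC; exact: tangent_comb. Qed.

Lemma tangent_bigsum p (I : Type) (r : seq I) (v : I -> tvec R M) :
  (forall i, tangent p (v i)) -> tangent p (\sum_(i <- r) v i).
Proof.
move=> tv; elim: r => [|i r IH]; first by rewrite big_nil; exact: tangent0.
by rewrite big_cons; exact: tangent_add.
Qed.

Lemma tvec_sumE (I : Type) (r : seq I) (v : I -> tvec R M) f :
  (\sum_(i <- r) v i) f = \sum_(i <- r) v i f.
Proof. by elim: r => [|i r IH]; rewrite ?big_nil // !big_cons -IH. Qed.

Lemma tangent_ext p v w : tangent p v -> tangent p w ->
  (forall f, smooth_fun f -> v f = w f) -> v = w.
Proof.
move=> tv tw h; apply/funext => f; have [/h //|nf] := pselect (smooth_fun f).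
by rewrite (tangent_nonsmooth tv nf) (tangent_nonsmooth tw nf).
Qed.

Lemma vector_field0 : vector_field (fun=> 0 : tvec R M).
Proof. by split=> [p|f sf]; [exact: tangent0|exact: smooth_fun_cst]. Qed.

Lemma vector_fieldD X Y : vector_field X -> vector_field Y -> vector_field (fun p => X p + Y p).
Proof.
move=> [tX sX] [tY sY]; split=> [p|f sf]; first exact: tangent_add.
exact: smooth_funD (sX f sf) (sY f sf).
Qed.

Lemma vector_fieldZ f X : smooth_fun f -> vector_field X -> vector_field (fun p => f p *: X p).
Proof.
move=> sf [tX sX]; split=> [p|h sh]; first exact: tangent_scale.
exact: smooth_funM sf (sX h sh).
Qed.

Lemma vector_fieldN X : vector_field X -> vector_field (fun p => - X p).
Proof.
move=> vX; have := vector_fieldZ (smooth_fun_cst (-1)) vX.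
by under eq_fun do rewrite scaleN1r.
Qed.

Lemma vector_fieldB X Y : vector_field X -> vector_field Y -> vector_field (fun p => X p - Y p).
Proof. by move=> vX vY; apply: vector_fieldD => //; exact: vector_fieldN. Qed.

Lemma vector_field_sum (I : Type) (r : seq I) (X : I -> field R M) :
  (forall i, vector_field (X i)) -> vector_field (fun p => \sum_(i <- r) X i p).
Proof.
move=> vX; elim: r => [|i r IH].
  by under eq_fun do rewrite big_nil; exact: vector_field0.
by under eq_fun do rewrite big_cons; exact: vector_fieldD.
Qed.

Lemma vector_field_near X : (forall p, tangent p (X p)) ->
  (forall p, exists2 Y, vector_field Y & \near p, X p = Y p) -> vector_field X.
Proof.
move=> tX h; split=> // f sf; apply: smooth_fun_near => p.
have [Y [_ sY] hY] := h p; exists (fun q => Y q f); first exact: sY.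
by apply: filterS hY => q ->.
Qed.

Lemma bracket_tangent X Y p : vector_field X -> vector_field Y -> tangent p (bracket X Y p).
Proof.
move=> [tX sX] [tY sY]; split=> [f nf|a f h sf sh|f h sf sh]; rewrite /bracket.
- have -> : (fun q => Y q f) = (fun=> 0) by apply/funext => q; rewrite (tangent_nonsmooth (tY q) nf).
  have -> : (fun q => X q f) = (fun=> 0) by apply/funext => q; rewrite (tangent_nonsmooth (tX q) nf).
  by rewrite (tangent_cst _ (tX p)) (tangent_cst _ (tY p)) subrr.
- have -> : (fun q => Y q (fun q => a * f q + h q)) = (fun q => a * Y q f + Y q h).
    by apply/funext => q; rewrite (tangent_lin a (tY q) sf sh).
  have -> : (fun q => X q (fun q => a * f q + h q)) = (fun q => a * X q f + X q h).
    by apply/funext => q; rewrite (tangent_lin a (tX q) sf sh).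
  rewrite (tangent_lin a (tX p) (sY f sf) (sY h sh)) (tangent_lin a (tY p) (sX f sf) (sX h sh)).
  by ring.
- have -> : (fun q => Y q (fun q => f q * h q)) = (fun q => Y q f * h q + f q * Y q h).
    by apply/funext => q; rewrite (tangentM (tY q) sf sh).
  have -> : (fun q => X q (fun q => f q * h q)) = (fun q => X q f * h q + f q * X q h).
    by apply/funext => q; rewrite (tangentM (tX q) sf sh).
  rewrite (tangentD (tX p) (smooth_funM (sY f sf) sh) (smooth_funM sf (sY h sh))).
  rewrite (tangentD (tY p) (smooth_funM (sX f sf) sh) (smooth_funM sf (sX h sh))).
  rewrite (tangentM (tX p) (sY f sf) sh) (tangentM (tX p) sf (sY h sh)).
  rewrite (tangentM (tY p) (sX f sf) sh) (tangentM (tY p) sf (sX h sh)).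
  by ring.
Qed.

Lemma vector_field_bracket X Y : vector_field X -> vector_field Y -> vector_field (bracket X Y).
Proof.
move=> vX vY; split=> [p|f sf]; first exact: bracket_tangent.
have [tX sX] := vX; have [tY sY] := vY.
exact: smooth_funB (sX _ (sY f sf)) (sY _ (sX f sf)).
Qed.

(** Coordinate functions and coordinate fields as global objects, with the usual relations only on
    [W]. The spanning clause shows that derivations form a space of the expected dimension. *)
Lemma coord_frame (a : chart R n M) p : atlas a -> dom a p ->
  exists (x : 'I_n -> M -> R) (E : 'I_n -> field R M) (W : set M),
  [/\ open W, W p, W `<=` dom a & forall j, smooth_fun (x j)] /\
  [/\ forall i, vector_field (E i),
      forall q j, W q -> x j q = coord a q 0 j,
      forall q i f, W q -> smooth_fun f ->
        E i q f = 'D_(delta_mx 0 i) (f \o param a) (coord a q),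
      forall q i j, W q -> E i q (x j) = (i == j)%:R &
      forall q v, W q -> tangent q v -> v = \sum_j v (x j) *: E j q].
Proof.
move=> Ma dp.
have oT : open [set: M] by exact: openT.
have [chi [schi [W0 oW0 [W0p c1]] c0 ext]] := bump_ext Ma dp oT I.
rewrite setIT in ext.
pose x j q := chi q * coord a q 0 j.
(* The value 0 on non-smooth functions is imposed by [tangent]; the factor [chi] extends the field
   by 0 outside the chart. *)
pose E i : field R M := fun q f => if `[< smooth_fun f >] then
   chi q * 'D_(delta_mx 0 i) (f \o param a) (coord a q) else 0.
have sx j : smooth_fun (x j) by apply: (ext (fun y => y 0 j)); exact: smooth_on_coord.
have EE i q f : smooth_fun f -> E i q f = chi q * 'D_(delta_mx 0 i) (f \o param a) (coord a q).
  by move=> sf; rewrite /E asboolT.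
have drv f i q : smooth_fun f -> dom a q -> derivable (f \o param a) (coord a q) (delta_mx 0 i).
  by move=> sf dq; apply: (smooth_on_derivable (sf a Ma)); exact: codom_coord.
have vE i : vector_field (E i).
  split=> [q|f sf]; last first.
    under eq_fun do rewrite (EE i _ f sf).
    by apply: (ext ('D_(delta_mx 0 i) (f \o param a))); apply: smooth_on_derive; exact: sf.
  split=> [f nf|c f h sf sh|f h sf sh]; first by rewrite /E asboolF.
  - rewrite !EE //; last by apply: smooth_funD => //; exact: smooth_funZ.
    have [->|/c0 [dq _]] := eqVneq (chi q) 0; first by rewrite !mul0r mulr0 addr0.
    have -> : (fun q => c * f q + h q) \o param a = c \*: (f \o param a) + (h \o param a) by [].
    rewrite deriveD; [|by apply: derivableZ; exact: drv|exact: drv].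
    by rewrite deriveZ; [rewrite /GRing.scale /=; ring|exact: drv].
  - rewrite !EE //; last exact: smooth_funM.
    have [->|/c0 [dq _]] := eqVneq (chi q) 0; first by rewrite !mul0r mulr0 addr0.
    have -> : (fun q => f q * h q) \o param a = (f \o param a) * (h \o param a) by [].
    rewrite deriveM; [|exact: drv|exact: drv].
    by rewrite /GRing.scale /= !coordK //; ring.
pose W := W0.
have Wd : W `<=` dom a by move=> q Wq; have [|] := c0 q; first by rewrite (c1 q Wq) oner_neq0.
have xE q j : W q -> x j q = coord a q 0 j by move=> Wq; rewrite /x c1 // mul1r.
have EW q i f : W q -> smooth_fun f -> E i q f = 'D_(delta_mx 0 i) (f \o param a) (coord a q).
  by move=> Wq sf; rewrite EE // c1 // mul1r.
have Ex q i j : W q -> E i q (x j) = (i == j)%:R.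
  move=> Wq; rewrite EW //.
  have nr : \forall y \near coord a q, (x j \o param a) y = y 0 j.
    have : nbhs (coord a q) (coord a @` (dom a `&` W)).
      by apply: open_nbhs_nbhs; split; [exact: open_image_coord|exists q => //; split => //; exact: Wd].
    by apply: filterS => _ [q' [dq' Wq'] <-] /=; rewrite coordK // xE.
  rewrite (near_eq_derive _ nr).
  by have [_ ->] := is_derive_coord (coord a q) (delta_mx 0 i) j; rewrite mxE eqxx /= eq_sym.
exists x, E, W; split=> //; split=> // q v Wq tv.
have dq := Wd q Wq.
have tE j : tangent q (E j q) by have [] := vE j.
apply: (@tangent_ext q) => //; first by apply: tangent_bigsum => j; apply: tangent_scale.
move=> f sf; rewrite tvec_sumE.
pose xq := coord a q.
have /nbhs_ballP[r /= r0 hr] : nbhs xq (chart_image a).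
  by apply: open_nbhs_nbhs; split; [exact: codom_open|exact: codom_coord].
have sfb : smooth_on (ball xq r) (f \o param a) by exact: smooth_on_sub hr (sf a Ma).
have [h [sh hf]] := hadamard sfb.
pose Q := dom a `&` coord a @^-1` ball xq r.
have oQ : open Q by apply: open_preimage_coord; exact: ball_open.
have Qq : Q q by split => //; exact: ballxx.
have [chq [schq [W1 oW1 [W1q cq1]] cq0 extq]] := bump_ext Ma dq oQ Qq.
pose H j q' := chq q' * h j (coord a q').
have sH j : smooth_fun (H j).
  apply: (extq (h j)); apply: smooth_on_sub (sh j).
  by move=> _ [q' [_ [_ bq']] <-].
have fE : \forall z \near q, f z = (fun q' => f q + \sum_j (x j q' - x j q) * H j q') z.
  have : nbhs q (W1 `&` W) by apply: open_nbhs_nbhs; split; [exact: openI|split].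
  apply: filterS => q' [W1q' Wq'].
  have [dq' [_ bq']] : dom a q' /\ Q q' by apply: cq0; rewrite cq1 // oner_neq0.
  have := hf _ bq'; rewrite /= !coordK // => ->; congr (_ + _).
  by apply: eq_bigr => j _; rewrite !xE // /H cq1 // mul1r.
have sxx j : smooth_fun (fun q' => x j q' - x j q) by apply: smooth_funB => //; exact: smooth_fun_cst.
have sG : smooth_fun (fun q' => f q + \sum_j (x j q' - x j q) * H j q').
  apply: smooth_funD; first exact: smooth_fun_cst.
  by apply: smooth_fun_sum => j; exact: smooth_funM.
(* Near [q], Hadamard's lemma writes [f] as a constant plus a sum of products of [x j - x j q] and
   [H j]. A derivation at [q] sees only the values [H j q], and applying this to [E j q] identifies
   these as the partial derivatives. *)
have key u : tangent q u -> u f = \sum_j u (x j) * H j q.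
  move=> tu; rewrite (tangent_near tu sf sG fE).
  rewrite (tangentD tu (smooth_fun_cst _)); last by apply: smooth_fun_sum => j; exact: smooth_funM.
  rewrite (tangent_cst _ tu) add0r (tangent_sum _ tu); last by move=> j; exact: smooth_funM.
  apply: eq_bigr => j _; rewrite (tangentM tu) // subrr mul0r addr0; congr (_ * _).
  by rewrite (tangentB tu _ (smooth_fun_cst _)) // (tangent_cst _ tu) subr0.
rewrite key //; apply: eq_bigr => j _; rewrite [RHS]/GRing.scale /=.
congr (_ * _); rewrite key // (bigD1 j) //= Ex // eqxx mul1r big1 ?addr0 // => i ij.
by rewrite Ex // eq_sym (negbTE ij) mul0r.
Qed.

End tangent_vectors.

(** * Local frames, metrics and connections *)

Section localization.
Context {R : realType} {n : nat} {M : manifold R n}.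
Implicit Types (f : M -> R) (p q : M) (v w : tvec R M) (X Y : field R M).

Lemma tvecZE a v f : (a *: v) f = a * v f.
Proof. by []. Qed.

Lemma bump_at p (W : set M) : open W -> W p ->
  exists chi : M -> R, [/\ smooth_fun chi, \forall q \near p, chi q = 1 &
    forall q, chi q != 0 -> W q].
Proof.
move=> oW Wp; have [a Ma dp] := atlas_cover p.
have [chi [schi [Z oZ [Zp c1]] c0 _]] := bump_ext Ma dp oW Wp.
exists chi; split=> // [|q /c0 []//].
by apply: filterS c1 _; exact: open_nbhs_nbhs.
Qed.

(** A global smooth function that agrees with the inverse of [f] near [p] only, as [f] may vanish
    elsewhere. *)
Lemma smooth_fun_local_inv f p : smooth_fun f -> f p != 0 ->
  exists2 h, smooth_fun h & \forall q \near p, h q * f q = 1.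
Proof.
move=> sf fp.
have oW : open [set q | f q != 0].
  have -> : [set q | f q != 0] = f @^-1` [set x | x != 0] by [].
  by apply: open_comp => [q _|]; [exact: smooth_fun_continuous|exact: open_neq].
have [chi [schi c1 c0]] := bump_at oW fp.
(* This sum of squares vanishes nowhere, since [chi] cannot be 0 and 1 at once, and it equals the
   square of [f] near [p]; so [f / e] is the inverse of [f] there. *)
pose e q := (chi q * f q) * (chi q * f q) + (1 - chi q) * (1 - chi q).
have e0 q : e q != 0.
  rewrite /e; have [c|/c0 /= fq] := eqVneq (chi q) 0.
    by rewrite c mul0r mul0r add0r subr0 mulr1 oner_neq0.
  have h1 : 0 <= (chi q * f q) ^+ 2 by exact: sqr_ge0.
  have h2 : 0 <= (1 - chi q) ^+ 2 by exact: sqr_ge0.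
  rewrite -!expr2 paddr_eq0 // !expf_eq0 /= mulf_eq0 (negbTE fq) orbF subr_eq0.
  by apply/negP => /andP[/eqP -> /eqP /esym /eqP]; rewrite eq_sym oner_eq0.
have scf := smooth_funM schi sf.
have s1c : smooth_fun (fun q => 1 - chi q) by apply: smooth_funB => //; exact: smooth_fun_cst.
have se : smooth_fun e by apply: smooth_funD; exact: smooth_funM.
exists (fun q => (e q)^-1 * f q); first by apply: smooth_funM => //; exact: smooth_funV.
have nf : \forall q \near p, f q != 0 by apply: open_nbhs_nbhs; split.
apply: filterS2 c1 nf => q cq fq.
by rewrite /e cq subrr mulr0 addr0 mul1r; field.
Qed.

Lemma smooth_fun_det k (m : 'I_k -> 'I_k -> M -> R) :
  (forall i j, smooth_fun (m i j)) -> smooth_fun (fun q => \det (\matrix_(i, j) m i j q)).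
Proof.
move=> sm.
have -> : (fun q => \det (\matrix_(i, j) m i j q)) =
    (fun q => \sum_(s <- index_enum {perm 'I_k}) (-1) ^+ s * \prod_(i <- index_enum 'I_k) m i (s i) q).
  apply/funext => q; rewrite /determinant; apply: eq_bigr => s _; congr (_ * _).
  by apply: eq_bigr => i _; rewrite mxE.
apply: smooth_fun_sum => s; apply: smooth_funZ; apply: smooth_fun_prod => i; exact: sm.
Qed.

(** Cramer's rule, with the determinant inverted by [smooth_fun_local_inv]. *)
Lemma local_inverse_matrix k (m : 'I_k -> 'I_k -> M -> R) p :
  (forall i j, smooth_fun (m i j)) -> (\matrix_(i, j) m i j p) \in unitmx ->
  exists2 c : 'I_k -> 'I_k -> M -> R, forall i j, smooth_fun (c i j) &
    \forall q \near p, forall i l, \sum_j c i j q * m j l q = (i == l)%:R.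
Proof.
move=> sm; rewrite unitmxE unitfE => d0.
have [h sh hd] := smooth_fun_local_inv (smooth_fun_det sm) d0.
pose c i j q := h q * cofactor (\matrix_(i, j) m i j q) j i.
exists c => [i j|].
  apply: smooth_funM => //.
  have -> : (fun q => cofactor (\matrix_(i, j) m i j q) j i) =
     (fun q => (-1) ^+ (j + i) * \det (\matrix_(a, b) m (lift j a) (lift i b) q)).
    apply/funext => q; rewrite /cofactor; congr (_ * \det _).
    by apply/matrixP => a b; rewrite !mxE.
  by apply: smooth_funZ; apply: smooth_fun_det => a b; exact: sm.
apply: filterS hd => q hq i l.
set A := \matrix_(i, j) m i j q in hq *.
have /matrixP/(_ i l) := mul_adj_mx A.
rewrite !mxE => E.
have -> : \sum_j c i j q * m j l q = h q * (\sum_j (\adj A) i j * A j l).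
  rewrite mulr_sumr; apply: eq_bigr => j _.
  have -> : A j l = m j l q by rewrite mxE.
  have -> : (\adj A) i j = cofactor A j i by rewrite mxE.
  by rewrite mulrA.
by rewrite E mulrnAr hq.
Qed.

(** A free family of [n] vectors spans: the matrix of its values on the coordinates is free with [n]
    rows, hence invertible. *)
Lemma tangent_span (I : finType) (u : I -> tvec R M) p : #|I| = n ->
  (forall i, tangent p (u i)) -> (forall a : I -> R, \sum_i a i *: u i = 0 -> forall i, a i = 0) ->
  forall v, tangent p v -> exists a : I -> R, v = \sum_i a i *: u i.
Proof.
move=> cI tu fu v tv.
have [a Ma dp] := atlas_cover p.
have [x [E [W [[oW Wp Wd sx] [vE xE EW Ex span]]]]] := coord_frame Ma dp.
pose A : 'M[R]_(#|I|, n) := \matrix_(i, j) (u (enum_val i) (x j) : R).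
have zero w : tangent p w -> (forall j, w (x j) = 0) -> w = 0.
  by move=> tw w0; rewrite (span p w Wp tw); apply: big1 => j _; rewrite w0 scale0r.
have fA : row_free A.
  apply/row_freeP; apply: contrapT => nf.
  have : ~~ row_free A by apply/negP => /row_freeP.
  rewrite -kermx_eq0 => /rowV0Pn [b /sub_kermxP bA /eqP b0]; apply: b0.
  apply/rowP => i; rewrite mxE.
  have : \sum_i b 0 (enum_rank i) *: u i = 0.
    apply: zero => [|j]; first by apply: tangent_bigsum => i'; exact: tangent_scale.
    rewrite tvec_sumE.
    have /matrixP/(_ 0 j) := bA; rewrite !mxE => bA0; rewrite -[RHS]bA0.
    rewrite (reindex (@enum_val I I)) /=; last by exists enum_rank => ? _; rewrite ?enum_valK ?enum_rankK.
    by apply: eq_bigr => i' _; rewrite mxE enum_valK.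
  by move/fu/(_ (enum_val i)); rewrite enum_valK.
have fullA : row_full A by rewrite -col_leq_rank -[X in (X <= _)%N]cI; rewrite /row_free in fA; rewrite (eqP fA).
have /submxP [b vb] : ((\row_j (v (x j) : R)) <= A)%MS by exact: submx_full.
exists (fun i => b 0 (enum_rank i)).
apply/eqP; rewrite -subr_eq0; apply/eqP.
have ts : tangent p (\sum_i b 0 (enum_rank i) *: u i).
  by apply: tangent_bigsum => i; exact: tangent_scale.
apply: zero => [|j]; first exact: tangent_sub.
have -> : (v - \sum_i b 0 (enum_rank i) *: u i) (x j) = v (x j) - (\sum_i b 0 (enum_rank i) *: u i) (x j) by [].
rewrite tvec_sumE; have /rowP/(_ j) := vb; rewrite !mxE => ->.
apply/eqP; rewrite subr_eq0; apply/eqP; apply/esym.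
rewrite (reindex (@enum_val I I)) /=; last by exists enum_rank => ? _; rewrite ?enum_valK ?enum_rankK.
by apply: eq_bigr => i' _; rewrite mxE enum_valK.
Qed.

Section metric.
Context (g : metric R M) (mg : metric_tensor g).

Lemma gC p v w : tangent p v -> tangent p w -> g p v w = g p w v.
Proof. by have [h _ _] := mg; exact: h. Qed.

Lemma g_lin p a v v' w : tangent p v -> tangent p v' -> tangent p w ->
  g p (a *: v + v') w = a * g p v w + g p v' w.
Proof. by have [_ h _] := mg; exact: h. Qed.

Lemma gDl p v v' w : tangent p v -> tangent p v' -> tangent p w ->
  g p (v + v') w = g p v w + g p v' w.
Proof. by move=> tv tv' tw; have := g_lin 1 tv tv' tw; rewrite scale1r mul1r. Qed.

Lemma g0l p w : tangent p w -> g p 0 w = 0.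
Proof.
move=> tw; have t0 := tangent0 p; have := gDl t0 t0 tw.
by rewrite addr0 => /eqP; rewrite -subr_eq0 opprD addNKr oppr_eq0 => /eqP.
Qed.

Lemma gZl p a v w : tangent p v -> tangent p w -> g p (a *: v) w = a * g p v w.
Proof. by move=> tv tw; have := g_lin a tv (tangent0 p) tw; rewrite addr0 (g0l tw) addr0. Qed.

Lemma gBl p v v' w : tangent p v -> tangent p v' -> tangent p w ->
  g p (v - v') w = g p v w - g p v' w.
Proof. by move=> tv tv' tw; have := g_lin (-1) tv' tv tw; rewrite scaleN1r mulN1r addrC => ->; rewrite addrC. Qed.

Lemma g_suml p (I : Type) (r : seq I) (v : I -> tvec R M) w : (forall i, tangent p (v i)) -> tangent p w ->
  g p (\sum_(i <- r) v i) w = \sum_(i <- r) g p (v i) w.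
Proof.
move=> tv tw; elim: r => [|i r IH]; first by rewrite !big_nil g0l.
by rewrite !big_cons gDl ?IH //; exact: tangent_bigsum.
Qed.

Lemma gDr p v w w' : tangent p v -> tangent p w -> tangent p w' ->
  g p v (w + w') = g p v w + g p v w'.
Proof. by move=> tv tw tw'; rewrite gC ?gDl ?(gC tw) ?(gC tw') //; exact: tangent_add. Qed.

Lemma gZr p a v w : tangent p v -> tangent p w -> g p v (a *: w) = a * g p v w.
Proof. by move=> tv tw; rewrite gC ?gZl ?(gC tw) //; exact: tangent_scale. Qed.

Lemma g_sumr p (I : Type) (r : seq I) (v : I -> tvec R M) w : (forall i, tangent p (v i)) -> tangent p w ->
  g p w (\sum_(i <- r) v i) = \sum_(i <- r) g p w (v i).
Proof.
move=> tv tw; rewrite gC ?g_suml //; last exact: tangent_bigsum.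
by apply: eq_bigr => i _; rewrite gC.
Qed.

Lemma smooth_metric X Y : vector_field X -> vector_field Y -> smooth_fun (fun p => g p (X p) (Y p)).
Proof. by have [_ _ h] := mg; exact: h. Qed.

(** Locally the gradient comes from inverting the Gram matrix of a coordinate frame. Nondegeneracy
    makes it unique, so the local solutions glue without a partition of unity. *)
Lemma gradient_exists f : (forall p, nondegenerate_on g p (tangent p)) -> smooth_fun f ->
  exists2 X, vector_field X & forall p w, tangent p w -> g p (X p) w = w f.
Proof.
move=> ng sf.
have loc p : exists2 Y, vector_field Y & \forall q \near p, forall w, tangent q w -> g q (Y q) w = w f.
  have [a Ma dp] := atlas_cover p.
  have [x [E [W [[oW Wp Wd sx] [vE xE EW Ex span]]]]] := coord_frame Ma dp.
  have tE q j : tangent q (E j q) by have [] := vE j.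
  pose G i j q := g q (E i q) (E j q).
  have sG i j : smooth_fun (G i j) by exact: smooth_metric.
  have uG : (\matrix_(i, j) G i j p) \in unitmx.
    rewrite -row_free_unit -kermx_eq0; apply/eqP; apply: contrapT => /eqP /rowV0Pn [b /sub_kermxP bA /eqP b0]; apply: b0.
    have z : \sum_i b 0 i *: E i p = 0.
      apply: ng => [|w tw]; first by apply: tangent_bigsum => i; exact: tangent_scale.
      rewrite (span p w Wp tw) g_sumr; [|by move=> i; exact: tangent_scale|by apply: tangent_bigsum => i; exact: tangent_scale].
      apply: big1 => j _; rewrite gZr //; last by apply: tangent_bigsum => i; exact: tangent_scale.
      rewrite g_suml //; last by move=> i; exact: tangent_scale.
      have /matrixP/(_ 0 j) := bA; rewrite !mxE => bA0.
      rewrite [X in _ * X](_ : _ = 0) ?mulr0 // -[RHS]bA0.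
      by apply: eq_bigr => i _; rewrite gZl // mxE.
    apply/rowP => j; rewrite mxE.
    have : (\sum_i b 0 i *: E i p) (x j) = 0 by rewrite z.
    rewrite tvec_sumE (bigD1 j) //= tvecZE Ex // eqxx mulr1 big1 ?addr0 // => i ij.
    by rewrite tvecZE Ex // (negbTE ij) mulr0.
  have [c sc hc] := local_inverse_matrix sG uG.
  pose Y q : tvec R M := \sum_i (\sum_j (E j q f : R) * c j i q) *: E i q.
  exists Y.
    apply: vector_field_sum => i; apply: vector_fieldZ => //.
    by apply: smooth_fun_sum => j; apply: smooth_funM => //; have [_] := vE j; exact.
  have nW : \forall q \near p, W q by apply: open_nbhs_nbhs.
  apply: filterS2 hc nW => q cq Wq w tw.
  have tY : tangent q (Y q) by apply: tangent_bigsum => i; exact: tangent_scale.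
  have YE k : g q (Y q) (E k q) = E k q f.
    rewrite /Y g_suml //; last by move=> i; exact: tangent_scale.
    under eq_bigr do rewrite gZl // mulr_suml.
    rewrite exchange_big /= (bigD1 k) //= [X in _ + X]big1 ?addr0 => [|j jk].
      under eq_bigr do rewrite -mulrA.
      by rewrite -mulr_sumr cq eqxx mulr1.
    under eq_bigr do rewrite -mulrA.
    by rewrite -mulr_sumr cq (negbTE jk) mulr0.
  rewrite [in LHS](span q w Wq tw) [in RHS](span q w Wq tw) tvec_sumE.
  rewrite g_sumr //; last by move=> i; exact: tangent_scale.
  by apply: eq_bigr => j _; rewrite gZr // YE.
have ex p : exists v, tangent p v /\ forall w, tangent p w -> g p v w = w f.
  by have [Y [tY _] /nbhs_singleton hY] := loc p; exists (Y p).
have [X hX] := choice ex.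
exists X; last by move=> p; have [] := hX p.
apply: vector_field_near => p; first by have [] := hX p.
have [Y vY hY] := loc p; exists Y => //; apply: filterS hY => q hq.
have [tX gX] := hX q; have [tY _] := vY.
apply/eqP; rewrite -subr_eq0; apply/eqP; apply: (ng q); first exact: tangent_sub tX (tY q).
by move=> w tw; rewrite gBl // gX // hq // subrr.
Qed.

End metric.

Section connection.
Context (D : connection R M) (aD : affine_connection D).

Lemma D_field X Y : vector_field X -> vector_field Y -> vector_field (D X Y).
Proof. by have [h _ _ _] := aD; exact: h. Qed.

Lemma D_lin f X X' Y p : smooth_fun f -> vector_field X -> vector_field X' -> vector_field Y ->
  D (fun q => f q *: X q + X' q) Y p = f p *: D X Y p + D X' Y p.
Proof. by have [_ h _ _] := aD => sf vX vX' vY; exact: h. Qed.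

Lemma D_addl X X' Y p : vector_field X -> vector_field X' -> vector_field Y ->
  D (fun q => X q + X' q) Y p = D X Y p + D X' Y p.
Proof.
move=> vX vX' vY; have := D_lin p (smooth_fun_cst 1) vX vX' vY.
by rewrite scale1r; under eq_fun do rewrite scale1r.
Qed.

Lemma D_0l Y p : vector_field Y -> D (fun=> 0) Y p = 0.
Proof.
move=> vY; have v0 := @vector_field0 R n M.
have := D_addl p v0 v0 vY; rewrite addr0 => /eqP.
by rewrite -subr_eq0 opprD addNKr oppr_eq0 => /eqP.
Qed.

Lemma D_scalel f X Y p : smooth_fun f -> vector_field X -> vector_field Y ->
  D (fun q => f q *: X q) Y p = f p *: D X Y p.
Proof.
move=> sf vX vY; have := D_lin p sf vX (@vector_field0 R n M) vY.
by rewrite D_0l // addr0; under eq_fun do rewrite addr0.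
Qed.

Lemma D_suml (I : Type) (r : seq I) (X : I -> field R M) Y p :
  (forall i, vector_field (X i)) -> vector_field Y ->
  D (fun q => \sum_(i <- r) X i q) Y p = \sum_(i <- r) D (X i) Y p.
Proof.
move=> vX vY; elim: r => [|i r IH].
  by rewrite big_nil; under eq_fun do rewrite big_nil; exact: D_0l.
rewrite big_cons -IH; under eq_fun do rewrite big_cons.
by apply: D_addl => //; exact: vector_field_sum.
Qed.

Lemma D_addr X Y Y' p : vector_field X -> vector_field Y -> vector_field Y' ->
  D X (fun q => Y q + Y' q) p = D X Y p + D X Y' p.
Proof. by have [_ _ h _] := aD => vX vY vY'; exact: h. Qed.

Lemma D_leibniz f X Y p : smooth_fun f -> vector_field X -> vector_field Y ->
  D X (fun q => f q *: Y q) p = (X p f : R) *: Y p + f p *: D X Y p.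
Proof. by have [_ _ _ h] := aD => sf vX vY; exact: h. Qed.

(** The connection acts on global fields, so the expansion of [X] in a local frame is first
    multiplied by a bump function; then its coefficients, which vanish at [p], come out by linearity
    over smooth functions. *)
Lemma D_tensor0 X Y p : vector_field X -> vector_field Y -> X p = 0 -> D X Y p = 0.
Proof.
move=> vX vY X0.
have [a Ma dp] := atlas_cover p.
have [x [E [W [[oW Wp Wd sx] [vE xE EW Ex span]]]]] := coord_frame Ma dp.
have [chi [schi c1 c0]] := bump_at oW Wp.
have [tX sX] := vX.
pose X' q : tvec R M := \sum_j (X q (x j) : R) *: E j q.
have vX'j j : vector_field (fun q => (X q (x j) : R) *: E j q) by apply: vector_fieldZ => //; exact: sX.
have vX' : vector_field X' by exact: vector_field_sum.
have EX : (fun q => chi q *: X q) = (fun q => chi q *: X' q).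
  apply/funext => q; have [->|/c0 Wq] := eqVneq (chi q) 0; first by rewrite !scale0r.
  by rewrite /X' -(span q (X q) Wq (tX q)).
have := D_scalel p schi vX vY; rewrite EX D_scalel // (nbhs_singleton c1) !scale1r => <-.
rewrite D_suml //; apply: big1 => j _.
by rewrite D_scalel ?X0 ?scale0r //; exact: sX.
Qed.

Lemma D_tensor X X' Y p : vector_field X -> vector_field X' -> vector_field Y ->
  X p = X' p -> D X Y p = D X' Y p.
Proof.
move=> vX vX' vY e.
have vB := vector_fieldB vX vX'.
have := D_addl p vB vX' vY.
rewrite (D_tensor0 vB vY); last by rewrite e subrr.
by rewrite add0r => <-; congr (D _ Y p); apply/funext => q; rewrite subrK.
Qed.

End connection.

End localization.

(** * The differential of a smooth map *)

Section maps.
Context {R : realType} {m n : nat} {M : manifold R m} {B : manifold R n}.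
Context (phi : M -> B) (sphi : smooth_map phi).

Lemma smooth_fun_pullback f : smooth_fun f -> smooth_fun (f \o phi).
Proof.
move=> sf; have [cphi sc] := sphi; apply: smooth_fun_at => p.
have [a Ma dp] := atlas_cover p; have [b Mb db] := atlas_cover (phi p).
have oV : open (phi @^-1` dom b) by apply: open_comp => [q _|]; [exact: cphi|exact: dom_open].
have oW := @open_image_coord _ _ _ a _ oV.
exists a; split=> //; exists (coord a @` (dom a `&` phi @^-1` dom b)); split=> //.
- by exists p.
- by move=> _ [q [dq _] <-]; exact: codom_coord.
- apply: (@smooth_on_eq _ _ _ (fun x => (f \o param b) (coord b (phi (param a x))))) => //.
    by move=> _ [q [dq dbq] <-] /=; rewrite coordK // coordK.
  apply: (smooth_on_comp oW (@codom_open _ _ _ b) _ _ (sf b Mb)).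
    by move=> _ [q [dq dbq] <-]; rewrite coordK //; exact: codom_coord.
  by move=> j; exact: sc.
Qed.

Lemma pushforwardE v f : smooth_fun f -> pushforward phi v f = v (f \o phi).
Proof. by move=> sf; rewrite /pushforward asboolT. Qed.

Lemma tangent_pushforward p v : tangent p v -> tangent (phi p) (pushforward phi v).
Proof.
move=> tv; split=> [f nf|a f h sf sh|f h sf sh].
- by rewrite /pushforward asboolF.
- have sfh : smooth_fun (fun q => a * f q + h q) by apply: smooth_funD => //; exact: smooth_funZ.
  rewrite !pushforwardE //.
  exact: (tangent_lin a tv (smooth_fun_pullback sf) (smooth_fun_pullback sh)).
- rewrite !pushforwardE //; last exact: smooth_funM.
  exact: (tangentM tv (smooth_fun_pullback sf) (smooth_fun_pullback sh)).
Qed.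

Lemma verticalP p v : vertical phi p v <-> tangent p v /\ forall f, smooth_fun f -> v (f \o phi) = 0.
Proof.
split=> [[tv h]|[tv h]]; split=> //.
  by move=> f sf; rewrite -(pushforwardE v sf) h.
apply: (@tangent_ext _ _ _ (phi p)) => //; first exact: tangent_pushforward.
  exact: tangent0.
by move=> f sf; rewrite pushforwardE // h.
Qed.

End maps.

(** * Semi-Riemannian submersions *)

Section submersion.
Context {R : realType} {m n : nat} {M : manifold R m} {B : manifold R n}.
Context (g : metric R M) (gB : metric R B) (pi : M -> B).
Hypothesis mn : (n <= m)%N.
Hypothesis rB : riemannian gB.
Hypothesis mg : metric_tensor g.
Hypothesis ng : forall p, nondegenerate_on g p (tangent p).
Hypothesis sub : semi_riemannian_submersion g gB pi.

Let spi : smooth_map pi. Proof. by case: sub. Qed.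
Let lift p w : tangent (pi p) w -> exists2 v, tangent p v & pushforward pi v = w.
Proof. by case: sub => _ _ h _ _; exact: h. Qed.
Let nv p : nondegenerate_on g p (vertical pi p). Proof. by case: sub. Qed.

Lemma riemannian_nondegenerate q : nondegenerate_on gB q (tangent q).
Proof.
move=> v tv h; apply/eqP; apply: contraT => v0.
by have [_ /(_ q v tv v0)] := rB; rewrite h // ltxx.
Qed.

Lemma vertical_tangent p v : vertical pi p v -> tangent p v.
Proof. by case. Qed.

Lemma horizontal_tangent p v : horizontal g pi p v -> tangent p v.
Proof. by case. Qed.

Lemma vertical_comb p (a : R) v w : vertical pi p v -> vertical pi p w -> vertical pi p (a *: v + w).
Proof.
move=> /(verticalP spi) [tv hv] /(verticalP spi) [tw hw]; apply/(verticalP spi).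
split=> [|f sf]; first exact: tangent_comb.
have -> : (a *: v + w) (f \o pi) = a * v (f \o pi) + w (f \o pi) by [].
by rewrite hv // hw // mulr0 addr0.
Qed.

Lemma vertical0 p : vertical pi p 0.
Proof. by apply/(verticalP spi); split=> //; exact: tangent0. Qed.

Lemma vertical_scale p (a : R) v : vertical pi p v -> vertical pi p (a *: v).
Proof. by move=> hv; have := vertical_comb a hv (vertical0 p); rewrite addr0. Qed.

Lemma vertical_add p v w : vertical pi p v -> vertical pi p w -> vertical pi p (v + w).
Proof. by move=> hv hw; have := vertical_comb 1 hv hw; rewrite scale1r. Qed.

Lemma vertical_sub p v w : vertical pi p v -> vertical pi p w -> vertical pi p (v - w).
Proof. by move=> hv hw; have := vertical_comb (-1) hw hv; rewrite scaleN1r addrC. Qed.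

Lemma vertical_bigsum p (I : Type) (s : seq I) (v : I -> tvec R M) :
  (forall i, vertical pi p (v i)) -> vertical pi p (\sum_(i <- s) v i).
Proof.
move=> hv; elim: s => [|i s IH]; first by rewrite big_nil; exact: vertical0.
by rewrite big_cons; exact: vertical_add.
Qed.

Lemma horizontal_comb p (a : R) v w : horizontal g pi p v -> horizontal g pi p w ->
  horizontal g pi p (a *: v + w).
Proof.
move=> [tv hv] [tw hw]; split=> [|u vu]; first exact: tangent_comb.
by rewrite (g_lin mg) // ?hv ?hw ?mulr0 ?addr0 //; exact: vertical_tangent.
Qed.

Lemma horizontal0 p : horizontal g pi p 0.
Proof.
split=> [|u vu]; first exact: tangent0.
by rewrite (g0l mg) //; exact: vertical_tangent.
Qed.

Lemma horizontal_scale p (a : R) v : horizontal g pi p v -> horizontal g pi p (a *: v).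
Proof. by move=> hv; have := horizontal_comb a hv (horizontal0 p); rewrite addr0. Qed.

Lemma horizontal_add p v w : horizontal g pi p v -> horizontal g pi p w -> horizontal g pi p (v + w).
Proof. by move=> hv hw; have := horizontal_comb 1 hv hw; rewrite scale1r. Qed.

Lemma horizontal_sub p v w : horizontal g pi p v -> horizontal g pi p w -> horizontal g pi p (v - w).
Proof. by move=> hv hw; have := horizontal_comb (-1) hw hv; rewrite scaleN1r addrC. Qed.

Lemma horizontal_bigsum p (I : Type) (s : seq I) (v : I -> tvec R M) :
  (forall i, horizontal g pi p (v i)) -> horizontal g pi p (\sum_(i <- s) v i).
Proof.
move=> hv; elim: s => [|i s IH]; first by rewrite big_nil; exact: horizontal0.
by rewrite big_cons; exact: horizontal_add.
Qed.

Lemma horizontal_vertical0 p v : horizontal g pi p v -> vertical pi p v -> v = 0.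
Proof. by move=> [tv hv] vv; exact: (nv vv). Qed.

Lemma g_hv p v w : horizontal g pi p v -> vertical pi p w -> g p v w = 0.
Proof. by move=> [_ h]; exact: h. Qed.

Lemma g_vh p v w : horizontal g pi p v -> vertical pi p w -> g p w v = 0.
Proof. by move=> hv vw; rewrite (gC mg) ?g_hv //; [exact: vertical_tangent|exact: horizontal_tangent]. Qed.

Lemma horizontal_gt0 p v : horizontal g pi p v -> v != 0 -> 0 < g p v v.
Proof.
move=> hv v0; have [_ _ _ _ /(_ p v v hv hv) <-] := sub.
have [tv _] := hv; have [_ h] := rB; apply: h; first exact: tangent_pushforward.
apply: contra v0 => /eqP e; apply/eqP; apply: horizontal_vertical0 hv _.
by split.
Qed.

Lemma horizontal_ge0 p v : horizontal g pi p v -> 0 <= g p v v.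
Proof.
move=> hv; have [->|v0] := eqVneq v 0; last exact/ltW/horizontal_gt0.
by rewrite (g0l mg) //; exact: tangent0.
Qed.

Lemma horizontal_eq0 p v : horizontal g pi p v -> g p v v = 0 -> v = 0.
Proof.
move=> hv e; apply/eqP; apply: contraT => /(horizontal_gt0 hv).
by rewrite e ltxx.
Qed.

(** Gradients of pulled-back functions are global and horizontal, and near any point finitely many
    of them span the horizontal spaces. *)
Definition is_gradient (f : B -> R) (X : field R M) :=
  vector_field X /\ forall p w, tangent p w -> g p (X p) w = w (f \o pi).

Lemma pullback_gradient f : smooth_fun f -> exists X, is_gradient f X.
Proof.
move=> sf; have [X vX gX] := gradient_exists mg ng (smooth_fun_pullback spi sf).
by exists X.
Qed.

Lemma gradient_horizontal f X p : smooth_fun f -> is_gradient f X -> horizontal g pi p (X p).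
Proof.
move=> sf [[tX sX] gX]; split=> // w vw; rewrite gX; last exact: vertical_tangent.
by have /(verticalP spi) [_ h] := vw; exact: h.
Qed.

Definition oframe k p (e : 'I_k -> tvec R M) (eps : 'I_k -> R) :=
  [/\ forall i, vertical pi p (e i), forall i, eps i = 1 \/ eps i = -1 &
      forall i j, g p (e i) (e j) = if i == j then eps i else 0].

Lemma eps_sqr k (eps : 'I_k -> R) i : eps i = 1 \/ eps i = -1 -> eps i * eps i = 1.
Proof. by move=> [] ->; rewrite ?mulr1 // mulrNN mulr1. Qed.

Lemma oframe_coef k p (e : 'I_k -> tvec R M) eps (b : 'I_k -> R) i : oframe p e eps ->
  g p (\sum_j b j *: e j) (e i) = b i * eps i.
Proof.
move=> [ve _ ge].
rewrite (g_suml mg); [|by move=> j; apply: tangent_scale; exact: vertical_tangent|exact: vertical_tangent].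
rewrite (bigD1 i) //= big1 ?addr0 => [|j ji].
  by rewrite (gZl mg) ?ge ?eqxx //; exact: vertical_tangent.
by rewrite (gZl mg) ?ge ?(negbTE ji) ?mulr0 //; exact: vertical_tangent.
Qed.

Definition base_coords (W : set B) (y : 'I_n -> B -> R) (E : 'I_n -> field R B) :=
  [/\ open W, forall j, smooth_fun (y j), forall i, vector_field (E i),
      forall q i j, W q -> E i q (y j) = (i == j)%:R &
      forall q v, W q -> tangent q v -> v = \sum_j v (y j) *: E j q].

Lemma base_coords_exists b : exists W y E, base_coords W y E /\ W b.
Proof.
have [a Ma db] := atlas_cover b.
have [y [E [W [[oW Wp Wd sx] [vE xE EW Ex span]]]]] := coord_frame Ma db.
by exists W, y, E.
Qed.

(** A count of dimensions: [m - n] orthonormal vertical vectors together with [n] gradients are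
    linearly independent, hence span. This shows that vertical spaces have dimension [m - n] without
    a study of fibres as submanifolds. *)
Lemma decomposition p (e : 'I_(m - n) -> tvec R M) eps W y E (X : 'I_n -> field R M) :
  oframe p e eps -> base_coords W y E -> W (pi p) -> (forall j, is_gradient (y j) (X j)) ->
  forall v, tangent p v -> exists (b : 'I_(m - n) -> R) (a : 'I_n -> R),
    v = \sum_i b i *: e i + \sum_j a j *: X j p.
Proof.
move=> oe [oW sy vE Ey span] Wp gX v tv.
have [ve eps1 ge] := oe.
have hX j : horizontal g pi p (X j p) by apply: gradient_horizontal (gX j).
pose u (i : 'I_(m - n) + 'I_n) := match i with inl i => e i | inr j => X j p end.
have tu i : tangent p (u i).
  by case: i => i; [exact: vertical_tangent (ve i)|exact: horizontal_tangent (hX i)].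
have cI : #|{: 'I_(m - n) + 'I_n}| = m by rewrite card_sum !card_ord subnK.
have [|a va] := tangent_span cI tu _ tv.
  move=> a; rewrite big_sumType /= => s0.
  have h1 : horizontal g pi p (\sum_j a (inr j) *: X j p).
    by apply: horizontal_bigsum => j; exact: horizontal_scale.
  have v1 : vertical pi p (\sum_i a (inl i) *: e i).
    by apply: vertical_bigsum => j; exact: vertical_scale.
  have a0 i : a (inl i) = 0.
    have : g p (\sum_i a (inl i) *: e i + \sum_j a (inr j) *: X j p) (e i) = 0.
      by rewrite s0 (g0l mg) //; exact: vertical_tangent.
    rewrite (gDl mg) ?(g_hv h1) // ?(oframe_coef _ _ oe) ?addr0; last 3 first.
    - exact: vertical_tangent.
    - exact: horizontal_tangent.
    - exact: vertical_tangent.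
    move/(congr1 (fun z => z * eps i)); rewrite -mulrA (eps_sqr (eps1 i)) mulr1 mul0r.
    exact.
  have X0 : \sum_j a (inr j) *: X j p = 0.
    by move: s0; rewrite big1 ?add0r // => i _; rewrite a0 scale0r.
  case=> [//|j].
  (* Against a lift [w] of the coordinate vector [E j], the gradient [X i] pairs to 1 if [i = j] and
     to 0 otherwise, which isolates the coefficient of [X j]. *)
  have [w tw pw] := lift (let: conj h _ := vE j in h (pi p)).
  have : g p (\sum_j a (inr j) *: X j p) w = 0 by rewrite X0 (g0l mg).
  rewrite (g_suml mg) //; last by move=> i; apply: tangent_scale; exact: horizontal_tangent.
  rewrite (bigD1 j) //= big1 ?addr0 => [|i ij].
    rewrite (gZl mg) //; last exact: horizontal_tangent.
    by have [_ /(_ p w tw) ->] := gX j; rewrite -(@pushforwardE _ _ _ _ _ pi w _ (sy j)) pw Ey // eqxx mulr1.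
  rewrite (gZl mg) //; last exact: horizontal_tangent.
  by have [_ /(_ p w tw) ->] := gX i; rewrite -(@pushforwardE _ _ _ _ _ pi w _ (sy i)) pw Ey // eq_sym (negbTE ij) mulr0.
by exists (fun i => a (inl i)), (fun j => a (inr j)); rewrite va big_sumType.
Qed.

Section oframe_at.
Context (p : M) (e : 'I_(m - n) -> tvec R M) (eps : 'I_(m - n) -> R) (oe : oframe p e eps).

Lemma oframe_proj v : tangent p v ->
  horizontal g pi p (v - \sum_i (eps i * g p v (e i)) *: e i).
Proof.
move=> tv; have [ve eps1 ge] := oe.
have [W [y [E [bc Wp]]]] := base_coords_exists (pi p).
have sy j : smooth_fun (y j) by case: bc.
have [X gX] := choice (fun j => pullback_gradient (sy j)).
have [b [a vE]] := decomposition oe bc Wp gX tv.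
have h1 : horizontal g pi p (\sum_j a j *: X j p).
  by apply: horizontal_bigsum => j; apply: horizontal_scale; exact: gradient_horizontal (sy j) (gX j).
have v1 : vertical pi p (\sum_i b i *: e i).
  by apply: vertical_bigsum => j; exact: vertical_scale.
have -> : \sum_i (eps i * g p v (e i)) *: e i = \sum_i b i *: e i.
  apply: eq_bigr => i _; congr (_ *: _); rewrite vE.
  rewrite (gDl mg) ?(g_hv h1) // ?(oframe_coef _ _ oe) ?addr0; last 3 first.
  - exact: vertical_tangent.
  - exact: horizontal_tangent.
  - exact: vertical_tangent.
  by rewrite mulrCA (eps_sqr (eps1 i)) mulr1.
by rewrite vE addrC addKr.
Qed.

Lemma oframe_vertical v : vertical pi p v -> v = \sum_i (eps i * g p v (e i)) *: e i.
Proof.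
move=> vv; have [ve eps1 ge] := oe.
apply/eqP; rewrite -subr_eq0; apply/eqP; apply: (@horizontal_vertical0 p).
  by apply: oframe_proj; exact: vertical_tangent.
by apply: vertical_sub => //; apply: vertical_bigsum => i; exact: vertical_scale.
Qed.

Lemma hproj_unique v w : horizontal g pi p w -> vertical pi p (v - w) -> hproj g pi p v = w.
Proof.
move=> hw vw; rewrite /hproj; case: xgetP => [u _ [hu vu]|/(_ w)]; last by case.
apply/eqP; rewrite -subr_eq0; apply/eqP; apply: (@horizontal_vertical0 p); first exact: horizontal_sub.
have -> : u - w = (v - w) - (v - u) by rewrite opprB [RHS]addrC addrA subrK.
exact: vertical_sub.
Qed.

Lemma hproj_frame v : tangent p v ->
  hproj g pi p v = v - \sum_i (eps i * g p v (e i)) *: e i.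
Proof.
move=> tv; have [ve eps1 ge] := oe.
apply: hproj_unique; first exact: oframe_proj.
by rewrite opprB addrC subrK; apply: vertical_bigsum => i; exact: vertical_scale.
Qed.

End oframe_at.

Hypothesis frames : forall p, exists (e : 'I_(m - n) -> field R M) eps, vertical_frame_near g pi p e eps.

Lemma frame_oframe p (e : 'I_(m - n) -> field R M) eps : vertical_frame_near g pi p e eps ->
  \forall q \near p, oframe q (e^~ q) eps.
Proof.
move=> [ve eps1 ge]; apply: filterS ge => q gq; split=> // i.
by have [_ h] := ve i.
Qed.

Lemma hproj_spec p v : tangent p v -> horizontal g pi p (hproj g pi p v) /\ vertical pi p (v - hproj g pi p v).
Proof.
move=> tv; have [e [eps he]] := frames p.
have oe := nbhs_singleton (frame_oframe he); rewrite (hproj_frame oe tv).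
split; first exact: oframe_proj.
have [ve _ _] := oe.
by rewrite opprB addrC subrK; apply: vertical_bigsum => i; exact: vertical_scale.
Qed.

Lemma hproj_field X : vector_field X -> vector_field (fun p => hproj g pi p (X p)).
Proof.
move=> vX; have [tX sX] := vX; apply: vector_field_near => p.
  exact/horizontal_tangent/(hproj_spec (tX p)).1.
have [e [eps he]] := frames p; have [ve _ _] := he.
have vfe i : vector_field (e i) by have [] := ve i.
exists (fun q => X q - \sum_i (eps i * g q (X q) (e i q)) *: e i q).
  apply: vector_fieldB => //; apply: vector_field_sum => i; apply: vector_fieldZ => //.
  by apply: smooth_funZ; exact: smooth_metric.
by apply: filterS (frame_oframe he) => q oq; exact: hproj_frame.
Qed.

Lemma vertical_field_hproj X : vector_field X -> vertical_field pi (fun p => X p - hproj g pi p (X p)).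
Proof.
move=> vX; have [tX _] := vX; split; first exact/vector_fieldB/hproj_field.
by move=> p; have [] := hproj_spec (tX p).
Qed.

(** Both sides have the same product with every [w]: the product is computed on the horizontal part
    of a lift of [w], where [pi] is isometric. *)
Lemma gradient_related f X Xb p : smooth_fun f -> is_gradient f X ->
  (forall q w, tangent q w -> gB q (Xb q) w = w f) -> tangent (pi p) (Xb (pi p)) ->
  pushforward pi (X p) = Xb (pi p).
Proof.
move=> sf gX gXb tXb.
have [mgB _] := rB; have [[tX _] gXp] := gX.
have tpX := tangent_pushforward spi (tX p).
apply/eqP; rewrite -subr_eq0; apply/eqP; apply: (@riemannian_nondegenerate (pi p)); first exact: tangent_sub.
move=> w tw; have [v tv pv] := lift tw.
have [hv vv] := hproj_spec tv.
have pvE : pushforward pi (hproj g pi p v) = w.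
  rewrite -pv; apply/funext => h; have [sh|nh] := pselect (smooth_fun h); last by rewrite /pushforward asboolF.
  rewrite !pushforwardE //; have /(verticalP spi) [_ /(_ h sh)] := vv.
  by move=> /eqP; rewrite [X in X == _]/(_ - _) /= subr_eq0 => /eqP.
rewrite (gBl mgB) // gXb // -[in gB _ (pushforward _ _) w]pvE.
have [_ _ _ _ ->] := sub => //; last exact: gradient_horizontal gX.
rewrite gXp; last exact: horizontal_tangent.
by rewrite -(@pushforwardE _ _ _ _ _ pi _ _ sf) pvE subrr.
Qed.

Lemma horizontal_span p W y E (X : 'I_n -> field R M) v :
  base_coords W y E -> W (pi p) -> (forall j, is_gradient (y j) (X j)) ->
  horizontal g pi p v -> exists a : 'I_n -> R, v = \sum_j a j *: X j p.
Proof.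
move=> bc Wp gX hv.
have [e [eps he]] := frames p; have oe := nbhs_singleton (frame_oframe he).
have [ve eps1 _] := oe.
have sy j : smooth_fun (y j) by case: bc.
have [b [a vE]] := decomposition oe bc Wp gX (horizontal_tangent hv).
have h1 : horizontal g pi p (\sum_j a j *: X j p).
  by apply: horizontal_bigsum => j; apply: horizontal_scale; exact: gradient_horizontal (sy j) (gX j).
have v1 : vertical pi p (\sum_i b i *: e i p).
  by apply: vertical_bigsum => j; exact: vertical_scale.
exists a; rewrite vE (_ : \sum_i b i *: e i p = 0) ?add0r //.
apply: (@horizontal_vertical0 p) => //.
have -> : \sum_i b i *: e i p = v - \sum_j a j *: X j p by rewrite vE addrK.
exact: horizontal_sub.
Qed.

(** * Mean curvature, Hessians and O'Neill's tensor *)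

Section connection.
Context (D : connection R M) (c : R).
Hypothesis lc : levi_civita g D.
Hypothesis cc : constant_curvature g D c.

Let aD : affine_connection D. Proof. by case: lc. Qed.

Lemma torsion_free X Y p : vector_field X -> vector_field Y -> D X Y p - D Y X p = bracket X Y p.
Proof. by move=> vX vY; have [_ h _] := lc; exact: h. Qed.

Lemma compatible X Y Z p : vector_field X -> vector_field Y -> vector_field Z ->
  X p (fun q => g q (Y q) (Z q)) = g p (D X Y p) (Z p) + g p (Y p) (D X Z p).
Proof. by move=> vX vY vZ; have [_ _ h] := lc; exact: h. Qed.

(** [H] is given only pointwise, by frames that vary with the point. Umbilicity makes [N] equal near
    [p] to [eps i] times [T] on a single frame field [e i], which is smooth. *)
Lemma mean_curvature_field (H : field R M) : (0 < m - n)%N -> is_trace_T g D pi (m - n) H ->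
  (forall U V, vertical_field pi U -> vertical_field pi V -> forall p,
     Ttensor g D pi U V p = ((m - n)%:R^-1 * g p (U p) (V p)) *: H p) ->
  exists N : field R M, [/\ vector_field N, forall p, horizontal g pi p (N p) &
    forall U V, vertical_field pi U -> vertical_field pi V -> forall p,
      Ttensor g D pi U V p = g p (U p) (V p) *: N p].
Proof.
move=> r0 tr umb; pose N p : tvec R M := (m - n)%:R^-1 *: H p.
have TN U V : vertical_field pi U -> vertical_field pi V -> forall p,
      Ttensor g D pi U V p = g p (U p) (V p) *: N p.
  by move=> vU vV p; rewrite umb // /N scalerA mulrC.
have hN p : horizontal g pi p (N p).
  rewrite /N; have [e [eps [[ve _ _] ->]]] := tr p.
  apply: horizontal_scale; apply: horizontal_bigsum => i; apply: horizontal_scale.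
  have [vei _] := ve i; have [tD _] := D_field aD vei vei.
  exact: (hproj_spec (tD p)).1.
exists N; split=> //; apply: vector_field_near => p; first exact: horizontal_tangent.
have [e [eps he]] := frames p; have [ve eps1 _] := he.
pose i := Ordinal r0; have [vei _] := ve i.
exists (fun q => eps i *: hproj g pi q (D (e i) (e i) q)).
  apply: vector_fieldZ; first exact: smooth_fun_cst.
  by apply: hproj_field; exact: D_field.
apply: filterS (frame_oframe he) => q [_ _ ge].
have := TN _ _ (ve i) (ve i) q; rewrite /Ttensor => ->.
by rewrite ge eqxx scalerA (eps_sqr (eps1 i)) scale1r.
Qed.

(** Both sides are the Hessian of [f \o pi], namely [V W f - (D_V W) f], whose antisymmetric part
    vanishes because [D] is torsion-free. *)
Lemma hessian_sym f X V W p : smooth_fun f -> is_gradient f X -> vector_field V -> vector_field W ->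
  g p (D V X p) (W p) = g p (D W X p) (V p).
Proof.
move=> sf [vX gX] vV vW.
have h V' W' : vector_field V' -> vector_field W' ->
    g p (D V' X p) (W' p) = V' p (fun q => W' q (f \o pi)) - D V' W' p (f \o pi).
  move=> vV' vW'; have := compatible p vV' vX vW'.
  have -> : (fun q => g q (X q) (W' q)) = (fun q => W' q (f \o pi)).
    by apply/funext => q; rewrite gX //; case: vW'.
  by rewrite (gX p (D V' W' p)) => [->|]; [rewrite addrK|case: (D_field aD vV' vW')].
rewrite !h //; apply/eqP; rewrite subr_eq addrAC -subr_eq0 -addrA; apply/eqP.
have := congr1 (fun w : tvec R M => w (f \o pi)) (torsion_free p vV vW).
have -> : (D V W p - D W V p) (f \o pi) = D V W p (f \o pi) - D W V p (f \o pi) by [].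
rewrite /bracket => E.
set a := V p _ in E *; set b := W p _ in E *; set x := D V W p _ in E *; set z := D W V p _ in E *.
have : a - b - (x - z) = 0 by rewrite E subrr.
by move=> <-; ring.
Qed.

Definition horizontal_field (X : field R M) := vector_field X /\ forall p, horizontal g pi p (X p).

(** Differentiate the identity [g Y U = 0] along [X]. *)
Lemma connection_skew X Y U p : vector_field X -> horizontal_field Y -> vertical_field pi U ->
  g p (D X Y p) (U p) = - g p (Y p) (D X U p).
Proof.
move=> vX [vY hY] [vU hU]; apply/eqP; rewrite -addr_eq0; apply/eqP.
rewrite -compatible //; have -> : (fun q => g q (Y q) (U q)) = (fun=> 0).
  by apply/funext => q; rewrite g_hv.
by have [tX _] := vX; exact: tangent_cst (tX p).
Qed.

(* O'Neill's tensor [A] is skew on horizontal fields: it suffices to see it on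
   gradients of functions pulled back from the base, where it follows from the
   symmetry of the Hessian. *)
Lemma A_skew X Y U p : horizontal_field X -> horizontal_field Y -> vertical_field pi U ->
  g p (D X Y p) (U p) = - g p (D Y X p) (U p).
Proof.
move=> hX hY vU; have [vX hXp] := hX; have [vY hYp] := hY; have [vfU hU] := vU.
rewrite (connection_skew _ vX hY vU) (connection_skew _ vY hX vU) opprK; apply/eqP; rewrite -subr_eq0 -opprD oppr_eq0; apply/eqP.
have [W [y [E [bc Wp]]]] := base_coords_exists (pi p).
have sy j : smooth_fun (y j) by case: bc.
have [Z gZ] := choice (fun j => pullback_gradient (sy j)).
have vZ j : vector_field (Z j) by case: (gZ j).
have hZ j q : horizontal g pi q (Z j q) by exact: gradient_horizontal (sy j) (gZ j).
have [mgB _] := rB.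
(* By symmetry of the Hessians the sum is, up to sign, the derivative along [U] of [g (Z k) (Z j)].
   That function is pulled back from [B], where it is the product of two gradients, so a vertical
   vector kills it. *)
have S0 j k : g p (Z k p) (D (Z j) U p) + g p (Z j p) (D (Z k) U p) = 0.
  apply/eqP; rewrite -oppr_eq0 opprD -(connection_skew _ (vZ j) (conj (vZ k) (hZ k)) vU) -(connection_skew _ (vZ k) (conj (vZ j) (hZ j)) vU); apply/eqP.
  rewrite (hessian_sym p (sy k) (gZ k)) // (hessian_sym p (sy j) (gZ j)) // [g p (D U (Z j) p) _](gC mg); last 2 first.
  - by case: (D_field aD vfU (vZ j)).
  - exact: horizontal_tangent.
  rewrite -compatible //.
  have [Xk vXk gXk] := gradient_exists mgB riemannian_nondegenerate (sy k).
  have [Xj vXj gXj] := gradient_exists mgB riemannian_nondegenerate (sy j).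
  have -> : (fun q => g q (Z k q) (Z j q)) = (fun b => gB b (Xk b) (Xj b)) \o pi.
    apply/funext => q /=; have [_ _ _ _ <-] := sub => //.
    rewrite (gradient_related (sy k) (gZ k) gXk); last by case: vXk.
    by rewrite (gradient_related (sy j) (gZ j) gXj) //; case: vXj.
  by have /(verticalP spi) [_ h] := hU p; apply: h; exact: smooth_metric.
have [a aE] := horizontal_span bc Wp gZ (hXp p).
have [b bE] := horizontal_span bc Wp gZ (hYp p).
have tDU j : tangent p (D (Z j) U p) by case: (D_field aD (vZ j) vfU).
(* [D X' U p] depends only on the value of [X'] at [p], which has constant coefficients in the
   gradients. *)
have DE (X' : field R M) (d : 'I_n -> R) : vector_field X' -> X' p = \sum_j d j *: Z j p ->
    D X' U p = \sum_j d j *: D (Z j) U p.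
  move=> vX' dE; have vs j : vector_field (fun q => d j *: Z j q).
    by apply: vector_fieldZ => //; exact: smooth_fun_cst.
  rewrite (D_tensor aD vX' (vector_field_sum _ vs) vfU dE) (D_suml aD _ _ vs vfU).
  by apply: eq_bigr => j _; rewrite (D_scalel aD p (smooth_fun_cst (d j))).
have dbl (d1 d2 : 'I_n -> R) : g p (\sum_j d1 j *: Z j p) (\sum_j d2 j *: D (Z j) U p) =
   \sum_j \sum_k d1 j * d2 k * g p (Z j p) (D (Z k) U p).
  rewrite (g_suml mg); [|by move=> j; apply: tangent_scale; exact: horizontal_tangent|by apply: tangent_bigsum => j; exact: tangent_scale].
  apply: eq_bigr => j _; rewrite (g_sumr mg); [|by move=> k; exact: tangent_scale|by apply: tangent_scale; exact: horizontal_tangent].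
  apply: eq_bigr => k _; rewrite (gZl mg) ?(gZr mg) ?mulrA //; first exact: horizontal_tangent.
  - exact: horizontal_tangent.
  - exact: tangent_scale.
rewrite (DE X a) // (DE Y b) // aE bE !dbl.
rewrite [X in _ + X]exchange_big /= -big_split /= big1 // => j _.
rewrite -big_split /= big1 // => k _.
by rewrite [a k * b j]mulrC -mulrDr S0 mulr0.
Qed.

(** * Codazzi and mixed curvature equations for umbilic fibres *)

Section umbilic.
(* [N] is [H / r]. *)
Context (N : field R M).
Hypothesis vN : vector_field N.
Hypothesis hN : forall p, horizontal g pi p (N p).
Hypothesis TN : forall U V, vertical_field pi U -> vertical_field pi V -> forall p,
  Ttensor g D pi U V p = g p (U p) (V p) *: N p.

Let tan (X : field R M) p : vector_field X -> tangent p (X p).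
Proof. by case. Qed.

Let vert (U : field R M) p : vertical_field pi U -> vertical pi p (U p).
Proof. by case. Qed.

Lemma connection_vertical U V : vertical_field pi U -> vertical_field pi V ->
  exists2 Z, vertical_field pi Z & D U V = (fun p => g p (U p) (V p) *: N p + Z p).
Proof.
move=> vU vV; have vD := D_field aD (proj1 vU) (proj1 vV).
exists (fun p => D U V p - hproj g pi p (D U V p)); first exact: vertical_field_hproj.
by apply/funext => p; rewrite -TN // /Ttensor addrC subrK.
Qed.

Lemma g_connection_vertical U V p x : vertical_field pi U -> vertical_field pi V ->
  horizontal g pi p x -> g p (D U V p) x = g p (U p) (V p) * g p (N p) x.
Proof.
move=> vU vV hx; have [Z vZ ->] := connection_vertical vU vV.
have tN := tan p vN; have tx := horizontal_tangent hx; have vZp := vert p vZ.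
by rewrite (g_lin mg) ?(g_vh hx vZp) ?addr0 //; exact: vertical_tangent.
Qed.

Lemma vertical_field_bracket U V : vertical_field pi U -> vertical_field pi V ->
  vertical_field pi (bracket U V).
Proof.
move=> [vU hU] [vV hV]; split=> [|p]; first exact: vector_field_bracket.
apply/(verticalP spi); split=> [|f sf]; first exact: bracket_tangent.
have z (W : field R M) q : (forall q, vertical pi q (W q)) -> W q (f \o pi) = 0.
  by move=> hW; have /(verticalP spi) [_] := hW q; exact.
rewrite /bracket.
have -> : (fun q => V q (f \o pi)) = (fun=> 0) by apply/funext => q; exact: z.
have -> : (fun q => U q (f \o pi)) = (fun=> 0) by apply/funext => q; exact: z.
by rewrite (tangent_cst _ (tan p vU)) (tangent_cst _ (tan p vV)) subrr.
Qed.

(** Constant curvature makes [R(U, V)W] vertical, so its product with the horizontal [x] is 0.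
    Expanding [D U V] as [g U V] times [N] plus a vertical field, all coefficients of [g N x] cancel
    by compatibility and torsion-freeness. *)
Lemma codazzi U V W p x : vertical_field pi U -> vertical_field pi V -> vertical_field pi W ->
  horizontal g pi p x ->
  g p (V p) (W p) * g p (D U N p) x = g p (U p) (W p) * g p (D V N p) x.
Proof.
move=> vU vV vW hx.
have [fU _] := vU; have [fV _] := vV; have [fW _] := vW.
have tx := horizontal_tangent hx.
(* The [x]-component of a second covariant derivative of [W], to be antisymmetrized in [U'] and
   [V']. *)
have L U' V' : vertical_field pi U' -> vertical_field pi V' ->
    g p (D U' (D V' W) p) x = ((U' p (fun q => g q (V' q) (W q)) : R) + g p (U' p) (D V' W p)) * g p (N p) x
      + g p (V' p) (W p) * g p (D U' N p) x.
  move=> vU' vV'; have [fU' _] := vU'; have [fV' _] := vV'.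
  have [Z vZ DE] := connection_vertical vV' vW; have [fZ _] := vZ.
  have sVW : smooth_fun (fun q => g q (V' q) (W q)) by exact: smooth_metric.
  have fN := vector_fieldZ sVW vN.
  have tN := tan p vN; have tDN := tan p (D_field aD fU' vN).
  rewrite {1}DE (D_addr aD p fU' fN fZ) (D_leibniz aD p sVW fU' vN).
  have t1 := tangent_scale (U' p (fun q => g q (V' q) (W q)) : R) tN.
  have t2 := tangent_scale (g p (V' p) (W p)) tDN.
  rewrite (gDl mg) //; [|exact: tangent_add|exact: tan (D_field aD fU' fZ)].
  rewrite (gDl mg) // !(gZl mg) // (g_connection_vertical vU' vZ hx).
  have -> : g p (U' p) (D V' W p) = g p (U' p) (Z p).
    rewrite DE (gDr mg) ?(gZr mg) ?(g_vh (hN p) (vert p vU')) ?mulr0 ?add0r //.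
    - exact: tan.
    - exact: tan.
    - exact: tangent_scale.
    - exact: tan.
  by ring.
have vb := vertical_field_bracket vU vV.
have E := congr1 (fun w => g p w x) (cc fU fV fW p).
have tc : tangent p (g p (V p) (W p) *: U p - g p (U p) (W p) *: V p).
  by apply: tangent_sub; apply: tangent_scale; exact: tan.
have rhs0 : g p (c *: (g p (V p) (W p) *: U p - g p (U p) (W p) *: V p)) x = 0.
  apply: (g_vh hx); apply: vertical_scale; apply: vertical_sub; apply: vertical_scale; exact: vert.
move: E; rewrite /= rhs0 /curvature.
have tD1 := tan p (D_field aD fU (D_field aD fV fW)).
have tD2 := tan p (D_field aD fV (D_field aD fU fW)).
have tD3 := tan p (D_field aD (proj1 vb) fW).
rewrite (gBl mg) //; last exact: tangent_sub.
rewrite (gBl mg) // !L // (g_connection_vertical vb vW hx) !compatible // -torsion_free //.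
have tUV := tan p (D_field aD fU fV); have tVU := tan p (D_field aD fV fU).
have tUW := tan p (D_field aD fU fW); have tVW := tan p (D_field aD fV fW).
rewrite (gBl mg) //; last exact: tan.
by move=> E; apply/eqP; rewrite -subr_eq0 -E; apply/eqP; ring.
Qed.

Hypothesis r2 : (2 <= m - n)%N.

(** In [codazzi] take [e i] for [U] and [e j] for both [V] and [W], with [j] different from [i]: the
    right-hand side vanishes and the left-hand factor is a sign. Such a [j] exists because the
    fibres have dimension at least 2. *)
Lemma DN_vertical U p x : vertical_field pi U -> horizontal g pi p x -> g p (D U N p) x = 0.
Proof.
move=> vU hx; have [e [eps he]] := frames p; have [ve eps1 _] := he.
have oe := nbhs_singleton (frame_oframe he); have [_ _ ge] := oe.
have fe i : vector_field (e i) by have [] := ve i.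
have z i : g p (D (e i) N p) x = 0.
  have [j ij] : exists j : 'I_(m - n), i != j.
    pose j0 := Ordinal (ltnW r2 : (0 < m - n)%N); pose j1 := Ordinal (r2 : (1 < m - n)%N).
    have [e0|e0] := eqVneq i j0; last by exists j0.
    by exists j1; rewrite e0.
  have := codazzi (ve i) (ve j) (ve j) hx.
  rewrite !ge eqxx (negbTE ij) mul0r => /(congr1 (fun z => eps j * z)).
  by rewrite mulr0 mulrA (eps_sqr (eps1 j)) mul1r.
have vs i : vector_field (fun q => (eps i * g p (U p) (e i p)) *: e i q).
  by apply: vector_fieldZ => //; exact: smooth_fun_cst.
rewrite (D_tensor aD (proj1 vU) (vector_field_sum _ vs) vN (oframe_vertical oe (vert p vU))).
rewrite (D_suml aD _ _ vs vN) (g_suml mg); last 2 first.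
- by move=> i; exact: tan (D_field aD (vs i) vN).
- exact: horizontal_tangent.
apply: big1 => i _; rewrite (D_scalel aD p (smooth_fun_cst _)) // (gZl mg) ?z ?mulr0 //.
  exact: tan (D_field aD (fe i) vN).
exact: horizontal_tangent.
Qed.

Lemma N2_vertical p v : vertical pi p v -> v (fun q => g q (N q) (N q)) = 0.
Proof.
move=> vv; have [e [eps he]] := frames p; have [ve eps1 _] := he.
have oe := nbhs_singleton (frame_oframe he).
rewrite (oframe_vertical oe vv) tvec_sumE; apply: big1 => i _.
have [fe _] := ve i.
have tDN := tan p (D_field aD fe vN).
rewrite tvecZE compatible // [g p (N p) _](gC mg) //; last exact: tan.
by rewrite DN_vertical // addr0 mulr0.
Qed.

(* O'Neill's equation for the curvature of the mixed plane [U], [X]. *)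
Lemma mixed_curvature U X p : vertical_field pi U -> horizontal_field X ->
  c * g p (U p) (U p) * g p (X p) (X p) =
  g p (U p) (U p) * (g p (D X N p) (X p) - g p (N p) (X p) ^+ 2) +
  g p (hproj g pi p (D X U p)) (hproj g pi p (D X U p)).
Proof.
move=> vU hX; have [fU hU] := vU; have [fX hXp] := hX.
have tX := tan p fX; have tU := tan p fU; have tN := tan p vN.
have fXU := D_field aD fX fU; have fUX := D_field aD fU fX.
have fUU := D_field aD fU fU; have fXN := D_field aD fX vN.
(* [P] and [Q] are the horizontal and vertical parts of [D X U]; [Y] and [Z] are those of
   [D U X]. *)
pose P q := hproj g pi q (D X U q); pose Q q := D X U q - hproj g pi q (D X U q).
pose Y q := hproj g pi q (D U X q); pose Z q := D U X q - hproj g pi q (D U X q).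
have fP : vector_field P by exact: hproj_field.
have fY : vector_field Y by exact: hproj_field.
have hP q : horizontal g pi q (P q) by exact: (hproj_spec (tan q fXU)).1.
have hY q : horizontal g pi q (Y q) by exact: (hproj_spec (tan q fUX)).1.
have vQ : vertical_field pi Q by exact: vertical_field_hproj.
have vZ : vertical_field pi Z by exact: vertical_field_hproj.
have [fQ hQ] := vQ; have [fZ hZ] := vZ.
have XUE : D X U = (fun q => P q + Q q) by apply/funext => q; rewrite /Q addrC subrK.
have UXE : D U X = (fun q => Y q + Z q) by apply/funext => q; rewrite /Z addrC subrK.
have [W vW UUE] := connection_vertical vU vU; have [fW hW] := vW.
(* Skewness of O'Neill's tensor with both arguments equal to [X]. *)
have gPX q : g q (P q) (X q) = 0.
  have e : g q (D X U q) (X q) = 0.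
    rewrite (gC mg) //; [|exact: tan|exact: tan].
    have := connection_skew q fX hX vU => /eqP; rewrite -eqr_oppLR => /eqP <-.
    have /eqP := A_skew q hX hX vU.
    by rewrite -addr_eq0 -mulr2n mulrn_eq0 /= => /eqP ->; rewrite oppr0.
  move: e; rewrite XUE (gDl mg) ?(g_vh (hXp q) (hQ q)) ?addr0 //; exact: tan.
have gXX q (V : field R M) : vertical_field pi V -> g q (D X V q) (X q) = 0.
  move=> vV; rewrite (gC mg) //; [|exact: tan (D_field aD fX (proj1 vV))|exact: tan].
  have := connection_skew q fX hX vV => /eqP; rewrite -eqr_oppLR => /eqP <-.
  have /eqP := A_skew q hX hX vV.
  by rewrite -addr_eq0 -mulr2n mulrn_eq0 /= => /eqP ->; rewrite oppr0.
have tP := tan p fP; have tQ := tan p fQ; have tY := tan p fY; have tZ := tan p fZ.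
have T1 : g p (D X (D U U) p) (X p) =
    2 * g p (Q p) (U p) * g p (N p) (X p) + g p (U p) (U p) * g p (D X N p) (X p).
  have sUU : smooth_fun (fun q => g q (U q) (U q)) by exact: smooth_metric.
  have fN := vector_fieldZ sUU vN.
  rewrite UUE (D_addr aD p fX fN fW) (D_leibniz aD p sUU fX vN).
  have t1 := tangent_scale (X p (fun q => g q (U q) (U q)) : R) tN.
  have t2 := tangent_scale (g p (U p) (U p)) (tan p fXN).
  rewrite (gDl mg) //; [|exact: tangent_add|exact: tan (D_field aD fX fW)].
  rewrite (gXX p W vW) addr0 (gDl mg) // !(gZl mg) //; last exact: tan.
  congr (_ * _ + _); rewrite compatible // [g p (U p) (D X U p)](gC mg) //; last exact: tan.
  by rewrite XUE (gDl mg) // (g_hv (hP p) (hU p)) add0r; ring.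
have T2 : g p (D U (D X U) p) (X p) = - g p (P p) (Y p) + g p (Q p) (U p) * g p (N p) (X p).
  rewrite XUE (D_addr aD p fU fP fQ) (gDl mg) //; [|exact: tan (D_field aD fU fP)|exact: tan (D_field aD fU fQ)].
  rewrite (g_connection_vertical vU vQ (hXp p)) [g p (U p) _](gC mg) //; congr (_ + _).
  have := compatible p fU fP fX; have -> : (fun q => g q (P q) (X q)) = (fun=> 0) by apply/funext.
  rewrite (tangent_cst _ tU) => /esym/eqP; rewrite addr_eq0 => /eqP ->; congr (- _).
  by rewrite UXE (gDr mg) // (g_hv (hP p) (hZ p)) addr0.
(* The bracket splits into the horizontal field [P - Y], handled by skewness, and the vertical field
   [Q - Z], handled by umbilicity. In [T1 - T2 - T3] the terms with [Y] and with [Q] cancel, and [P]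
   survives as a square. *)
have T3 : g p (D (bracket X U) U p) (X p) = g p (P p) (Y p) - g p (P p) (P p)
    + g p (Q p) (U p) * g p (N p) (X p) + g p (U p) (U p) * g p (N p) (X p) ^+ 2.
  pose K q := P q - Y q; pose V q := Q q - Z q.
  have fK : vector_field K by exact: vector_fieldB.
  have hK q : horizontal g pi q (K q) by exact: horizontal_sub.
  have vV : vertical_field pi V by split=> [|q]; [exact: vector_fieldB|exact: vertical_sub].
  have -> : bracket X U = (fun q => K q + V q).
    apply/funext => q; rewrite -torsion_free // XUE UXE /K /V.
    by rewrite opprD addrACA.
  rewrite (D_addl aD p fK (proj1 vV) fU) (gDl mg) //;
    [|exact: tan (D_field aD fK fU)|exact: tan (D_field aD (proj1 vV) fU)].
  rewrite (g_connection_vertical vV vU (hXp p)).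
  have -> : g p (D K U p) (X p) = g p (P p) (Y p) - g p (P p) (P p).
    rewrite (gC mg) //; last exact: tan (D_field aD fK fU).
    have /eqP := connection_skew p fK hX vU; rewrite -eqr_oppLR => /eqP <-.
    rewrite (A_skew p (conj fK hK) hX vU) opprK.
    rewrite (connection_skew p fX (conj fK hK) vU) XUE (gDr mg) //; last exact: tan.
    rewrite (g_hv (hK p) (hQ p)) addr0 /K (gBl mg) // [g p (Y p) _](gC mg) //.
    by rewrite opprB.
  have -> : g p (V p) (U p) = g p (Q p) (U p) + g p (U p) (U p) * g p (N p) (X p).
    rewrite /V (gBl mg) //; congr (_ + _).
    rewrite -(g_connection_vertical vU vU (hXp p)).
    have h1 : g p (D U X p) (U p) = g p (Z p) (U p).
      by rewrite UXE (gDl mg) // (g_hv (hY p) (hU p)) add0r.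
    by rewrite -h1 (connection_skew p fU hX vU) opprK (gC mg) //; exact: tan.
  by ring.
have E := congr1 (fun w => g p w (X p)) (cc fX fU fU p).
move: E; rewrite /= /curvature.
have tD1 := tan p (D_field aD fX fUU).
have tD2 := tan p (D_field aD fU fXU).
have tD3 := tan p (D_field aD (vector_field_bracket fX fU) fU).
rewrite (gBl mg) //; last exact: tangent_sub.
rewrite (gBl mg) // T1 T2 T3.
have t1 := tangent_scale (g p (U p) (U p)) tX.
have t2 := tangent_scale (g p (X p) (U p)) tU.
rewrite (gZl mg) //; last exact: tangent_sub.
rewrite (g_hv (hXp p) (hU p)) scale0r subr0 (gZl mg) // => E.
by rewrite -/(P p) -mulrA -E; ring.
Qed.

End umbilic.

End connection.

End submersion.

(** * Flows on manifolds *)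

Section flows.
Context {R : realType} {m : nat} {M : manifold R m}.
Implicit Types (f : M -> R) (p q : M) (v : tvec R M).

(** [commuting_flow] read in a chart, where the components of [A i] are its values on the coordinate
    functions. Vanishing of the brackets on these functions is the commutation hypothesis there. *)
Lemma manifold_flow k (A : 'I_k -> field R M) p (W : set M) :
  (forall i, vector_field (A i)) -> open W -> W p ->
  exists (delta : R) (g : 'rV[R]_k -> R -> M), [/\ 0 < delta,
    forall v : 'rV[R]_k, `|v| < delta -> [/\ g v 0 = p,
      forall t : R, 0 <= t <= 1 -> W (g v t) &
      forall f (t : R), smooth_fun f -> 0 <= t <= 1 ->
        is_derive t 1 (fun s => f (g v s)) (\sum_i v 0 i * A i (g v t) f)] &
    (forall i h q, W q -> bracket (A i) (A h) q = 0) ->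
    (forall v : 'rV[R]_k, `|v| < delta -> {for v, continuous (fun u => g u 1)}) /\
    forall f, smooth_fun f -> smooth_on (ball 0 delta) (fun u => f (g u 1)) /\
      forall (v : 'rV[R]_k) h, `|v| < delta ->
        is_derive v (delta_mx 0 h) (fun u => f (g u 1)) (A h (g v 1) f : R)].
Proof.
move=> vA oW Wp.
have [a Ma dp] := atlas_cover p.
have [x [E [W1 [[oW1 W1p W1d sx] [vE xE EW Ex span]]]]] := coord_frame Ma dp.
have oWW : open (W `&` W1) by exact: openI.
pose x0 := coord a p.
pose Om := coord a @` (dom a `&` (W `&` W1)).
have oOm : open Om by exact: open_image_coord.
have Omp : Om x0 by exists p.
have /nbhs_ballP[r0 /= r00 hr] : nbhs x0 Om by exact: open_nbhs_nbhs.
have inOm y : ball x0 r0 y -> [/\ dom a (param a y), W (param a y), W1 (param a y) & coord a (param a y) = y].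
  by move=> /hr [q [dq [Wq W1q]] <-]; rewrite coordK.
have Omc : ball x0 r0 `<=` chart_image a by move=> y /hr [q [dq _] <-]; exact: codom_coord.
pose Ac i (y : 'rV[R]_m) : 'rV[R]_m := \row_j (A i (param a y) (x j) : R).
have tA i q : tangent q (A i q) by have [] := vA i.
have sAx i f : smooth_fun f -> smooth_fun (fun q => A i q f : R) by have [_] := vA i; exact.
have sAc i j : smooth_on (ball x0 r0) (fun y => Ac i y 0 j).
  under eq_fun do rewrite mxE.
  exact: smooth_on_sub Omc (sAx i _ (sx j) a Ma).
have AE i f y : smooth_fun f -> ball x0 r0 y ->
    A i (param a y) f = \sum_l Ac i y 0 l * 'D_(delta_mx 0 l) (f \o param a) y.
  move=> sf /inOm [dy Wy W1y ey].
  rewrite (span _ _ W1y (tA i (param a y))) tvec_sumE; apply: eq_bigr => l _.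
  by rewrite tvecZE EW // ey mxE.
have rr : r0 / 2 < r0 by rewrite ltr_pdivrMr // mulr_natr mulr2n ltrDr.
have r2 : 0 < r0 / 2 by rewrite divr_gt0.
have sub2 : ball x0 (r0 / 2) `<=` ball x0 r0 by apply: le_ball; exact: ltW.
have [delta [g [d0 hg hcomm]]] := commuting_flow sAc r2 rr.
exists delta, (fun (v : 'rV[R]_k) (t : R) => (param a (g v t) : M)); split=> //.
  move=> v vd; have [g0 gb dg] := hg v vd; split=> [|t t01|f t sf t01].
  - by rewrite g0 /x0 coordK.
  - by have [] := inOm _ (sub2 _ (gb t t01)).
  - have bt := sub2 _ (gb t t01).
    have := @chain_curve R m (f \o param a) (ball x0 r0) (g v) _ t (ball_open _ _) bt
      (smooth_on_sub Omc (sf a Ma) 1%N) (dg t t01).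
    set X := (X in is_derive _ _ _ X -> _); set Y := (X in _ -> is_derive _ _ _ X).
    suff -> : X = Y by [].
    rewrite /X /Y; under [RHS]eq_bigr do rewrite (AE _ _ _ sf bt) mulr_sumr.
    rewrite exchange_big /=; apply: eq_bigr => l _; rewrite mulr_sumr; apply: eq_bigr => i _.
    by ring.
move=> br.
have comm i h j y : ball x0 r0 y ->
   \sum_l Ac i y 0 l * 'D_(delta_mx 0 l) (fun y => Ac h y 0 j) y =
   \sum_l Ac h y 0 l * 'D_(delta_mx 0 l) (fun y => Ac i y 0 j) y.
  move=> by_; have [dy Wy W1y ey] := inOm y by_.
  have F i' : (fun y => Ac i' y 0 j) = (fun q => A i' q (x j) : R) \o param a.
    by apply/funext => z; rewrite mxE.
  rewrite !F -!AE //; [|exact: sAx|exact: sAx].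
  have := congr1 (fun w : tvec R M => w (x j)) (br i h _ Wy).
  by rewrite /bracket => /eqP; rewrite [X in _ == X]/(0 : R) subr_eq0 => /eqP.
have {}hcomm := hcomm comm.
have dball (v : 'rV[R]_k) : ball 0 delta v <-> `|v| < delta.
  by rewrite -ball_normE /= sub0r normrN.
have i1 : 0 <= (1 : R) <= 1 by rewrite ler01 lexx.
have gin (v : 'rV[R]_k) : `|v| < delta -> ball x0 r0 (g v 1).
  by move=> vd; have [_ gb _] := hg v vd; exact/sub2/gb.
have sg j : smooth_on (ball 0 delta) (fun u => g u 1 0 j).
  move=> K; elim: K j => [|K IH] j; (split; [by move=> v /dball vd; have [] := hcomm v vd j|]) => // h.
  split=> [v /dball vd|]; first by have [_ /(_ h) []] := hcomm v vd j.
  have C1 : Ck_on K (ball 0 delta) (fun u => Ac h (g u 1) 0 j).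
    apply: (Ck_on_comp (ball_open _ _) (ball_open _ _) _ IH (sAc h j K)).
    by move=> v /dball vd; exact: gin.
  apply: Ck_on_eq C1; first exact: ball_open.
  by move=> v /dball vd; have [_ /(_ h) [_ ->]] := hcomm v vd j.
split.
  move=> v vd; apply: (@continuous_comp _ _ _ (fun u => g u 1) (param a) v).
    by apply: continuous_rV => j; have [] := hcomm v vd j.
  by apply: param_continuous; exact/Omc/gin.
move=> f sf; split.
  apply: (smooth_on_comp (ball_open _ _) (ball_open _ _) _ sg (smooth_on_sub Omc (sf a Ma))).
  by move=> v /dball vd; exact: gin.
move=> v h vd.
have := @is_derive_comp R k m (f \o param a) (ball x0 r0) (fun u => g u 1) v (delta_mx 0 h)
  (fun j => Ac h (g v 1) 0 j) (ball_open _ _) (gin v vd) (smooth_on_sub Omc (sf a Ma) 1%N).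
rewrite (AE _ _ _ sf (gin v vd)).
under eq_bigr do rewrite mulrC.
apply=> j; have [_] := hcomm v vd j; exact.
Qed.

Lemma derive01_cst (h : R -> R) (c : R) :
  (forall t : R, 0 <= t <= 1 -> is_derive t 1 h c) -> h 1 = h 0 + c.
Proof.
move=> dh; have [||t _] := @MVT_segment R h (fun=> c) 0 1 ler01.
- by move=> t; rewrite in_itv /= => /andP[t0 t1]; apply: dh; rewrite !ltW.
- apply: derivable_within_continuous => t; rewrite in_itv /= => t01.
  by have [] := dh t t01.
- by rewrite subr0 mulr1 => /eqP; rewrite subr_eq addrC => /eqP.
Qed.

(** The injective half of the inverse function theorem. With [J] the Jacobian at [p] and [C] such
    that [J *m C = 1], equal values of all [f i] bound the coordinate difference by half of itself,
    so it is 0. *)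
Lemma local_injective (I : finType) (f : I -> M -> R) p :
  (forall i, smooth_fun (f i)) -> (forall v, tangent p v -> (forall i, v (f i) = 0) -> v = 0) ->
  exists W, [/\ open W, W p & forall q q', W q -> W q' -> (forall i, f i q = f i q') -> q = q'].
Proof.
move=> sf inj.
have [a Ma dp] := atlas_cover p.
have [x [E [W1 [[oW1 W1p W1d sx] [vE xE EW Ex span]]]]] := coord_frame Ma dp.
have tE j q : tangent q (E j q) by have [] := vE j.
pose J : 'M[R]_(m, #|I|) := \matrix_(j, k) (E j p (f (enum_val k)) : R).
have fJ : row_free J.
  rewrite -kermx_eq0; apply/eqP; apply: contrapT => /eqP /rowV0Pn [b /sub_kermxP bJ /eqP b0]; apply: b0.
  have z : \sum_j b 0 j *: E j p = 0.
    apply: inj => [|i]; first by apply: tangent_bigsum => j; exact: tangent_scale.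
    rewrite tvec_sumE; have /matrixP/(_ 0 (enum_rank i)) := bJ; rewrite !mxE => h; rewrite -[RHS]h.
    by apply: eq_bigr => j _; rewrite mxE enum_rankK tvecZE.
  apply/rowP => j; rewrite mxE.
  have : (\sum_i b 0 i *: E i p) (x j) = 0 by rewrite z.
  rewrite tvec_sumE (bigD1 j) //= tvecZE Ex // eqxx mulr1 big1 ?addr0 // => i ij.
  by rewrite tvecZE Ex // (negbTE ij) mulr0.
have /row_freeP [C JC] := fJ.
have JCE j l : \sum_k J j k * C k l = (j == l)%:R.
  by have /matrixP/(_ j l) := JC; rewrite [LHS]mxE [RHS]mxE.
pose x0 := coord a p.
pose phi (k : 'I_#|I|) := f (enum_val k) \o param a.
have JE j k : J j k = 'D_(delta_mx 0 j) (phi k) x0 by rewrite mxE EW.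
have sphi k : smooth_on (chart_image a) (phi k) by exact: sf.
have cx0 : chart_image a x0 by exact: codom_coord.
pose c : R := \sum_k \sum_l `|C k l| + 1.
have c0 : 0 < c by rewrite ltr_wpDl // sumr_ge0 // => k _; exact: sumr_ge0.
(* Tolerance on the partial derivatives for which the final constant [c * (m + 1) * eta] is 1/2. *)
pose eta : R := (2 * (m%:R + 1) * c)^-1.
have m1 : 0 < m%:R + 1 :> R by rewrite ltr_wpDl.
have eta0 : 0 < eta by rewrite invr_gt0 !mulr_gt0.
pose S := [set y | forall jk : 'I_m * 'I_#|I|,
    `|'D_(delta_mx 0 jk.1) (phi jk.2) y - 'D_(delta_mx 0 jk.1) (phi jk.2) x0| < eta].
have nearD : nbhs x0 S.
  apply: (@filter_forall _ _ _ (nbhs x0) (nbhs_filter x0)) => -[j k] /=.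
  have cD := smooth_on_continuous (smooth_on_derive j (sphi k)) cx0.
  have /(@cvgrPdist_lt _ _ _ (nbhs x0) (nbhs_filter x0)) /(_ eta eta0) := cD.
  by apply: filterS => y; rewrite distrC.
have nearC : nbhs x0 (chart_image a) by apply: open_nbhs_nbhs; split => //; exact: codom_open.
have /nbhs_ballP[r /= r0 hr] : nbhs x0 (S `&` chart_image a) by exact: filterI.
exists (dom a `&` coord a @^-1` ball x0 r); split.
- by apply: open_preimage_coord; exact: ball_open.
- by split => //; exact: ballxx.
move=> q q' [dq bq] [dq' bq'] ff.
suff e : coord a q - coord a q' = 0.
  by rewrite -(coordK dq) -(coordK dq'); congr param; apply/eqP; rewrite -subr_eq0 e.
set y := coord a q in bq *; set y' := coord a q' in bq' *.
have H k : exists xi : 'I_m -> 'rV[R]_m, (forall j, ball x0 r (xi j)) /\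
    \sum_j 'D_(delta_mx 0 j) (phi k) (xi j) * (y - y') 0 j = 0.
  have bz z : box y' y z -> ball x0 r z by exact: box_ball.
  have [z /bz /hr [_ cz] i|xi [bxi E0]] := @mvt_box R m (phi k) y' y; first exact: (smooth_on_derivable (sphi k)).
  exists xi; split=> [j|]; first exact: bz.
  transitivity (phi k y - phi k y'); last by rewrite /phi /= /y /y' !coordK // ff subrr.
  by rewrite E0; apply: eq_bigr => j _; rewrite !mxE.
have [xi hxi] := choice H.
have key l : `|(y - y') 0 l| <= 2^-1 * `|y - y'|.
  have id1 : (y - y') 0 l = \sum_j (\sum_k J j k * C k l) * (y - y') 0 j.
    rewrite (bigD1 l) //= [X in _ = _ + X]big1 ?addr0 => [|j jl]; first by rewrite JCE eqxx mul1r.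
    by rewrite JCE (negbTE jl) mul0r.
  (* The mean-value expansions of [phi k y - phi k y' = 0] are subtracted, so only differences
     between derivatives at [x0] and at nearby points remain. *)
  have id2 : (y - y') 0 l = \sum_k C k l * \sum_j ('D_(delta_mx 0 j) (phi k) x0 - 'D_(delta_mx 0 j) (phi k) (xi k j)) * (y - y') 0 j.
    transitivity (\sum_k C k l * \sum_j 'D_(delta_mx 0 j) (phi k) x0 * (y - y') 0 j).
      rewrite id1; under eq_bigr do rewrite mulr_suml.
      rewrite exchange_big /=; apply: eq_bigr => k _; rewrite mulr_sumr; apply: eq_bigr => j _.
      by rewrite JE; ring.
    apply: eq_bigr => k _; congr (_ * _); have [_ e0] := hxi k.
    by under [RHS]eq_bigr do rewrite mulrBl; rewrite sumrB e0 subr0.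
  rewrite id2; apply: le_trans (ler_norm_sum _ _ _) _.
  apply: (@le_trans _ _ (\sum_k `|C k l| * (m%:R * (eta * `|y - y'|)))).
    apply: ler_sum => k _; rewrite normrM ler_wpM2l //.
    apply: le_trans (ler_norm_sum _ _ _) _.
    apply: (@le_trans _ _ (\sum_(j < m) eta * `|y - y'|)).
      apply: ler_sum => j _; rewrite normrM; apply: ler_pM => //; last exact: rV_coord_le.
      have [/(_ j) b _] := hxi k; have [/(_ (j, k)) h _] := hr _ b.
      by rewrite distrC; exact: ltW.
    by rewrite sumr_const card_ord -[leLHS]mulr_natl.
  rewrite -mulr_suml.
  have cl : \sum_k `|C k l| <= c.
    apply: (@le_trans _ _ (\sum_k \sum_l `|C k l|)); last by rewrite lerDl.
    by apply: ler_sum => k _; rewrite (bigD1 l) //= lerDl sumr_ge0.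
  apply: (@le_trans _ _ (c * ((m%:R + 1) * (eta * `|y - y'|)))).
    apply: ler_pM => //; first exact: sumr_ge0.
      by rewrite !mulr_ge0 // ltW.
    by rewrite ler_wpM2r ?mulr_ge0 ?(ltW eta0) // lerDl.
  rewrite le_eqVlt; apply/orP; left; apply/eqP; rewrite /eta; field.
  by rewrite !gt_eqF.
have : `|y - y'| <= 2^-1 * `|y - y'|.
  by apply: rV_norm_le => //; rewrite mulr_ge0 // invr_ge0.
rewrite -subr_ge0 => h; apply/eqP; rewrite -normr_le0.
have e2 : 2^-1 * `|y - y'| = `|y - y'| / 2 by rewrite mulrC.
by lra.
Qed.

End flows.

(** * Reaching nearby points by flows *)

Section straightening.
Context {R : realType} {m : nat} {M : manifold R m}.
Implicit Types (p q : M).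

(** Along the flow of the combination of the [A i] with coefficients [v], each [l h] has constant
    speed [v 0 h], and a function killed by all [A i] is constant. This replaces the surjective half
    of the inverse function theorem. *)
Lemma flow_endpoint k (A : 'I_k -> field R M) (l : 'I_k -> M -> R) p (W : set M) :
  (forall i, vector_field (A i)) -> (forall i, smooth_fun (l i)) -> open W -> W p ->
  (forall i h q, W q -> A i q (l h) = (i == h)%:R) ->
  exists2 delta : R, 0 < delta & forall v : 'rV[R]_k, `|v| < delta ->
    exists q, [/\ W q, forall h, l h q = l h p + v 0 h &
      forall f, smooth_fun f -> (forall i q, W q -> A i q f = 0) -> f q = f p].
Proof.
move=> vA sl oW Wp Al; have [delta [g [d0 hg _]]] := manifold_flow vA oW Wp.
exists delta => // v vd; have [g0 gW dg] := hg v vd; exists (g v 1); split=> [|h|f sf Af].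
- by apply: gW; rewrite ler01 lexx.
- rewrite -g0; apply: (@derive01_cst _ (fun s => l h (g v s))) => t t01.
  have := dg _ t (sl h) t01; rewrite (bigD1 h) //= big1 ?addr0 => [|i ih].
    by rewrite Al ?eqxx ?mulr1 //; exact: gW.
  by rewrite Al ?(negbTE ih) ?mulr0 //; exact: gW.
- rewrite -g0 -[RHS]addr0; apply: (@derive01_cst _ (fun s => f (g v s))) => t t01.
  by have := dg _ t sf t01; rewrite big1 // => i _; rewrite Af ?mulr0 //; exact: gW.
Qed.

Lemma dual_frame k (e : 'I_k -> field R M) (l : 'I_k -> M -> R) p :
  (forall i, vector_field (e i)) -> (forall i, smooth_fun (l i)) ->
  \matrix_(i, j) (e i p (l j) : R) \in unitmx ->
  exists2 c : 'I_k -> 'I_k -> M -> R, forall i j, smooth_fun (c i j) &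
    \forall q \near p, forall i h, (\sum_j c i j q *: e j q) (l h) = (i == h)%:R.
Proof.
move=> ve sl u; have [||c sc cP] := @local_inverse_matrix _ _ _ k (fun j h q => e j q (l h)) p.
- by move=> i j; have [_] := ve i; exact.
- exact: u.
exists c => //; apply: filterS cP => q h i l0; rewrite -h tvec_sumE.
by apply: eq_bigr => j _; rewrite tvecZE.
Qed.

Lemma near_values (I : finType) (f : I -> M -> R) p (eps : R) : 0 < eps ->
  (forall i, smooth_fun (f i)) -> \forall q \near p, forall i, `|f i q - f i p| < eps.
Proof.
move=> e0 sf; apply: (@filter_forall _ _ _ (nbhs p) (nbhs_filter p)) => i.
have /(@cvgrPdist_lt _ _ _ (nbhs p) (nbhs_filter p)) /(_ eps e0) := smooth_fun_continuous (sf i) (x := p).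
by apply: filterS => q; rewrite distrC.
Qed.

Lemma row_ball k (a : 'I_k -> R) (delta : R) : 0 < delta ->
  (forall i, `|a i| < delta / 2) -> `|\row_i a i| < delta.
Proof.
move=> d0 h; apply: (@le_lt_trans _ _ (delta / 2)); last by rewrite ltr_pdivrMr // mulr_natr mulr2n ltrDr.
by apply: rV_norm_le => [|j]; rewrite ?mxE ltW // divr_gt0.
Qed.

End straightening.

(** * Fibres and projection *)

Section fibres.
Context {R : realType} {m n : nat} {M : manifold R m} {B : manifold R n}.
Context (g : metric R M) (gB : metric R B) (pi : M -> B).
Hypothesis mn : (n <= m)%N.
Hypothesis mg : metric_tensor g.
Hypothesis ng : forall p, nondegenerate_on g p (tangent p).
Hypothesis sub : semi_riemannian_submersion g gB pi.
Hypothesis frames : forall p, exists (e : 'I_(m - n) -> field R M) eps, vertical_frame_near g pi p e eps.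

Let spi : smooth_map pi. Proof. by case: sub. Qed.

(* Take [l_i] with [dl_i = g (e_i, _)] at [p] and vertical fields [A_i] dual to
   them: the [l_i] and the base coordinates separate points near [p], so every
   nearby point of the fibre is the endpoint of a flow of the [A_i]. *)
Lemma near_fibre (F : M -> R) p : smooth_fun F ->
  (forall q v, vertical pi q v -> v F = 0) ->
  \forall q \near p, pi q = pi p -> F q = F p.
Proof.
move=> sF vF; have [e [eps he]] := frames p.
have oe := nbhs_singleton (frame_oframe he).
have [ve _ _] := he; have [_ eps1 ge] := oe.
have vfe i : vector_field (e i) by have [] := ve i.
have te i q : tangent q (e i q) by have [] := vfe i.
have [W1 [y [E [bc W1p]]]] := base_coords_exists (pi p).
have [oW1 sy _ _ _] := bc.
have sypi j : smooth_fun (y j \o pi) by exact: smooth_fun_pullback.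
have [X hX] := choice (fun j => pullback_gradient mg ng sub (sy j)).
have [a Ma dp] := atlas_cover p.
have [x [Ex [W2 [[oW2 W2p _ sx] [vE _ _ _ span]]]]] := coord_frame Ma dp.
pose l i q := \sum_k g p (e i p) (Ex k p) * x k q.
have sl i : smooth_fun (l i) by apply: smooth_fun_sum => k; exact: smooth_funZ.
have tEx k q : tangent q (Ex k q) by have [] := vE k.
have lE i v : tangent p v -> v (l i) = g p (e i p) v.
  move=> tv; rewrite [in RHS](span _ _ W2p tv) g_sumr // => [|k]; last exact: tangent_scale.
  rewrite /l (tangent_sum _ tv) => [|k]; last exact: smooth_funZ.
  by apply: eq_bigr => k _; rewrite (tangentZ _ tv) // gZr // mulrC.
have u : \matrix_(i, j) (e i p (l j) : R) \in unitmx.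
  have -> : \matrix_(i, j) (e i p (l j) : R) = diag_mx (\row_i eps i).
    apply/matrixP => i j; rewrite !mxE lE // ge eq_sym; case: eqP => [->|_].
      by rewrite mulr1n.
    by rewrite mulr0n.
  rewrite unitmxE det_diag unitfE; apply/prodf_neq0 => i _; rewrite mxE.
  by have [->|->] := eps1 i; rewrite ?oppr_eq0 oner_eq0.
have [c sc cP] := dual_frame vfe sl u.
pose f (s : 'I_(m - n) + 'I_n) : M -> R := match s with inl i => l i | inr j => y j \o pi end.
have sf s : smooth_fun (f s) by case: s => i; [exact: sl|exact: sypi].
have [|W3 [oW3 W3p inj]] := @local_injective _ _ _ _ f p sf.
  (* A vector killed by every [l i] and every [y j \o pi] is orthogonal at [p] to the frame [e] and
     to the gradients, hence to everything. *)
  move=> v tv fv; apply: (ng tv) => w tw.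
  have [b [a' ->]] := decomposition mn mg sub oe bc W1p hX tw.
  rewrite gDr //; try (apply: tangent_bigsum => i; apply: tangent_scale => //; by have [[]] := hX i).
  rewrite !g_sumr // => [|i|i]; last first.
  - exact: tangent_scale.
  - by apply: tangent_scale; have [[]] := hX i.
  rewrite !big1 ?addr0 // => i _.
  - have [[tX _] gX] := hX i; rewrite gZr // gC // gX //.
    by rewrite (fv (inr i)) mulr0.
  - by rewrite gZr // gC // -lE // (fv (inl i)) mulr0.
have [W4 [oW4 W4p hW4]] := near_open cP.
pose A i q := \sum_j c i j q *: e j q.
have vA i : vector_field (A i) by apply: vector_field_sum => j; exact: vector_fieldZ.
have vertA i q : vertical pi q (A i q).
  by apply: (vertical_bigsum sub) => j; apply: (vertical_scale sub); have [] := ve j.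
have oW : open (W3 `&` W4) by exact: openI.
have [|delta d0 hd] := flow_endpoint vA sl oW (conj W3p W4p).
  by move=> i h q [_ /hW4]; exact.
have d2 : 0 < delta / 2 by rewrite divr_gt0.
have nl := near_values p d2 sl.
have nW : \forall q \near p, W3 q by exact: open_nbhs_nbhs.
near=> q => qp.
have W3q : W3 q by near: q.
have lq : forall i, `|l i q - l i p| < delta / 2 by near: q.
have [z [[W3z _] lz fz]] := hd _ (row_ball d0 lq).
have <- : z = q; last by apply: fz => // i q' _; exact: vF.
(* The endpoint [z] agrees with [q] on [l] by the choice of flow, and on the base coordinates
   because the [A i] are vertical and [pi q = pi p]. *)
apply: inj => // -[i|j] /=.
  by rewrite lz mxE addrC subrK.
rewrite qp; apply: (fz (y j \o pi)) => // i q' _.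
by have /(verticalP spi) [_] := vertA i q'; exact.
Unshelve. all: by end_near.
Qed.

(** The points of a fibre where [F] takes a given value form a set that is closed and, by
    [near_fibre], open in the fibre. *)
Lemma fibre_constant (F : M -> R) : smooth_fun F ->
  (forall b, connected (pi @^-1` [set b])) ->
  (forall q v, vertical pi q v -> v F = 0) ->
  forall p q, pi p = pi q -> F p = F q.
Proof.
move=> sF cf vF p q pq; pose b := pi q; pose S := [set z | pi z = b /\ F z = F q].
suff SE : S = pi @^-1` [set b] by have [] : S p by rewrite SE.
apply: cf.
- by exists q.
(* Stating the condition as an implication puts whole neighbourhoods in [M] into the set, so that
   its interior cuts out [S] on the fibre. *)
- exists (interior [set z | pi z = b -> F z = F q]); first exact: open_interior.
  apply/seteqP; split=> [z [zb Fz]|z [zb /interior_subset]]; last by split=> //; auto.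
  split=> //; apply: filterS (near_fibre z sF vF) => z' h z'b /=.
  by rewrite h ?Fz // z'b.
- exists (F @^-1` [set F q]).
    by apply: preimage_closed => // z _; exact: smooth_fun_continuous.
  by [].
Qed.
End fibres.

(** * Horizontal lifts, openness of the submersion and maxima *)

Section projection.
Context {R : realType} {m n : nat} {M : manifold R m} {B : manifold R n}.
Context (g : metric R M) (gB : metric R B) (pi : M -> B).
Hypothesis rB : riemannian gB.
Hypothesis mg : metric_tensor g.
Hypothesis ng : forall p, nondegenerate_on g p (tangent p).
Hypothesis sub : semi_riemannian_submersion g gB pi.

Let spi : smooth_map pi. Proof. by case: sub. Qed.

Lemma base_coords_injective W y (E : 'I_n -> field R B) b : base_coords W y E -> W b ->
  exists W', [/\ open W', W' b & forall q q', W' q -> W' q' -> (forall i, y i q = y i q') -> q = q'].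
Proof.
move=> [_ sy _ _ span] Wb; apply: local_injective => // v tv vy.
by rewrite (span _ _ Wb tv) big1 // => j _; rewrite vy scale0r.
Qed.

(** The fields [A i] are dual to the pulled-back coordinates and arise from the gradients by
    inverting the matrix of the [g (X i) (X j)]. A combination in its kernel has norm 0, so it
    vanishes because horizontal spaces are definite, and pairing it with lifts of coordinate vectors
    kills its coefficients. *)
Lemma horizontal_lifts p : exists (W : set B) y E (A : 'I_n -> field R M),
  [/\ base_coords W y E, W (pi p), forall i, horizontal_field g pi (A i) &
    \forall q \near p, forall i h, A i q (y h \o pi) = (i == h)%:R].
Proof.
have [W [y [E [bc Wp]]]] := base_coords_exists (pi p).
have [oW sy vE Ey span] := bc.
have sypi j : smooth_fun (y j \o pi) by exact: smooth_fun_pullback.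
have [X hX] := choice (fun j => pullback_gradient mg ng sub (sy j)).
have vX i : vector_field (X i) by have [] := hX i.
have tX i q : tangent q (X i q) by have [] := vX i.
have gX i q w : tangent q w -> g q (X i q) w = w (y i \o pi) by have [_] := hX i; exact.
have horX i q : horizontal g pi q (X i q) by exact: (gradient_horizontal sub q (sy i) (hX i)).
have u : \matrix_(i, j) (X i p (y j \o pi) : R) \in unitmx.
  rewrite -row_free_unit -kermx_eq0; apply/eqP; apply: contrapT => /eqP /rowV0Pn [b /sub_kermxP bJ /eqP b0].
  apply: b0; pose w := \sum_j b 0 j *: X j p.
  have hw : horizontal g pi p w.
    by apply: horizontal_bigsum => // j; apply: horizontal_scale.
  have tw : tangent p w by case: hw.
  have gw k : g p (X k p) w = 0.
    rewrite gX // /w tvec_sumE; have /matrixP/(_ 0 k) := bJ; rewrite !mxE => h; rewrite -[RHS]h.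
    by apply: eq_bigr => j _; rewrite mxE tvecZE.
  have w0 : w = 0.
    apply: (horizontal_eq0 rB sub hw); rewrite {1}/w g_suml // => [|j]; last exact: tangent_scale.
    by apply: big1 => j _; rewrite gZl // gw mulr0.
  apply/rowP => k; rewrite mxE.
  have [_ _ lift _ _] := sub.
  have tE : tangent (pi p) (E k (pi p)) by have [] := vE k.
  have [v tv ve] := lift _ _ tE.
  have : g p w v = 0 by rewrite w0 g0l.
  rewrite /w g_suml // => [|j]; last exact: tangent_scale.
  have vy j : v (y j \o pi) = (k == j)%:R by rewrite -(Ey _ k j Wp) -ve pushforwardE.
  rewrite (bigD1 k) //= gZl // gX // vy eqxx mulr1 big1 ?addr0 // => j jk.
  by rewrite gZl // gX // vy eq_sym (negbTE jk) mulr0.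
have [c sc cP] := dual_frame vX sypi u.
exists W, y, E, (fun i q => \sum_j c i j q *: X j q); split=> // i; split.
  by apply: vector_field_sum => j; exact: vector_fieldZ.
by move=> q; apply: horizontal_bigsum => // j; exact: horizontal_scale.
Qed.

(** Flows of the horizontal lifts inside [W] attain all nearby values of the base coordinates, and
    these separate points of [B] near [pi p]. *)
Lemma submersion_open p (W : set M) : open W -> W p ->
  \forall b \near pi p, exists2 q, W q & pi q = b.
Proof.
move=> oW Wp; have [W1 [y [E [A [bc W1p hA nA]]]]] := horizontal_lifts p.
have [oW1 sy _ _ _] := bc.
have [W2 [oW2 W2p inj]] := base_coords_injective bc W1p.
have [W3 [oW3 W3p hW3]] := near_open nA.
have oV : open (W `&` (W3 `&` pi @^-1` W2)).
  apply: openI => //; apply: openI => //; apply: open_comp => // x _.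
  by have [] := spi; exact.
have [||||delta d0 hd] := @flow_endpoint _ _ _ _ A (fun k => y k \o pi) p _ _ _ oV.
- by move=> i; have [] := hA i.
- by move=> i; exact: smooth_fun_pullback.
- by [].
- by move=> i h q [_ [/hW3]]; exact.
have d2 : 0 < delta / 2 by rewrite divr_gt0.
have nl := near_values (pi p) d2 sy.
have nW : \forall b \near pi p, W2 b by exact: open_nbhs_nbhs.
near=> b; have W2b : W2 b by near: b.
have lb : forall i, `|y i b - y i (pi p)| < delta / 2 by near: b.
have [q [[Wq [_ W2q]] lq _]] := hd _ (row_ball d0 lb).
exists q => //; apply: inj => // i.
by have /= -> := lq i; rewrite mxE addrC subrK.
Unshelve. all: by end_near.
Qed.

(* [F] descends to a continuous function on [B] because [pi] is open. *)
Lemma fibre_constant_max (F : M -> R) : smooth_fun F -> compact [set: B] ->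
  (forall p q, pi p = pi q -> F p = F q) -> exists p, forall q, F q <= F p.
Proof.
move=> sF cB Fc; have [_ surj _ _ _] := sub.
have [s hs] := choice surj; pose f b := F (s b).
have fE q : f (pi q) = F q by apply: Fc; rewrite hs.
have cf : continuous f.
  move=> b; apply/(@cvgrPdist_lt _ _ _ (nbhs b) (nbhs_filter b)) => eps e0.
  have e1 : \forall q \near s b, `|F (s b) - F q| < eps.
    have /(@cvgrPdist_lt _ _ _ (nbhs (s b)) (nbhs_filter (s b))) := smooth_fun_continuous sF (x := s b).
    exact.
  have [W [oW Wb hW]] := near_open e1.
  have := submersion_open oW Wb; rewrite hs; apply: filterS => b' [q Wq <-].
  by rewrite fE; exact: hW.
have [p0 _] := manifold_nonempty M.
have [||b _ bmax] := @compact_EVT_max B R f [set: B] _ cB.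
- by exists (pi p0).
- exact: continuous_subspaceT.
exists (s b) => q; rewrite -fE; apply: bmax.
by rewrite inE.
Qed.

End projection.

(** * The sign of the curvature *)

Section curvature.
Context {R : realType} {m n : nat} {M : manifold R m} {B : manifold R n}.
Context (g : metric R M) (gB : metric R B) (pi : M -> B).
Hypothesis mn : (n <= m)%N.
Hypothesis rB : riemannian gB.
Hypothesis mg : metric_tensor g.
Hypothesis ng : forall p, nondegenerate_on g p (tangent p).
Hypothesis sub : semi_riemannian_submersion g gB pi.
Hypothesis frames : forall p, exists (e : 'I_(m - n) -> field R M) eps, vertical_frame_near g pi p e eps.

(** Expand [v] in coordinate vectors and apply the one-variable criterion on each coordinate
    line. *)
Lemma tangent_max (F : M -> R) p v : smooth_fun F -> (forall q, F q <= F p) -> tangent p v -> v F = 0.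
Proof.
move=> sF Fp tv; have [a Ma dp] := atlas_cover p.
have [x [E [W [[oW Wp _ sx] [vE _ EW _ span]]]]] := coord_frame Ma dp.
rewrite (span _ _ Wp tv) tvec_sumE big1 // => j _; rewrite tvecZE EW //.
set f := F \o param a; set x0 := coord a p.
suff -> : 'D_(delta_mx 0 j) f x0 = 0 by rewrite mulr0.
have nC : nbhs x0 (chart_image a).
  by apply: open_nbhs_nbhs; split; [exact: codom_open|exact: codom_coord].
have /nbhs_ballP[r /= r0 hr] := nC.
set e : 'rV[R]_m := delta_mx 0 j.
have e1 : `|e| <= 1.
  by apply: rV_norm_le => // k; rewrite mxE eqxx /=; case: eqP => _; rewrite ?normr1 ?normr0.
have inC (t : R) : `|t| < r -> chart_image a (x0 + t *: e).
  move=> tr; apply/hr/ball_normP; rewrite opprD addrA subrr sub0r normrN normrZ.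
  by apply: le_lt_trans tr; rewrite ler_piMr.
have lineD (t : R) : `|t| < r -> is_derive t 1 (fun s : R => f (x0 + s *: e)) ('D_e f (x0 + t *: e)).
  by move=> /inC h; apply: line_derive; exact: (@smooth_on_derivable _ _ _ f (sF a Ma)).
have itv (t : R) : (t \in `]- r, r[%R) = (`|t| < r) by rewrite in_itv /= ltr_norml.
have [_ D2] : is_derive (0 : R) 1 (fun s : R => f (x0 + s *: e)) 0.
  apply: (@derive1_at_max R _ (- r) r) => [|t||t _].
  - by rewrite lerNl (le_trans _ (ltW r0)) // oppr_le0 ltW.
  - by rewrite itv => /lineD [].
  - by rewrite itv normr0.
  - by rewrite scale0r addr0 /f /= [X in _ <= F X]coordK.
have [|_] := lineD 0; first by rewrite normr0.
by rewrite D2 scale0r addr0.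
Qed.

(** Keep the coefficients in a vertical frame constant. *)
Lemma vertical_extension p w : vertical pi p w -> exists2 U, vertical_field pi U & U p = w.
Proof.
move=> vw; have [e [eps he]] := frames p.
have oe := nbhs_singleton (frame_oframe he); have [ve _ _] := he.
rewrite (oframe_vertical mn mg ng sub oe vw).
set b := fun i => eps i * g p w (e i p).
exists (fun q => \sum_i b i *: e i q) => //; split=> [|q].
  apply: vector_field_sum => i; apply: (vector_fieldZ (smooth_fun_cst (b i))).
  by have [] := ve i.
by apply: (vertical_bigsum sub) => i; apply: (vertical_scale sub); have [] := ve i.
Qed.

(** Removing the horizontal part of a vector with negative square removes a nonnegative term, so its
    vertical part still has negative square. *)
Lemma timelike_vertical p nu : (0 < nu)%N -> index_at g p nu ->
  exists2 U, vertical_field pi U & g p (U p) (U p) < 0.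
Proof.
move=> nu0 [[e [te hneg]] _]; pose u := \sum_i 1 *: e i.
have tu : tangent p u by apply: tangent_bigsum => i; exact: tangent_scale.
have u0 : g p u u < 0 by apply: (hneg (fun=> 1)); exists (Ordinal nu0); exact: oner_neq0.
have [hu vu] := hproj_spec mn mg ng sub frames tu.
have [U vU Up] := vertical_extension vu; exists U => //; rewrite Up.
set h := hproj g pi p u in hu vu *; set v := u - h in vu *.
have th : tangent p h by case: hu.
have tv : tangent p v by case: vu.
have uE : u = h + v by rewrite /v addrC subrK.
apply: le_lt_trans u0; rewrite uE; clearbody v.
rewrite gDl // ?gDr // ?(g_hv hu vu) ?(g_vh _ hu vu) //; try exact: tangent_add.
by rewrite addr0 add0r lerDr; exact: (horizontal_ge0 rB mg sub hu).
Qed.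

Context (D : connection R M) (c : R).
Hypothesis lc : levi_civita g D.
Hypothesis cc : constant_curvature g D c.
Context (N : field R M).
Hypothesis vN : vector_field N.
Hypothesis hN : forall p, horizontal g pi p (N p).
Hypothesis TN : forall U V, vertical_field pi U -> vertical_field pi V -> forall p,
  Ttensor g D pi U V p = g p (U p) (V p) *: N p.
Hypothesis r2 : (2 <= m - n)%N.

Lemma mean_curvature_eq0 : compact [set: B] -> (forall b, connected (pi @^-1` [set b])) ->
  (forall p, index_at g p (m - n)) -> 0 <= c -> forall p, N p = 0.
Proof.
move=> cB cf ig c0; pose F p := g p (N p) (N p).
have sF : smooth_fun F by exact: smooth_metric.
have vF q v : vertical pi q v -> v F = 0.
  exact: (N2_vertical mn mg ng sub frames lc cc vN hN TN r2).
have Fc := fibre_constant mn mg ng sub frames sF cf vF.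
have [p pmax] := fibre_constant_max rB mg ng sub sF cB Fc.
have F0 q : 0 <= F q by exact: (horizontal_ge0 rB mg sub).
have tN q : tangent q (N q) by have [] := vN.
have [aD _ _] := lc.
have tD : tangent p (D N N p) by have [] := D_field aD vN vN.
(* This is half the derivative of [F] along [N] at its maximum. *)
have dN : g p (D N N p) (N p) = 0.
  have := tangent_max sF pmax (tN p); rewrite (compatible lc) // (gC _ (tN p)) //.
  by move=> /eqP; rewrite -mulr2n mulrn_eq0 /= => /eqP.
have [U vU Un] := timelike_vertical (ltnW r2) (ig p).
have := mixed_curvature mn rB mg ng sub frames lc cc vN TN p vU (conj vN hN).
rewrite dN -/(F p) sub0r => E.
have tDU : tangent p (D N U p) by have [] := D_field aD vN vU.1.
have P0 : 0 <= g p (hproj g pi p (D N U p)) (hproj g pi p (D N U p)).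
  by have [h _] := hproj_spec mn mg ng sub frames tDU; exact: (horizontal_ge0 rB mg sub).
(* The mixed equation becomes [g(U, U) (c + F) F = g(P, P)] with [P = h D_N U]. If [F p] were
   positive the left side would be negative, while the right side is nonnegative. *)
have Fp : F p = 0.
  apply/eqP; rewrite eq_le F0 andbT leNgt; apply/negP => Fp0.
  have : g p (U p) (U p) * ((c + F p) * F p) = g p (hproj g pi p (D N U p)) (hproj g pi p (D N U p)).
    by move: E; lra.
  have : g p (U p) (U p) * ((c + F p) * F p) < 0.
    by rewrite nmulr_rlt0 // mulr_gt0 // ltr_wpDl.
  by lra.
move=> q; apply: (horizontal_eq0 rB sub (hN q)).
by apply/eqP; rewrite eq_le -/(F q) F0 andbT -Fp pmax.
Qed.

Section vanishing.
Hypothesis N0 : forall p, N p = 0.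

Lemma geodesic_mixed_curvature U X p : vertical_field pi U -> horizontal_field g pi X ->
  c * g p (U p) (U p) * g p (X p) (X p) =
  g p (hproj g pi p (D X U p)) (hproj g pi p (D X U p)).
Proof.
move=> vU hX; have [vX horX] := hX; have [aD _ _] := lc.
have tX q : tangent q (X q) by have [] := vX.
rewrite (mixed_curvature mn rB mg ng sub frames lc cc vN TN p vU hX).
have tD : tangent p (D X X p) by have [] := D_field aD vX vX.
(* Differentiating [g N X = 0] is how [N = 0] yields [g (D X N) X = 0]. *)
have : X p (fun q => g q (N q) (X q)) = 0.
  rewrite -(tangent_cst 0 (tX p)); congr (X p _); apply/funext => q.
  by rewrite N0 g0l.
by rewrite (compatible lc) // N0 !g0l // addr0 => ->; rewrite expr0n subr0 mulr0 add0r.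
Qed.

(** Since [n] is positive there is a horizontal [X] of positive square, and [U] can be taken of
    negative square; then [c] times a negative number is a square of a horizontal vector. *)
Lemma curvature_le0 p : (0 < n)%N -> index_at g p (m - n) -> c <= 0.
Proof.
move=> n0 ip; have [W [y [E [A [_ _ hA nA]]]]] := horizontal_lifts rB mg ng sub p.
pose i0 := Ordinal n0; have A0 : A i0 p != 0.
  apply/eqP => z; have := nbhs_singleton nA i0 i0; rewrite z eqxx => /esym/eqP.
  by rewrite oner_eq0.
have [vA horA] := hA i0; have [aD _ _] := lc.
have [U vU Un] := timelike_vertical (ltnW r2) ip.
have := geodesic_mixed_curvature p vU (hA i0).
have A1 := horizontal_gt0 rB sub (horA p) A0.
have tDU : tangent p (D (A i0) U p) by have [] := D_field aD vA vU.1.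
have P0 : 0 <= g p (hproj g pi p (D (A i0) U p)) (hproj g pi p (D (A i0) U p)).
  by have [h _] := hproj_spec mn mg ng sub frames tDU; exact: (horizontal_ge0 rB mg sub).
move=> e0; rewrite leNgt; apply/negP => c0; move: P0; rewrite -e0.
by rewrite -mulrA pmulr_rge0 // leNgt nmulr_rlt0 // A1.
Qed.

(** The product of [bracket X Y] with a vertical [U] is [g X (D Y U) - g Y (D X U)], and both terms
    vanish since [D X U] and [D Y U] are vertical. *)
Lemma horizontal_bracket X Y p : c = 0 -> horizontal_field g pi X -> horizontal_field g pi Y ->
  horizontal g pi p (bracket X Y p).
Proof.
move=> c0; have [aD _ _] := lc.
have P0 X' U q : horizontal_field g pi X' -> vertical_field pi U ->
    vertical pi q (D X' U q).
  move=> hX' vU; have := geodesic_mixed_curvature q vU hX'.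
  rewrite c0 !mul0r => /esym P0.
  have tDU : tangent q (D X' U q) by have [] := D_field aD hX'.1 vU.1.
  have [h v] := hproj_spec mn mg ng sub frames tDU.
  by move: v; rewrite (horizontal_eq0 rB sub h P0) subr0.
move=> hX hY; split=> [|w vw]; first exact: bracket_tangent hX.1 hY.1.
have [U vU Up] := vertical_extension vw; rewrite -Up -(torsion_free lc p hX.1 hY.1).
have tU : tangent p (U p) by have [[]] := vU.
have tXY : tangent p (D X Y p) by have [] := D_field aD hX.1 hY.1.
have tYX : tangent p (D Y X p) by have [] := D_field aD hY.1 hX.1.
rewrite (gBl mg tXY tYX tU) (connection_skew lc p hX.1 hY vU) (connection_skew lc p hY.1 hX vU).
by rewrite (g_hv (hY.2 p) (P0 _ _ _ hX vU)) (g_hv (hX.2 p) (P0 _ _ _ hY vU)) oppr0 subrr.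
Qed.

End vanishing.
End curvature.

(** * Integral manifolds *)

Section ball_manifold.
Context {R : realType} {n : nat}.
Implicit Types (x y : 'rV[R]_n).

(** Balls with rational centre and rational radius form a countable basis. *)
Lemma second_countable_rV : @second_countable 'rV[R]_n.
Proof.
pose b (c : 'rV[rat]_n * rat) : set 'rV[R]_n := ball (map_mx ratr c.1 : 'rV[R]_n) (ratr c.2).
exists (range b); first by apply: card_le_trans (card_image_le _ _) (countableP _).
split=> [_ [c _ <-]|x U /nbhs_ballP[e /= e0 eU]]; first exact: ball_open.
have [r] : exists r, r \in `](0 : R), e / 2[%R /\ exists q : rat, r = ratr q.
  by have [q qr] := rat_in_itvoo (divr_gt0 e0 (ltr0Sn R 1)); exists (ratr q); split=> //; exists q.
rewrite in_itv /= => -[/andP[r0 re] [rq rE]].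
have r2 : 0 < r / 2 by rewrite divr_gt0.
have H i : exists q : rat, `|ratr q - x 0 i| < r / 2.
  have [|q] := @rat_in_itvoo R (x 0 i - r / 2) (x 0 i + r / 2).
    by rewrite ltrBlDr -addrA ltrDl addr_gt0.
  by rewrite in_itv /= => h; exists q; rewrite ltr_distl.
have [q hq] := choice H; pose c : 'rV[rat]_n * rat := (\row_i q i, rq).
have qx : `|(map_mx ratr c.1 : 'rV[R]_n) - x| <= r / 2.
  by apply: rV_norm_le => [|j]; rewrite ?(ltW r2) // !mxE ltW.
exists (b c).
  split; first by exists c.
  apply/ball_normP; rewrite -rE; apply: le_lt_trans qx _.
  by rewrite ltr_pdivrMr // mulr_natr mulr2n ltrDr.
move=> z /ball_normP; rewrite -rE => qz; apply/eU/ball_normP.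
set y : 'rV[R]_n := map_mx ratr c.1 in qx qz; have -> : x - z = (y - z) - (y - x).
  by clearbody y; apply/rowP => j; rewrite !mxE; ring.
by apply: le_lt_trans (ler_normB _ _) _; lra.
Qed.

Lemma connected_rV : connected [set: 'rV[R]_n].
Proof.
have -> : [set: 'rV[R]_n] = \bigcup_(x in setT) ((fun t : R => t *: x) @` `[0, 1]%classic).
  apply/seteqP; split=> // x _; exists x => //; exists 1; last by rewrite scale1r.
  by rewrite /= in_itv /= ler01 lexx.
apply: bigcup_connected.
  exists 0 => x _; exists 0; last by rewrite scale0r.
  by rewrite /= in_itv /= ler01 lexx.
move=> x _; apply: connected_continuous_connected; first exact: segment_connected.
apply: continuous_subspaceT => t; apply: continuous_rV => j.
under [X in {for _, continuous X}]eq_fun do rewrite mxE.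
by apply: cvgMr_tmp.
Qed.

Section to_ball.
Context (delta : R) (delta0 : 0 < delta).

(** Only a homeomorphism is required, although the norm is not smooth: as the coordinate of a
    one-chart atlas, this map defines the smooth structure. *)
Definition to_ball x : 'rV[R]_n := (delta / (1 + `|x|)) *: x.
Definition of_ball y : 'rV[R]_n := (delta - `|y|)^-1 *: y.

Let one_norm x : 0 < 1 + `|x|. Proof. by rewrite ltr_wpDr. Qed.

Lemma norm_to_ball x : `|to_ball x| = delta * `|x| / (1 + `|x|).
Proof. by rewrite normrZ ger0_norm ?divr_ge0 ?ltW // mulrAC. Qed.

Lemma to_ball_lt x : `|to_ball x| < delta.
Proof. by rewrite norm_to_ball ltr_pdivrMr // ltr_pM2l // ltrDr. Qed.

Lemma to_ballK : cancel to_ball of_ball.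
Proof.
move=> x; rewrite /of_ball norm_to_ball /to_ball scalerA -[RHS]scale1r; congr (_ *: _).
have := one_norm x; set a := `|x| => a1.
have -> : delta - delta * a / (1 + a) = delta / (1 + a) by field; rewrite gt_eqF.
by rewrite mulVf // mulf_neq0 ?invr_eq0 // gt_eqF.
Qed.

Lemma of_ballK y : `|y| < delta -> to_ball (of_ball y) = y.
Proof.
move=> yd; have dy : 0 < delta - `|y| by rewrite subr_gt0.
rewrite /to_ball /of_ball normrZ ger0_norm ?invr_ge0 ?ltW // scalerA -[RHS]scale1r; congr (_ *: _).
by field; rewrite !gt_eqF //= subrK.
Qed.

Lemma image_to_ball : range to_ball = ball 0 delta.
Proof.
apply/seteqP; split=> [_ [x _ <-]|y /ball_normP].
  by apply/ball_normP; rewrite sub0r normrN; exact: to_ball_lt.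
by rewrite sub0r normrN => yd; exists (of_ball y) => //; exact: of_ballK.
Qed.

Let norm_scale_continuous (f : R -> R) x : {for `|x|, continuous f} ->
  {for x, continuous (fun y => f `|y| *: y)}.
Proof.
move=> cf; apply: continuous_rV => j.
have -> : (fun y => (f `|y| *: y) 0 j) = (f \o (fun y => `|y|)) \* (fun y => y 0 j).
  by apply/funext => y; rewrite mxE.
apply: (@continuousM _ 'rV[R]_n); last exact: matrix_normedtype.coord_continuous.
by apply: (@continuous_comp 'rV[R]_n) => //; exact: norm_continuous.
Qed.

Lemma to_ball_continuous : continuous to_ball.
Proof.
move=> x; apply: (@norm_scale_continuous (fun s => delta / (1 + s))).
apply: (@continuousM _ R (fun=> delta)); first exact: cst_continuous.
apply: (@continuousV _ R (fun s => 1 + s)); first by rewrite gt_eqF.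
by apply: cvgD; [exact: cvg_cst|exact: cvg_id].
Qed.

Lemma of_ball_continuous y : `|y| < delta -> {for y, continuous of_ball}.
Proof.
move=> yd; have dy : 0 < delta - `|y| by rewrite subr_gt0.
apply: (@norm_scale_continuous (fun s => (delta - s)^-1)).
apply: (@continuousV _ R (fun s => delta - s)); first by rewrite gt_eqF.
by apply: cvgB; [exact: cvg_cst|exact: cvg_id].
Qed.

Definition to_ball_chart : chart R n 'rV[R]_n.
Proof.
apply: (@Chart R n _ setT to_ball of_ball).
- exact: openT.
- by rewrite image_to_ball; exact: ball_open.
- by move=> x _; exact: to_ballK.
- by move=> x _; exact: to_ball_continuous.
- move=> y; rewrite image_to_ball => /ball_normP; rewrite sub0r normrN.
  exact: of_ball_continuous.
Defined.

Lemma to_ball_compatible (a b : chart R n 'rV[R]_n) :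
  [set to_ball_chart] a -> [set to_ball_chart] b -> smooth_transition a b.
Proof.
move=> -> -> j; apply: (@smooth_on_eq _ _ _ (fun x => x 0 j)) => [|x|].
- by rewrite /overlap /= setIT image_to_ball; exact: ball_open.
- by move=> [y _ <-]; rewrite /transition /= to_ballK.
- exact: smooth_on_coord.
Qed.

(* The ball of radius [delta], with its identity chart, carried by the
   homeomorphic space ['rV[R]_n]. *)
Definition ball_manifold : manifold R n.
Proof.
apply: (@Manifold R n 'rV[R]_n [set to_ball_chart]).
- by exists 0.
- exact: norm_hausdorff.
- exact: second_countable_rV.
- exact: connected_rV.
- by move=> p; exists to_ball_chart.
- exact: to_ball_compatible.
Defined.

End to_ball.
End ball_manifold.

(** * Integral manifolds of commuting fields *)

Section integral_manifolds.
Context {R : realType} {m : nat} {M : manifold R m}.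

(** The integral manifold is parametrized by the time-one map of the flow of the combinations of the
    [A i]. Commutation makes its partial derivatives the [A i] themselves; the functions [z i]
    recover the parameter, which gives injectivity of the map and of its differential. *)
Lemma integral_ball k (A : 'I_k -> field R M) (z : 'I_k -> M -> R) p (W : set M) :
  (forall i, vector_field (A i)) -> (forall i, smooth_fun (z i)) -> open W -> W p ->
  (forall i h q, W q -> A i q (z h) = (i == h)%:R) ->
  (forall i h q, W q -> bracket (A i) (A h) q = 0) ->
  exists (N : manifold R k) (iota : N -> M),
    [/\ forall q, W (iota q), exists q, iota q = p &
        integral_manifold (fun q => [set v | exists a : 'I_k -> R, v = \sum_i a i *: A i q]) iota].
Proof.
move=> vA sz oW Wp Az bra.
have tA i q : tangent q (A i q) by have [] := vA i.
have [a0 Ma dp] := atlas_cover p.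
have [x [E [W2 [[oW2 W2p W2d sx] [_ xE _ _ _]]]]] := coord_frame Ma dp.
have [delta [h [d0 hh comm]]] := manifold_flow vA (openI oW oW2) (conj Wp W2p).
have [|cont hf] := comm; first by move=> i j q [Wq _]; exact: bra.
pose psi (u : 'rV[R]_k) : M := h u 1.
have psiW (u : 'rV[R]_k) : `|u| < delta -> W (psi u) /\ W2 (psi u).
  by move=> /hh [_ hW _]; apply: hW; rewrite ler01 lexx.
have zpsi (u : 'rV[R]_k) i : `|u| < delta -> z i (psi u) = z i p + u 0 i.
  move=> /hh [h0 hW dh]; rewrite -h0; apply: (@derive01_cst _ (fun s => z i (h u s))) => t t01.
  have [Wt _] := hW t t01; have := dh _ t (sz i) t01.
  rewrite (bigD1 i) //= big1 ?addr0 => [|j ji]; first by rewrite Az ?eqxx ?mulr1.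
  by rewrite Az ?(negbTE ji) ?mulr0.
(* The flow for the parameter 0 starts at [p] and has zero velocity, so it is still at [p] at time
   1. *)
have psi0 : psi 0 = p.
  have n0 : `|0 : 'rV[R]_k| < delta by rewrite normr0.
  have [_ W2z] := psiW _ n0; have [h0 _ dh] := hh _ n0.
  rewrite -(coordK (W2d _ W2z)) -(coordK dp); congr param; apply/rowP => j.
  rewrite -!xE // -[RHS]addr0 -h0; apply: (@derive01_cst _ (fun s => x j (h 0 s))) => t t01.
  by have := dh _ t (sx j) t01; rewrite big1 // => i _; rewrite mxE mul0r.
pose N := ball_manifold d0 : manifold R k.
pose iota : N -> M := fun v : 'rV[R]_k => psi (to_ball delta v).
have sq (v : 'rV[R]_k) : `|to_ball delta v| < delta by exact: to_ball_lt.
have bP (u : 'rV[R]_k) : ball 0 delta u -> `|u| < delta by move=> /ball_normP; rewrite sub0r normrN.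
have Pb (u : 'rV[R]_k) : `|u| < delta -> ball 0 delta u by move=> ud; apply/ball_normP; rewrite sub0r normrN.
have iotaE (u : 'rV[R]_k) : `|u| < delta -> iota (of_ball delta u) = psi u.
  by move=> ud; rewrite /iota /= of_ballK.
have nb (u : 'rV[R]_k) : `|u| < delta -> nbhs u (ball 0 delta).
  by move=> ud; apply: open_nbhs_nbhs; split; [exact: ball_open|exact: Pb].
have ci : continuous iota.
  move=> v; apply: (@continuous_comp _ _ _ (to_ball delta) psi); first exact: to_ball_continuous.
  exact: cont.
have si : smooth_map iota.
  split=> // _ b -> Mb j; apply: smooth_on_local => _ [v [_ bv] <-] /=.
  (* The coordinates of the chart [b] are replaced near the point by global smooth functions,
     because [hf] speaks only of these. *)
  have [x' [E' [W3 [[oW3 W3v W3d sx'] [_ xE' _ _ _]]]]] := coord_frame Mb bv.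
  have : nbhs (to_ball delta v) (ball 0 delta `&` psi @^-1` W3).
    by apply: filterI; [exact: nb|apply: cont => //; exact: open_nbhs_nbhs].
  move=> /near_open [V [oV Vv VW]]; exists V => //.
  apply: (@smooth_on_eq _ _ _ (x' j \o psi)) => // [u /VW [/bP ud W3u]|].
    by rewrite iotaE //= xE'.
  by apply: (@smooth_on_sub _ _ _ (ball 0 delta)); [move=> u /VW []|have [] := hf _ (sx' j)].
have ii : injective iota.
  move=> v v' e; apply: (can_inj (to_ballK d0)); apply/rowP => i.
  have := zpsi _ i (sq v); rewrite -[psi _]/(iota v) e [LHS]zpsi // => /addrI ->.
  by [].
have zi i v : z i (iota v) = z i p + to_ball delta v 0 i by exact: zpsi.
(* The coordinate vectors of [N] at [q]: they correspond to the [A j], and [z j \o iota] is their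
   coordinate function up to the constant [z j p]. *)
have span (q : N) : exists E' : 'I_k -> tvec R N,
    [/\ forall j, tangent q (E' j),
        forall j f, smooth_fun f -> E' j (f \o iota) = A j (iota q) f &
        forall v, tangent q v -> v = \sum_j v (z j \o iota) *: E' j].
  have Na : atlas (to_ball_chart d0 : chart R k N) by [].
  have [y [E' [W4 [[oW4 W4q _ sy] [vE yE EW Ey sp]]]]] := @coord_frame _ _ N _ q Na I.
  have sfi f : smooth_fun f -> smooth_fun (f \o iota) by exact: smooth_fun_pullback.
  exists (fun j => E' j q); split=> [j|j f sf|v tv]; first by have [] := vE j.
    rewrite EW //; last exact: sfi.
    have [_ /(_ _ j (sq q)) [_ <-]] := hf f sf.
    apply: near_eq_derive; apply: filterS (nb _ (sq q)) => u /bP ud /=.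
    by rewrite iotaE.
  rewrite {1}(sp _ _ W4q tv); apply: eq_bigr => j _; congr (_ *: _).
  have sc : smooth_fun (fun u : N => (z j \o iota) u - z j p) by apply: smooth_funB; [exact: sfi|exact: smooth_fun_cst].
  have -> : v (y j) = v (fun u => (z j \o iota) u - z j p).
    apply: (tangent_near tv) => //; have : \forall u \near q, W4 u by exact: open_nbhs_nbhs.
    by apply: filterS => u W4u; rewrite yE // /= zi addrC addKr.
  rewrite (tangentB tv) ?(tangent_cst _ tv) ?subr0 //; [exact: sfi|exact: smooth_fun_cst].
exists N, iota; split; [by move=> q; have [] := psiW _ (sq q)| |split=> //].
- exists (0 : 'rV[R]_k); rewrite /iota /= -[RHS]psi0; congr psi.
  by rewrite /to_ball scaler0.
- move=> q v tv v0; have [E' [tE _ sp]] := span q.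
  rewrite (sp _ tv) big1 // => j _.
  have := congr1 (fun w : tvec R M => w (z j)) v0; rewrite pushforwardE // => ->.
  by rewrite scale0r.
move=> q; have [E' [tE EA sp]] := span q.
have push (b : 'I_k -> R) : pushforward iota (\sum_j b j *: E' j) = \sum_j b j *: A j (iota q).
  apply: (@tangent_ext _ _ _ (iota q)).
  - by apply: (tangent_pushforward si); apply: tangent_bigsum => j; exact: tangent_scale.
  - by apply: tangent_bigsum => j; exact: tangent_scale.
  - move=> f sf; rewrite pushforwardE // !tvec_sumE; apply: eq_bigr => j _.
    by rewrite !tvecZE EA.
apply/seteqP; split=> [_ [v tv <-]|w [b ->]] /=.
  by exists (fun j => v (z j \o iota)); rewrite {1}(sp _ tv) push.
exists (\sum_j b j *: E' j); last exact: push.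
by apply: tangent_bigsum => j; exact: tangent_scale.
Qed.

End integral_manifolds.

(** * Integrability of the horizontal distribution *)

Section integrability.
Context {R : realType} {m n : nat} {M : manifold R m} {B : manifold R n}.
Context (g : metric R M) (gB : metric R B) (pi : M -> B).
Hypothesis rB : riemannian gB.
Hypothesis mg : metric_tensor g.
Hypothesis ng : forall p, nondegenerate_on g p (tangent p).
Hypothesis sub : semi_riemannian_submersion g gB pi.

Let spi : smooth_map pi. Proof. by case: sub. Qed.

(** A vector that kills the pulled-back coordinates is vertical, and only 0 is both horizontal and
    vertical. *)
Lemma horizontal_dual_eq0 p (W : set B) y (E : 'I_n -> field R B) w :
  base_coords W y E -> W (pi p) -> horizontal g pi p w -> (forall h, w (y h \o pi) = 0) -> w = 0.
Proof.
move=> [_ sy _ _ span] Wp hw wy; apply: (horizontal_vertical0 sub hw).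
have tw : tangent p w by case: hw.
split=> //; rewrite (span _ _ Wp (tangent_pushforward spi tw)) big1 // => j _.
by rewrite pushforwardE // wy scale0r.
Qed.

(** The lifts commute: [A j] on a pulled-back coordinate is locally constant, so a bracket of lifts
    kills these coordinates, and it is horizontal by hypothesis. *)
Lemma horizontal_integrable :
  (forall X Y p, horizontal_field g pi X -> horizontal_field g pi Y ->
     horizontal g pi p (bracket X Y p)) ->
  integrable_distribution n (horizontal g pi).
Proof.
move=> br p; have [W1 [y [E [A [bc W1p hA nA]]]]] := horizontal_lifts rB mg ng sub p.
have [oW1 sy _ _ _] := bc.
have sz j : smooth_fun (y j \o pi) by exact: smooth_fun_pullback.
have [W2 [oW2 W2p hW2]] := near_open nA.
pose W := W2 `&` pi @^-1` W1.
have oW : open W by apply: openI => //; apply: open_comp => // x _; have [] := spi; exact.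
have vA i : vector_field (A i) by have [] := hA i.
have AE i q : horizontal g pi q (A i q) by have [] := hA i.
have Az i h q : W q -> A i q (y h \o pi) = (i == h)%:R by move=> [/hW2].
have bra i j q : W q -> bracket (A i) (A j) q = 0.
  move=> Wq; apply: (horizontal_dual_eq0 bc (proj2 Wq)); first exact: br.
  have nW : \forall z \near q, W z by exact: open_nbhs_nbhs.
  move=> h; suff K i' j' : A i' q (fun z => A j' z (y h \o pi) : R) = 0 by rewrite /bracket !K subrr.
  have tA : tangent q (A i' q) by have [] := vA i'.
  rewrite -(tangent_cst (j' == h)%:R tA); apply: (tangent_near tA).
  - by have [_] := vA j'; exact.
  - exact: smooth_fun_cst.
  - by apply: filterS nW => z Wz; exact: Az.
have [N [iota [iW [q0 q0p] [i1 i2 i3 i4]]]] := integral_ball vA sz oW (conj W2p W1p) Az bra.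
exists N, iota; split; last by exists q0.
split=> // q; rewrite i4; apply/seteqP; split=> [w [a ->]|w hw] /=.
  by apply: horizontal_bigsum => // i; exact: horizontal_scale.
(* By duality the coefficients of a horizontal vector in the lifts are its values on the pulled-back
   coordinates. *)
exists (fun i => w (y i \o pi)); apply/eqP; rewrite -subr_eq0; apply/eqP.
apply: (horizontal_dual_eq0 bc (proj2 (iW q))) => [|h].
  by apply: horizontal_sub => //; apply: horizontal_bigsum => // i; exact: horizontal_scale.
have -> (u v : tvec R M) f : (u - v) f = u f - v f by [].
rewrite tvec_sumE (bigD1 h) //= big1 ?addr0 => [|i ih].
  by rewrite tvecZE Az // eqxx mulr1 subrr.
by rewrite tvecZE Az // (negbTE ih) mulr0.
Qed.

End integrability.

Theorem corollary3p14 (R : realType) (m n : nat)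
    (M : manifold R m) (B : manifold R n)
    (g : metric R M) (gB : metric R B) (D : connection R M)
    (pi : M -> B) (c : R) :
  (1 <= n)%N -> (2 <= m - n)%N ->
  compact [set: B] -> orientable B -> riemannian gB ->
  semi_riemannian g (m - n) -> levi_civita g D ->
  constant_curvature g D c ->
  semi_riemannian_submersion g gB pi ->
  (forall b : B, connected (pi @^-1` [set b])) ->
  totally_umbilic_fibres g D pi (m - n) ->
  c <= 0 /\
  (c = 0 -> totally_geodesic_fibres g D pi /\
            integrable_distribution n (horizontal g pi)).
Proof.
move=> n1 r2 cB _ rB [mg ng ig] lc cc sub cf [H [tr umb]].
have r1 : (0 < m - n)%N by exact: ltnW.
have mn : (n <= m)%N by rewrite ltnW // -subn_gt0.
(* The trace condition on [H] already supplies an orthonormal vertical frame near each point. *)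
have frames p : exists (e : 'I_(m - n) -> field R M) eps, vertical_frame_near g pi p e eps.
  by have [e [eps [he _]]] := tr p; exists e, eps.
have [N [vN hN TN]] := mean_curvature_field mn mg ng sub frames lc r1 tr umb.
have N0 : 0 <= c -> forall p, N p = 0.
  exact: (mean_curvature_eq0 mn rB mg ng sub frames lc cc vN hN TN r2 cB cf ig).
split=> [|c0].
  have [p _] := manifold_nonempty M; rewrite leNgt; apply/negP => c0.
  have : c <= 0 by exact: (curvature_le0 mn rB mg ng sub frames lc cc vN TN r2 (N0 (ltW c0)) n1 (ig p)).
  by rewrite leNgt c0.
have {}N0 p : N p = 0 by apply: N0; rewrite c0.
split=> [U V vU vV p|]; first by rewrite TN // N0 scaler0.
apply: (horizontal_integrable rB mg ng sub) => X Y p hX hY.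
exact: (horizontal_bracket mn rB mg ng sub frames lc cc vN TN N0).
Qed.
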